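(* Let $G=\mathrm{Spin}_9$, $H=\mathrm{Spin}_7$ with the embedding $H\subset \mathrm{Spin}_8\subset G$ described in the context, let $k\in\mathbb{N}=\{0,1,2,\dots\}$ and $\mu=k\epsilon_1\in P^+_H$. Then $$P^+_G(\mu)=\{a_1\epsilon_1+a_2\epsilon_2+a_3\epsilon_3+a_4\epsilon_4\in P^+_G:\ a_2+a_4\ge k\ge a_2-a_4\}.$$ Moreover, put $$B(\mu)=\{s(\varpi_2-\varpi_4)+t(\varpi_3-\varpi_4)+k\varpi_4:\ s,t\in\mathbb{N},\ s+t\le k\}.$$ Then the map $$(\mathbb{N}\varpi_1+\mathbb{N}\varpi_4)\times B(\mu)\to P^+_G(\mu),\qquad (\sigma,b)\mapsto \sigma+b,$$ is a bijection of sets.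
   Context: Groups are complex algebraic groups. $P^+_G$ is the set of dominant integral weights of $G=\mathrm{Spin}_9$ in standard coordinates: $\sum a_i\epsilon_i$ with $a_1\ge a_2\ge a_3\ge a_4\ge0$, all $a_i\in\mathbb{Z}$ or all $a_i\in\frac12+\mathbb{Z}$. The fundamental weights are $\varpi_1=\epsilon_1$, $\varpi_2=\epsilon_1+\epsilon_2$, $\varpi_3=\epsilon_1+\epsilon_2+\epsilon_3$, $\varpi_4=\frac12(\epsilon_1+\epsilon_2+\epsilon_3+\epsilon_4)$. The weight $\epsilon_1$ of $H$ is the highest weight of the $7$-dimensional vector representation of $\mathrm{Spin}_7$. The subgroup $H\cong\mathrm{Spin}_7$ lies in $\mathrm{Spin}_8\subset \mathrm{Spin}_9$ (standard embedding), where $\mathrm{Spin}_7\subset\mathrm{Spin}_8$ is the image of the standard $\mathrm{Spin}_7$ under an outer automorphism of $\mathrm{Spin}_8$ interchanging the simple roots $\alpha_1$ and $\alpha_3$; equivalently, the image of $H$ in $\mathrm{SO}_9$ is the image of the spin representation $\mathrm{Spin}_7\to \mathrm{SO}_8\subset\mathrm{SO}_9$. For $\mu\in P^+_H$, $P^+_G(\mu)=\{\lambda\in P^+_G: m^{G,H}_\lambda(\mu)=1\}$, where $m^{G,H}_\lambda(\mu)$ is the multiplicity of the irreducible $H$-representation of highest weight $\mu$ in the restriction to $H$ of the irreducible $G$-representation of highest weight $\lambda$. *)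

(* Defs.v *)
From HB Require Import structures.
From mathcomp Require Import all_boot all_order all_algebra.
From mathcomp Require Import mpoly complex.
From mathcomp Require Import boolp classical_sets functions reals.

Set Implicit Arguments.
Unset Strict Implicit.
Unset Printing Implicit Defensive.

Import Order.TTheory GRing.Theory Num.Theory.
Local Open Scope ring_scope.

(* The groups Spin_(2l+1)(C), for C a numClosedFieldType (the theorem takes
   C = R[i]).  The even Clifford algebra of the quadratic space C^(2l+1), with
   q(v) = \sum_i v_i^2, is isomorphic to the full matrix algebra of size 2^l
   through the spin representation, so Spin_(2l+1) is realized as a closed
   subgroup of SL_(2^l)(C) (for l > 0). *)

(* 2 ^ l, in a form suited to block decomposition *)
Fixpoint spindim (l : nat) : nat :=
  if l is l'.+1 then (spindim l' + spindim l')%N else 1%N.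

(* Brauer-Weyl matrices; only the indices k <= 2l are used. *)
Fixpoint gamma (C : numClosedFieldType) (l k : nat) : 'M[C]_(spindim l) :=
  match l return 'M[C]_(spindim l) with
  | 0 => 1%:M
  | l'.+1 =>
    match k with
    | 0 => block_mx 0 1%:M 1%:M 0
    | 1 => block_mx 0 (- 'i)%:M 'i%:M 0
    | k'.+2 => block_mx (gamma C l' k') 0 0 (- gamma C l' k')
    end
  end.

Lemma gamma_clifford (C : numClosedFieldType) (l i j : nat) :
  (i <= l.*2)%N -> (j <= l.*2)%N ->
  gamma C l i *m gamma C l j + gamma C l j *m gamma C l i
    = ((i == j)%:R *+ 2)%:M.
Proof.
elim: l i j => [|l IH] [|[|i]] [|[|j]] //=; rewrite ?doubleS ?ltnS => hi hj.
- by rewrite mul1mx -raddfD /=.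
all: rewrite !mulmx_block ?mul0mx ?mulmx0 ?mul1mx ?mulmx1 ?add0r ?addr0.
all: rewrite ?mulNmx ?mulmxN ?opprK ?mul_scalar_mx ?mul_mx_scalar.
all: rewrite ?add_block_mx ?addr0 ?scale_scalar_mx ?scalerN ?scaleNr ?addNr ?subrr.
all: rewrite ?mulNr ?mulrN ?mulCii ?opprK ?raddfN /= ?mul1mx ?addNr ?subrr.
all: try by rewrite ?mul0rn ?raddf0 ?block_mx0 // -?raddfD /= -scalar_mx_block.
by rewrite (IH _ _ hi hj) -scalar_mx_block.
Qed.

Section SpinGroups.

Variable C : numClosedFieldType.

(* the Clifford element attached to a vector of C^(2l+1) *)
Definition cliff (l : nat) (v : 'cV[C]_(l.*2.+1)) : 'M[C]_(spindim l) :=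
  \sum_(i < l.*2.+1) v i 0 *: gamma C l i.

Definition unit_vector (l : nat) (v : 'cV[C]_(l.*2.+1)) : Prop :=
  \sum_(i < l.*2.+1) v i 0 ^+ 2 = 1.

(* Spin_(2l+1)(C): the products of an even number of unit vectors *)
Definition spin (l : nat) : set 'M[C]_(spindim l) :=
  fun g => exists s : seq 'cV[C]_(l.*2.+1),
    [/\ ~~ odd (size s), forall v, v \in s -> unit_vector v
      & g = \prod_(v <- s) cliff v].

(* A is the image of g under the double cover Spin_(2l+1) -> SO_(2l+1), acting
   on column vectors. *)
Definition so_image (l : nat) (g : 'M[C]_(spindim l)) (A : 'M[C]_(l.*2.+1)) :
    Prop :=
  forall v : 'cV[C]_(l.*2.+1), g *m cliff v *m invmx g = cliff (A *m v).

(* Regular maps on a closed subgroup S of SL_N: the determinant is 1 on S, so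
   the coordinate ring consists of the restrictions of the polynomials in the
   matrix entries. *)
Definition regular_on (N n : nat) (S : set 'M[C]_N) (f : 'M[C]_N -> 'M[C]_n) :
    Prop :=
  forall i j, exists p : {mpoly C[N * N]},
    forall g, S g -> f g i j = p.@[fun k => mxvec g 0 k].

(* Homomorphisms of algebraic groups S -> GL_n; the values of f outside S are
   irrelevant. *)
Definition alg_morphism (N n : nat) (S : set 'M[C]_N)
    (f : 'M[C]_N -> 'M[C]_n) : Prop :=
  [/\ f 1%:M = 1%:M,
      forall g h, S g -> S h -> f (g *m h) = f g *m f h
    & regular_on S f].

Definition irreducible_rep (N n : nat) (S : set 'M[C]_N)
    (rho : 'M[C]_N -> 'M[C]_n) : Prop :=
  [/\ alg_morphism S rho, (0 < n)%N
    & forall U : {vspace 'cV[C]_n},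
        (forall g v, S g -> v \in U -> rho g *m v \in U) ->
        U = 0%VS \/ U = fullv].

(* The maximal torus is generated by the elements torus_elt l j z, j < l,
   z != 0.  Its element at j multiplies the isotropic vector
   iso_plus l j = e_(2j) + i e_(2j+1) by z ^ 2 and its conjugate
   iso_minus l j by z ^ -2 under so_image, so the weight
   \sum_j a_j epsilon_j takes the value z ^ (2 a_j) on it (the coordinates
   j = 0, ..., l - 1 here are 1, ..., l in the usual numbering). *)
Definition torus_elt (l j : nat) (z : C) : 'M[C]_(spindim l) :=
  ((z + z^-1) / 2)%:M
  + ((z - z^-1) / (2 * 'i)) *: (gamma C l j.*2 *m gamma C l j.*2.+1).

Definition iso_plus (l j : nat) : 'M[C]_(spindim l) :=
  gamma C l j.*2 + 'i *: gamma C l j.*2.+1.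
Definition iso_minus (l j : nat) : 'M[C]_(spindim l) :=
  gamma C l j.*2 - 'i *: gamma C l j.*2.+1.

(* The root subgroups of the positive roots
   epsilon_j - epsilon_k, epsilon_j + epsilon_k (j < k) and epsilon_j. *)
Inductive pos_root_elt (l : nat) : 'M[C]_(spindim l) -> Prop :=
| RootSub j k t : (j < k < l)%N ->
    pos_root_elt (1%:M + t *: (iso_plus l j *m iso_minus l k))
| RootAdd j k t : (j < k < l)%N ->
    pos_root_elt (1%:M + t *: (iso_plus l j *m iso_plus l k))
| RootShort j t : (j < l)%N ->
    pos_root_elt (1%:M + t *: (iso_plus l j *m gamma C l l.*2)).

(* Weights are row vectors of coordinates in the epsilon_j; for a half-integer
   a, numq (2 * a) is the integer 2 * a. *)
Definition highest_weight (l n : nat) (rho : 'M[C]_(spindim l) -> 'M[C]_n)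
    (lam : 'rV[rat]_l) : Prop :=
  exists v : 'cV[C]_n,
    [/\ v != 0,
        forall (j : 'I_l) (z : C), z != 0 ->
          rho (torus_elt l j z) *m v = z ^ numq (2 * lam 0 j) *: v
      & forall u, pos_root_elt u -> rho u *m v = v].

Definition irrep_of_hw (l n : nat) (lam : 'rV[rat]_l)
    (rho : 'M[C]_(spindim l) -> 'M[C]_n) : Prop :=
  irreducible_rep (@spin l) rho /\ highest_weight rho lam.

(* has_mult phi lam mu m: the irreducible representation V_lam of
   G = Spin_(2lG+1), restricted along phi : H = Spin_(2lH+1) -> G, contains the
   irreducible representation W_mu of H with multiplicity
   m = dim Hom_H(W_mu, V_lam). *)
Definition has_mult (lH lG : nat)
    (phi : 'M[C]_(spindim lH) -> 'M[C]_(spindim lG))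
    (lam : 'rV[rat]_lG) (mu : 'rV[rat]_lH) (m : nat) : Prop :=
  exists (n : nat) (V : 'M[C]_(spindim lG) -> 'M[C]_n)
         (p : nat) (W : 'M[C]_(spindim lH) -> 'M[C]_p)
         (Hom : {vspace 'M[C]_(n, p)}),
    [/\ irrep_of_hw lam V, irrep_of_hw mu W,
        forall f : 'M[C]_(n, p),
          f \in Hom <-> (forall h, spin h -> f *m W h = V (phi h) *m f)
      & \dim Hom = m].

(* Spin_7 -> Spin_9 whose composition with Spin_9 -> SO_9 is the spin
   representation into SO_8, embedded in SO_9 as the stabilizer of the last
   basis vector.  With the realization above the spin representation of Spin_7
   is the inclusion of spin 3 into GL_8, which is put into SO_8 by a change of
   basis P. *)
Definition spin7_embedding (phi : 'M[C]_(spindim 3) -> 'M[C]_(spindim 4)) :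
    Prop :=
  [/\ alg_morphism (@spin 3) phi,
      forall h, @spin 3 h -> @spin 4 (phi h)
    & exists2 P : 'M[C]_(spindim 3), P \in unitmx &
        forall h, @spin 3 h ->
          @so_image 4 (phi h)
            (block_mx (P *m h *m invmx P) 0 0 1%:M : 'M_(spindim 3 + 1))].

End SpinGroups.

Definition dominant (l : nat) : set 'rV[rat]_l :=
  fun lam =>
  [/\ forall i j : 'I_l, (i <= j)%N -> lam 0 j <= lam 0 i,
      forall i, 0 <= lam 0 i
    & (forall i, lam 0 i \is a Num.int)
      \/ (forall i, lam 0 i - 1 / 2 \is a Num.int)].

Definition eps (l : nat) (i : 'I_l) : 'rV[rat]_l := delta_mx 0 i.

(* The fundamental weights of Spin_9; eps is indexed from 0. *)
Definition varpi1 : 'rV[rat]_4 := eps 0.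
Definition varpi2 : 'rV[rat]_4 := eps 0 + eps 1.
Definition varpi3 : 'rV[rat]_4 := eps 0 + eps 1 + eps 2.
Definition varpi4 : 'rV[rat]_4 := (1 / 2) *: (eps 0 + eps 1 + eps 2 + eps 3).

(* P^+_G(mu) for G = Spin_9 and H = Spin_7 embedded by phi *)
Definition Pplus (C : numClosedFieldType)
    (phi : 'M[C]_(spindim 3) -> 'M[C]_(spindim 4)) (mu : 'rV[rat]_3) :
    set 'rV[rat]_4 :=
  fun lam => dominant lam /\ has_mult phi lam mu 1.

Definition cone14 : set 'rV[rat]_4 :=
  fun sigma => exists a b : nat, sigma = varpi1 *+ a + varpi4 *+ b.

(* B(k epsilon_1) *)
Definition Bset (k : nat) : set 'rV[rat]_4 :=
  fun b => exists s t : nat, (s + t <= k)%N /\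
    b = (varpi2 - varpi4) *+ s + (varpi3 - varpi4) *+ t + varpi4 *+ k.

(* Main.v *)
(* Spin_n is generated by the unipotent elements 1 + t a x (a a unit vector, x an
   isotropic vector orthogonal to a, multiplied in the Clifford algebra), so a
   regular homomorphism is controlled by its differential, computed on the
   rational curves t |-> 1 + t a x and on the one-parameter tori.  An element of
   Spin_9 conjugates phi to a homomorphism whose differential is explicit.

   Upper bound.  Let xi be the functional on V_lambda of weight lambda killed by
   the negative root vectors, and w the highest weight vector of W_mu.  The
   negative Borel subalgebra b of so_9 and the image of the parabolic subalgebra
   p of so_7 that stabilizes the line of w span so_9.  Hence T |-> xi (T w) is
   injective on Hom_H(W_mu, V_lambda), which is at most a line.  The image of p
   contains an element of E + b, for E a root vector of the short simple root
   epsilon_4.  If m is maximal with xi E^m (T w) != 0, the eigenvalue of this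
   element on w gives a_2 + a_4 = k + m, where 0 <= m <= 2 a_4 by sl_2 theory.

   Lower bound.  Consider representations of Spin_9 compatible with conjugate
   transposition, with a highest weight vector v of weight lambda, a vector w
   which is a highest weight vector of weight k epsilon_1 for Spin_7, and
   <w, v> != 0.  Tensor products preserve these data and add the pairs
   (lambda, k).  The pairs (varpi_1, 0), (varpi_2, 1), (varpi_3, 1),
   (varpi_4, 0), (varpi_4, 1) occur in the spin representation S and in S (x) S,
   and they generate all (lambda, k) with a_2 - a_4 <= k <= a_2 + a_4.
   Orthogonal projections onto suitable irreducible constituents give irreducible
   V_lambda and W_mu with a nonzero intertwiner. *)

From HB Require Import structures.
Require Import Defs.
From mathcomp Require Import all_boot all_order all_algebra.
From mathcomp Require Import mpoly complex mxtens.
From mathcomp Require Import boolp classical_sets functions reals.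
From mathcomp Require Import ring lra zify.

Set Implicit Arguments.
Unset Strict Implicit.
Unset Printing Implicit Defensive.

Import Order.TTheory GRing.Theory Num.Theory.
Local Open Scope classical_set_scope.
Local Open Scope ring_scope.

(** The upper bound hinges on a count: the negative Borel subalgebra of so_9 has dimension 20, the
    parabolic subalgebra of so_7 has dimension 16, and 20 + 16 = 36 = dim so_9. That their sum is
    everything depends on the position of H relative to the chosen Borel subalgebra; this is why phi
    is moved to a position given by one explicit matrix Q, for which spanning is a finite check over
    the Gaussian integers. Two properties of Q are needed together. Since Q^T Q is the invariant
    form of the spin representation, Schur's lemma conjugates every embedding to this position.
    Since star Q * Q is block scalar, the image of H is stable under conjugate transposition up to
    scalars, and orthogonal projections can take the place of complete reducibility. Derivatives are
    formal, on curves with polynomial numerators over powers of a fixed denominator; results on the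
    Lie algebra return to the group because f (1 + t X) is a polynomial exponential. Multiplicity is
    defined through the existence of V and W. The bound therefore concerns arbitrary V and W, while
    the lower bound has to produce both; no classification by highest weights enters. *)

(** * Derivatives of rational curves *)

Section CurveDerivatives.

Variable C : numClosedFieldType.

Lemma poly_ext (p r : {poly C}) : (forall z, p.[z] = r.[z]) -> p = r.
Proof.
move=> h; apply/eqP; rewrite -subr_eq0; apply/negPn/negP => nz.
have H rs := @max_poly_roots C (p - r) rs nz.
pose m := size (p - r); suff: (m < m)%N by rewrite ltnn.
rewrite -{1}(size_iota 0 m) -(size_map (fun i => i%:R : C)).
apply: H; last by rewrite map_inj_uniq ?iota_uniq // => x y /eqP; rewrite eqr_nat => /eqP.
by apply/allP => z _; rewrite /root hornerD hornerN h subrr.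
Qed.

(* f is a rational function with denominator a power of q, and f0, f1 are its
   value and its derivative at a. *)
Definition dcurve (q : {poly C}) (a : C) (f : C -> C) (f0 f1 : C) : Prop :=
  exists N (P : {poly C}),
    [/\ forall z, q.[z] != 0 -> f z * q.[z] ^+ N = P.[z],
        P.[a] = f0 * q.[a] ^+ N
      & P^`().[a] = f1 * q.[a] ^+ N + f0 * (q ^+ N)^`().[a]].

Variables (q : {poly C}) (a : C).
Hypothesis qa : q.[a] != 0.

Lemma dcurve_value f f0 f1 : dcurve q a f f0 f1 -> f a = f0.
Proof.
case=> N [P [h h0 _]]; have nz : q.[a] ^+ N != 0 by rewrite expf_neq0.
by apply: (mulIf nz); rewrite h // h0.
Qed.

(** The cross-multiplied numerators agree off the zeros of [q]. One more factor [q] makes the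
    identity hold at every point, hence between polynomials, where [q] can be cancelled and the
    result differentiated at [a]. *)
Lemma dcurve_uniq f f0 f1 f0' f1' :
  dcurve q a f f0 f1 -> dcurve q a f f0' f1' -> f1 = f1'.
Proof.
move=> H H'; have e0 : f0' = f0 by rewrite -(dcurve_value H) -(dcurve_value H').
case: H H' => N [P [h h0 h1]] [N' [P' [h' h0' h1']]].
have E : P * q ^+ N' * q = P' * q ^+ N * q.
  apply: poly_ext => z; rewrite !hornerE.
  have [->|nz] := eqVneq q.[z] 0; first by rewrite !mulr0.
  by rewrite -h // -h' // /=; ring.
have {}E : P * q ^+ N' = P' * q ^+ N.
  by apply: (mulIf _ E); apply: contraNneq qa => ->; rewrite horner0.
have := congr1 (fun p => p^`().[a]) E.
rewrite /= !derivM !hornerE h0 h0' h1 h1' e0 => E1.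
have nz : q.[a] ^+ N * q.[a] ^+ N' != 0 by rewrite mulf_neq0 // expf_neq0.
apply: (mulIf nz); apply/eqP; rewrite -subr_eq0.
move/eqP: E1; rewrite -subr_eq0; congr (_ == 0) => /=; ring.
Qed.

Lemma dcurve_ext f g f0 f1 : (forall z, q.[z] != 0 -> f z = g z) ->
  dcurve q a f f0 f1 -> dcurve q a g f0 f1.
Proof.
by move=> e [N [P [h h0 h1]]]; exists N, P; split=> // z hz; rewrite -e // h.
Qed.

Lemma dcurve_poly (P : {poly C}) : dcurve q a (horner P) P.[a] P^`().[a].
Proof.
exists 0%N, P; split=> [z _||]; rewrite ?expr0 ?mulr1 //.
by rewrite derivC horner0 mulr0 addr0.
Qed.

Lemma dcurve_const c : dcurve q a (fun _ => c) c 0.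
Proof.
have := dcurve_poly c%:P; rewrite derivC hornerC horner0.
by apply: dcurve_ext => z _; rewrite hornerC.
Qed.

Lemma dcurve_add f f0 f1 g g0 g1 : dcurve q a f f0 f1 -> dcurve q a g g0 g1 ->
  dcurve q a (fun z => f z + g z) (f0 + g0) (f1 + g1).
Proof.
case=> N [P [h h0 h1]] [N' [P' [h' h0' h1']]].
exists (N + N')%N, (P * q ^+ N' + P' * q ^+ N); split.
- by move=> z hz; rewrite !hornerE -h // -h' // exprD /=; ring.
- by rewrite !hornerE h0 h0' exprD /=; ring.
- by rewrite derivD !exprD !derivM !hornerE h0 h0' h1 h1' /=; ring.
Qed.

Lemma dcurve_mul f f0 f1 g g0 g1 : dcurve q a f f0 f1 -> dcurve q a g g0 g1 ->
  dcurve q a (fun z => f z * g z) (f0 * g0) (f1 * g0 + f0 * g1).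
Proof.
case=> N [P [h h0 h1]] [N' [P' [h' h0' h1']]].
exists (N + N')%N, (P * P'); split.
- by move=> z hz; rewrite !hornerE -h // -h' // exprD /=; ring.
- by rewrite !hornerE h0 h0' exprD /=; ring.
- by rewrite !exprD !derivM !hornerE h0 h0' h1 h1' /=; ring.
Qed.

Lemma dcurve_sum (I : Type) (r : seq I) (f : I -> C -> C) (f0 f1 : I -> C) :
  (forall i, dcurve q a (f i) (f0 i) (f1 i)) ->
  dcurve q a (fun z => \sum_(i <- r) f i z) (\sum_(i <- r) f0 i)
    (\sum_(i <- r) f1 i).
Proof.
move=> h; elim: r => [|i r IH].
  rewrite !big_nil; apply: dcurve_ext (dcurve_const 0) => z _.
  by rewrite big_nil.
rewrite !big_cons; apply: dcurve_ext (dcurve_add (h i) IH) => z _.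
by rewrite big_cons.
Qed.

Definition mcurve m n (F : C -> 'M[C]_(m, n)) (F0 F1 : 'M[C]_(m, n)) : Prop :=
  forall i j, dcurve q a (fun z => F z i j) (F0 i j) (F1 i j).

Lemma mcurve_value m n F (F0 F1 : 'M[C]_(m, n)) : mcurve F F0 F1 -> F a = F0.
Proof. by move=> h; apply/matrixP => i j; apply: dcurve_value (h i j). Qed.

Lemma mcurve_uniq m n F (F0 F1 F0' F1' : 'M[C]_(m, n)) :
  mcurve F F0 F1 -> mcurve F F0' F1' -> F1 = F1'.
Proof. by move=> h h'; apply/matrixP => i j; apply: dcurve_uniq (h i j) (h' i j). Qed.

Lemma mcurve_ext m n F F' (F0 F1 : 'M[C]_(m, n)) :
  (forall z, q.[z] != 0 -> F z = F' z) -> mcurve F F0 F1 -> mcurve F' F0 F1.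
Proof.
by move=> e h i j; apply: dcurve_ext (h i j) => z hz; rewrite e.
Qed.

Lemma mcurve_const m n (A : 'M[C]_(m, n)) : mcurve (fun _ => A) A 0.
Proof. by move=> i j; rewrite mxE; apply: dcurve_const. Qed.

Lemma mcurve_add m n F (F0 F1 : 'M[C]_(m, n)) G (G0 G1 : 'M[C]_(m, n)) :
  mcurve F F0 F1 -> mcurve G G0 G1 ->
  mcurve (fun z => F z + G z) (F0 + G0) (F1 + G1).
Proof.
move=> h h' i j; rewrite !mxE.
by apply: dcurve_ext (dcurve_add (h i j) (h' i j)) => z _; rewrite mxE.
Qed.

Lemma mcurve_scale m n f f0 f1 (A : 'M[C]_(m, n)) :
  dcurve q a f f0 f1 -> mcurve (fun z => f z *: A) (f0 *: A) (f1 *: A).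
Proof.
move=> h i j; have := dcurve_mul h (dcurve_const (A i j)).
rewrite mulr0 addr0 !mxE; apply: dcurve_ext => z _.
by rewrite mxE.
Qed.

Lemma mcurve_mul m n p F (F0 F1 : 'M[C]_(m, n)) G (G0 G1 : 'M[C]_(n, p)) :
  mcurve F F0 F1 -> mcurve G G0 G1 ->
  mcurve (fun z => F z *m G z) (F0 *m G0) (F1 *m G0 + F0 *m G1).
Proof.
move=> h h' i j.
have := dcurve_sum (index_enum 'I_n) (fun k => dcurve_mul (h i k) (h' k j)).
rewrite big_split /= !mxE.
by apply: dcurve_ext => z _; rewrite mxE.
Qed.

Lemma mcurve_mull m n p (A : 'M[C]_(m, n)) G (G0 G1 : 'M[C]_(n, p)) :
  mcurve G G0 G1 -> mcurve (fun z => A *m G z) (A *m G0) (A *m G1).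
Proof.
by move=> h; have := mcurve_mul (mcurve_const A) h; rewrite mul0mx add0r.
Qed.

Lemma mcurve_mulr m n p F (F0 F1 : 'M[C]_(m, n)) (A : 'M[C]_(n, p)) :
  mcurve F F0 F1 -> mcurve (fun z => F z *m A) (F0 *m A) (F1 *m A).
Proof.
by move=> h; have := mcurve_mul h (mcurve_const A); rewrite mulmx0 addr0.
Qed.

(** Chain rule: the property holds for constants and variables and is stable under sums and
    products. *)
Lemma dcurve_mpoly n (p : {mpoly C[n]}) (f : 'I_n -> C -> C) (x y : 'I_n -> C) :
  (forall k, dcurve q a (f k) (x k) (y k)) ->
  dcurve q a (fun z => p.@[fun k => f k z]) p.@[x]
    (\sum_k p^`M(k).@[x] * y k).
Proof.
move=> h; pose good (r : {mpoly C[n]}) := dcurve q a (fun z => r.@[fun k => f k z])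
  r.@[x] (\sum_k r^`M(k).@[x] * y k).
have goodC c : good c%:MP.
  rewrite /good mevalC big1 => [|k _]; last by rewrite mderivC meval0 mul0r.
  by apply: dcurve_ext (dcurve_const c) => z _; rewrite mevalC.
have goodM r s : good r -> good s -> good (r * s).
  move=> hr hs; rewrite /good mevalM.
  have -> : \sum_k (r * s)^`M(k).@[x] * y k =
    (\sum_k r^`M(k).@[x] * y k) * s.@[x] + r.@[x] * \sum_k s^`M(k).@[x] * y k.
    rewrite mulr_suml mulr_sumr -big_split /=; apply: eq_bigr => k _.
    by rewrite mderivM mevalD !mevalM /=; ring.
  by apply: dcurve_ext (dcurve_mul hr hs) => z _; rewrite mevalM.
have goodX i : good 'X_i.
  rewrite /good mevalXU (bigD1 i) //= mderivX mnm1E eqxx.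
  have -> : (U_(i) - U_(i))%MM = 0%MM :> 'X_{1..n} by rewrite -{1}[U_(i)%MM]add0m addmK.
  rewrite mpolyX0.
  rewrite mevalZ meval1 mulr1 mul1r big1 ?addr0 => [|k hk].
    by apply: dcurve_ext (h i) => z _; rewrite mevalXU.
  by rewrite mderivX mnm1E eq_sym (negPf hk) scale0r meval0 mul0r.
have good_sum I (r : seq I) (P : I -> {mpoly C[n]}) :
    (forall i, good (P i)) -> good (\sum_(i <- r) P i).
  move=> hP; elim: r => [|i r IH]; first by rewrite big_nil; exact (goodC 0).
  rewrite big_cons /good mevalD.
  have -> : \sum_k (P i + \sum_(j <- r) P j)^`M(k).@[x] * y k =
    \sum_k (P i)^`M(k).@[x] * y k + \sum_k (\sum_(j <- r) P j)^`M(k).@[x] * y k.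
    by rewrite -big_split /=; apply: eq_bigr => k _; rewrite mderivD mevalD mulrDl.
  by apply: dcurve_ext (dcurve_add (hP i) IH) => z _; rewrite mevalD.
suff : good p by [].
rewrite (mpolyE p); apply: good_sum => m; rewrite -mul_mpolyC.
refine (goodM _ _ (goodC _) _).
rewrite mpolyXE_id.
apply: (big_ind good) => [|r s|i _]; [exact (goodC 1)|exact (goodM r s)|].
elim: (m i) => [|k IH]; first exact (goodC 1).
by rewrite exprS; exact (goodM _ _ (goodX i) IH).
Qed.

End CurveDerivatives.

(** * Differentials of regular maps at the identity *)

Section Differential.

Variable C : numClosedFieldType.

(** The differential is specified by its effect on the curves through the identity inside [S], so
    only its values on their velocities are determined. The curves used are polynomial ([q] = 1, [a]
    = 0) or come from a torus ([q] = 'X, [a] = 1). *)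
Definition is_diff N n (S : set 'M[C]_N) (f : 'M[C]_N -> 'M[C]_n)
    (df : {linear 'M[C]_N -> 'M[C]_n}) : Prop :=
  forall (q : {poly C}) a G G1, q.[a] != 0 -> (forall z, q.[z] != 0 -> S (G z)) ->
    mcurve q a G 1%:M G1 -> mcurve q a (fun z => f (G z)) (f 1%:M) (df G1).

Lemma regular_diff N n (S : set 'M[C]_N) (f : 'M[C]_N -> 'M[C]_n) :
  regular_on S f -> exists df, is_diff S f df.
Proof.
move=> reg.
have /choice[p hp] : forall ij : 'I_n * 'I_n, exists p : {mpoly C[N * N]},
    forall g, S g -> f g ij.1 ij.2 = p.@[fun k => mxvec g 0 k].
  by move=> [i j]; apply: reg.
pose df X := \matrix_(i < n, j < n)
  \sum_k (p (i, j))^`M(k).@[fun k => mxvec 1%:M 0 k] * mxvec X 0 k.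
have df_lin : linear df.
  move=> c X Y; apply/matrixP => i j; rewrite !mxE mulr_sumr -big_split /=.
  by apply: eq_bigr => k _; rewrite linearP !mxE mulrDr mulrCA.
pose L := GRing.isLinear.Build C _ _ _ df df_lin.
pose dfL : {linear 'M[C]_N -> 'M[C]_n} := HB.pack df L.
exists dfL => q a G G1 qa SG hG i j; rewrite [dfL G1 i j]mxE.
have S1 : S 1%:M by rewrite -(mcurve_value qa hG); apply: SG.
rewrite (hp (i, j)) //.
apply: dcurve_ext (dcurve_mpoly (p (i, j)) (f := fun k z => mxvec (G z) 0 k) _) => //.
  by move=> z hz; rewrite -(hp (i, j)) //; apply: SG.
move=> k; case/mxvec_indexP: k => r s; rewrite !mxvecE.
by apply: dcurve_ext (hG r s) => z _; rewrite mxvecE.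
Qed.

End Differential.

(** * Clifford relations and generators of the spin group *)

Section SpinGroup.

Variables (C : numClosedFieldType) (l : nat).

Notation vec := 'cV[C]_(l.*2.+1).

Definition dot (v w : vec) : C := \sum_i v i 0 * w i 0.

Lemma dotC v w : dot v w = dot w v.
Proof. by apply: eq_bigr => i _; rewrite mulrC. Qed.

Lemma dotDl u v w : dot (u + v) w = dot u w + dot v w.
Proof. by rewrite -big_split; apply: eq_bigr => i _; rewrite mxE mulrDl. Qed.

Lemma dotZl c v w : dot (c *: v) w = c * dot v w.
Proof. by rewrite mulr_sumr; apply: eq_bigr => i _; rewrite mxE mulrA. Qed.

Lemma dotDr u v w : dot w (u + v) = dot w u + dot w v.
Proof. by rewrite !(dotC w) dotDl. Qed.

Lemma dotZr c v w : dot w (c *: v) = c * dot w v.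
Proof. by rewrite !(dotC w) dotZl. Qed.

Lemma dotNl v w : dot (- v) w = - dot v w.
Proof. by rewrite -scaleN1r dotZl mulN1r. Qed.

Lemma dotNr v w : dot w (- v) = - dot w v.
Proof. by rewrite !(dotC w) dotNl. Qed.

Definition dotE := (dotDl, dotDr, dotZl, dotZr, dotNl, dotNr).

Lemma unit_vectorE (v : vec) : unit_vector v <-> dot v v = 1.
Proof.
rewrite /unit_vector /dot.
by under eq_bigr => i _ do rewrite expr2.
Qed.

Definition basis_vec (k : 'I_l.*2.+1) : vec := delta_mx k 0.

Lemma dot_basis k v : dot (basis_vec k) v = v k 0.
Proof.
rewrite /dot (bigD1 k) //= big1 => [|i /negPf ik]; last by rewrite mxE ik mul0r.
by rewrite mxE !eqxx mul1r addr0.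
Qed.

Lemma cliffD (v w : vec) : cliff (v + w) = cliff v + cliff w.
Proof.
by rewrite -big_split; apply: eq_bigr => i _; rewrite mxE scalerDl.
Qed.

Lemma cliffZ c (v : vec) : cliff (c *: v) = c *: cliff v.
Proof.
by rewrite scaler_sumr; apply: eq_bigr => i _; rewrite mxE scalerA.
Qed.

Lemma cliff0 : cliff (0 : vec) = 0.
Proof. by rewrite -(scale0r (0 : vec)) cliffZ scale0r. Qed.

Lemma cliffN (v : vec) : cliff (- v) = - cliff v.
Proof. by rewrite -scaleN1r cliffZ scaleN1r. Qed.

Lemma cliff_sum (I : Type) (r : seq I) (F : I -> vec) :
  cliff (\sum_(i <- r) F i) = \sum_(i <- r) cliff (F i).
Proof. exact: (big_morph _ cliffD cliff0). Qed.

Lemma cliff_basis k : cliff (basis_vec k) = gamma C l k.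
Proof.
rewrite /cliff (bigD1 k) //= big1 => [|i /negPf ik]; last by rewrite mxE ik scale0r.
by rewrite mxE !eqxx scale1r addr0.
Qed.

Lemma mulmx_cliff (v w : vec) : cliff v *m cliff w =
  \sum_i \sum_j (v i 0 * w j 0) *: (gamma C l i *m gamma C l j).
Proof.
rewrite /cliff mulmx_suml; apply: eq_bigr => i _.
rewrite mulmx_sumr; apply: eq_bigr => j _.
by rewrite -scalemxAl -scalemxAr scalerA.
Qed.

Lemma cliff_clifford (v w : vec) :
  cliff v *m cliff w + cliff w *m cliff v = (dot v w *+ 2)%:M.
Proof.
rewrite !mulmx_cliff [X in _ + X]exchange_big -big_split /dot -sumrMnl raddf_sum /=.
apply: eq_bigr => i _; rewrite -big_split /= (bigD1 i) //= big1 => [|j ij].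
  rewrite addr0 (mulrC (w i 0)) -scalerDr gamma_clifford ?leq_ord // eqxx.
  by rewrite scale_scalar_mx mulrnAr mulr1.
rewrite (mulrC (w j 0)) -scalerDr gamma_clifford ?leq_ord //.
move: ij; rewrite -val_eqE eq_sym => ij.
by rewrite (negPf ij) mul0rn raddf0 scaler0.
Qed.

Lemma cliff_sqr (v : vec) : cliff v *m cliff v = (dot v v)%:M.
Proof.
have := cliff_clifford v v; rewrite -mulr2n -scaler_nat => /(congr1 ( *:%R 2^-1)).
rewrite scalerA mulVf ?pnatr_eq0 // scale1r => ->.
by rewrite scale_scalar_mx -(mulr_natl (dot v v)) mulrA mulVf ?pnatr_eq0 ?mul1r.
Qed.

Lemma cliff_anticomm (v w : vec) : dot v w = 0 ->
  cliff v *m cliff w = - (cliff w *m cliff v).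
Proof.
by move=> e; apply/eqP; rewrite -addr_eq0 cliff_clifford e mul0rn raddf0.
Qed.

Lemma spin1 : spin (1%:M : 'M[C]_(spindim l)).
Proof. by exists [::]; rewrite big_nil. Qed.

Lemma spinM g h : spin g -> spin h -> @spin C l (g *m h).
Proof.
case=> s [os us ->] [s' [os' us' ->]]; exists (s ++ s'); split.
- by rewrite size_cat oddD (negPf os) (negPf os').
- by move=> v; rewrite mem_cat => /orP[/us|/us'].
- by rewrite big_cat.
Qed.

Lemma prod_cliff_rev (s : seq vec) : (forall v, v \in s -> unit_vector v) ->
  (\prod_(v <- s) cliff v) *m (\prod_(v <- rev s) cliff v) = 1%:M.
Proof.
elim: s => [|v s IH] us; first by rewrite !big_nil mulmx1.
rewrite rev_cons big_cons -cats1 big_cat big_seq1 -!mulmxE -mulmxA (mulmxA _ _ (cliff v)).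
rewrite IH ?mul1mx => [|w ws]; last by apply: us; rewrite inE ws orbT.
by rewrite cliff_sqr; have /unit_vectorE -> := us v (mem_head _ _).
Qed.

Lemma spinV g : spin g -> exists h, [/\ @spin C l h, g *m h = 1%:M & h *m g = 1%:M].
Proof.
case=> s [os us ->]; exists (\prod_(v <- rev s) cliff v); split.
- exists (rev s); split=> //; first by rewrite size_rev.
  by move=> v; rewrite mem_rev => /us.
- exact: prod_cliff_rev.
- rewrite -{2}(revK s); apply: prod_cliff_rev => v.
  by rewrite mem_rev => /us.
Qed.

Lemma spin_unitmx g : @spin C l g -> g \in unitmx.
Proof. by case/spinV => h [_ gh _]; case/mulmx1_unit: gh. Qed.

Lemma spin_invmx g : spin g -> @spin C l (invmx g).
Proof.
move=> sg; have [h [sh gh _]] := spinV sg.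
by rewrite -[invmx g]mulmx1 -gh mulmxA mulVmx ?mul1mx // spin_unitmx.
Qed.

(* The elements 1 + t X, for X as below, are the unipotent elements that fix
   the orthogonal complement of a and x; long and short root elements are of
   this form. *)
Definition siegel (X : 'M[C]_(spindim l)) : Prop :=
  exists v x : vec, [/\ dot v v = 1, dot x x = 0, dot v x = 0
    & X = cliff v *m cliff x].

Lemma siegel_sqr X : siegel X -> X *m X = 0.
Proof.
case=> v [x [_ xx vx ->]]; rewrite {1}cliff_anticomm // mulNmx mulmxA.
rewrite -(mulmxA (cliff x)) cliff_sqr.
rewrite mul_mx_scalar -scalemxAl cliff_sqr xx.
by rewrite scale_scalar_mx mulr0 raddf0 oppr0.
Qed.

Lemma siegel_spin X t : siegel X -> spin (1%:M + t *: X).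
Proof.
case=> v [x [vv xx vx ->]]; exists [:: v; v + t *: x]; split=> //.
  move=> w; rewrite !inE => /orP[/eqP->|/eqP->]; apply/unit_vectorE => //.
  by rewrite !dotE (dotC x v) vv vx xx !mulr0 !addr0.
rewrite big_cons big_seq1 -mulmxE cliffD cliffZ mulmxDr cliff_sqr vv.
by rewrite -scalemxAr.
Qed.

Lemma siegelN X : siegel X -> siegel (- X).
Proof.
case=> v [x [vv xx vx ->]]; exists v, (- x); split=> //.
- by rewrite !dotE xx !oppr0.
- by rewrite !dotE vx oppr0.
- by rewrite cliffN mulmxN.
Qed.

(** The three equations make [w - v] isotropic and orthogonal to [v]. *)
Lemma unit_pair_siegel (v w : vec) : dot v v = 1 -> dot w w = 1 -> dot v w = 1 ->
  exists2 X, siegel X & cliff v *m cliff w = 1%:M + X.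
Proof.
move=> vv ww vw; exists (cliff v *m cliff (w - v)); last first.
  by rewrite cliffD cliffN mulmxDr mulmxN cliff_sqr vv addrCA subrr addr0.
by exists v, (w - v); split=> //; rewrite !dotE ?vv ?ww ?(dotC w) ?vw; ring.
Qed.

Hypothesis l_gt0 : (0 < l)%N.

Lemma unit_orthogonal (v w : vec) : dot v v = 1 -> dot v w = 0 ->
  dot w w = 1 \/ w = 0 -> exists z, [/\ dot z z = 1, dot z v = 0 & dot z w = 0].
Proof.
move=> vv vw ww.
(* [P i] is the projection of a basis vector to the orthogonal complement of [v] and [w]. The
   numbers dot (P i) (P i) add up to (2l + 1) - 1 - dot w w >= 2l - 1 > 0, so some [P i] is not
   isotropic and can be normalized. *)
pose P i := basis_vec i - v i 0 *: v - w i 0 *: w.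
have Pv i : dot (P i) v = 0.
  by rewrite /P !dotE dot_basis vv (dotC w) vw; ring.
have Pw i : dot (P i) w = 0.
  rewrite /P !dotE dot_basis vw; case: ww => [->|->]; first by ring.
  by rewrite mxE; ring.
have PP i : dot (P i) (P i) = 1 - v i 0 ^+ 2 - w i 0 ^+ 2.
  have -> : dot (P i) (P i) =
      dot (P i) (basis_vec i) - v i 0 * dot (P i) v - w i 0 * dot (P i) w.
    by rewrite {2}/P !dotDr !dotNr !dotZr.
  rewrite Pv Pw dotC dot_basis /P !mxE !eqxx /=; ring.
have [i nz] : exists i, dot (P i) (P i) != 0.
  apply: contrapT => nex; have: \sum_i dot (P i) (P i) = 0.
    by apply: big1 => i _; apply/eqP/negPn/negP => nz; apply: nex; exists i.
  under eq_bigr => i _ do rewrite PP.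
  rewrite !sumrB sumr_const card_ord.
  have -> : \sum_i v i 0 ^+ 2 = 1 by exact/unit_vectorE.
  have -> : \sum_i w i 0 ^+ 2 = (dot w w == 1)%:R.
    case: ww => [ww|->].
      by rewrite ww eqxx; apply/unit_vectorE.
    rewrite [dot _ _]big1 => [|i _]; last by rewrite mxE mul0r.
    by rewrite eq_sym oner_eq0 big1 // => i _; rewrite mxE expr0n.
  move: l_gt0; case: (l) => // l' _; rewrite doubleS.
  rewrite -[l'.*2.+3]addn2 natrD; case: eqP => _ /= /eqP.
    by rewrite (_ : _ - _ - _ = l'.*2.+1%:R) ?pnatr_eq0 //; ring.
  by rewrite (_ : _ - _ - _ = l'.*2.+2%:R) ?pnatr_eq0 // -[l'.*2.+2]addn1 natrD; ring.
exists ((sqrtC (dot (P i) (P i)))^-1 *: P i); split.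
- by rewrite dotZl dotZr mulrA -expr2 exprVn sqrtCK mulVf.
- by rewrite dotZl Pv mulr0.
- by rewrite dotZl Pw mulr0.
Qed.

(** With c = dot v w, the vector (v + w) / (1 + c) has the right products with [v] and [w], but its
    norm is 2 / (1 + c). Adding a vector of norm (c - 1) / (1 + c) orthogonal to both corrects this.
    For c = 1 the vector [v] itself serves. *)
Lemma unit_bridge (v w : vec) : dot v v = 1 -> dot w w = 1 -> dot v w != -1 ->
  exists z, [/\ dot z z = 1, dot v z = 1 & dot z w = 1].
Proof.
move=> vv ww vwN1; pose c := dot v w.
have c1 : 1 + c != 0 by rewrite addrC addr_eq0.
have [c_1|c_1] := eqVneq c 1.
  by exists v; split.
have sc : 1 - c ^+ 2 != 0.
  have -> : 1 - c ^+ 2 = (1 - c) * (1 + c) by ring.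
  by rewrite mulf_neq0 // subr_eq0 eq_sym.
pose s := sqrtC (1 - c ^+ 2).
have s2 : s ^+ 2 = 1 - c ^+ 2 by rewrite sqrtCK.
have s0 : s != 0 by rewrite sqrtC_eq0.
pose u := s^-1 *: (w - c *: v).
have vu : dot v u = 0 by rewrite /u !dotE vv -/c; ring.
have uu : dot u u = 1.
  have -> : dot u u = s^-1 ^+ 2 * (1 - c ^+ 2).
    by rewrite /u !dotE vv ww (dotC w) -/c; ring.
  by rewrite -s2 -exprMn mulVf // expr1n.
have [z [zz zv zu]] := unit_orthogonal vv vu (or_introl uu).
have zw : dot z w = 0.
  have -> : w = s *: u + c *: v by rewrite /u scalerA mulfV // scale1r subrK.
  by rewrite dotDr (dotZr s u) (dotZr c v) zu zv; ring.
pose r := sqrtC ((c - 1) / (1 + c)).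
have r2 : r ^+ 2 = (c - 1) / (1 + c) by rewrite sqrtCK.
exists ((1 + c)^-1 *: (v + w) + r *: z); split.
- transitivity ((1 + c)^-1 ^+ 2 * (2 + 2 * c) + r ^+ 2).
    rewrite !dotE vv ww zz (dotC v z) (dotC w z) zv zw (dotC w v) -/c; ring.
  by rewrite r2; field.
- by rewrite !dotE vv (dotC v z) zv -/c; field.
- by rewrite !dotE ww zw -/c; field.
Qed.

Definition spin_generated (K : 'M[C]_(spindim l) -> Prop) : Prop :=
  forall X g, siegel X -> K g -> K ((1%:M + X) *m g).

(** Inserting z z = 1 between [v] and [w] splits the product: a bridge gives two Siegel factors. If
    dot v w = -1 there is no bridge, and a unit vector orthogonal to [v], with suitable sign, is
    inserted so that neither half has product -1. *)
Lemma cliff_pair_generated K (v w : vec) g : spin_generated K ->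
  dot v v = 1 -> dot w w = 1 -> K g -> K (cliff v *m cliff w *m g).
Proof.
move=> Kgen.
have step u u' h : dot u u = 1 -> dot u' u' = 1 -> dot u u' = 1 -> K h ->
    K (cliff u *m cliff u' *m h).
  by move=> hu hu' huu' Kh; have [X sX ->] := unit_pair_siegel hu hu' huu'; apply: Kgen.
have insert u z u' h : dot z z = 1 ->
    cliff u *m cliff u' *m h = cliff u *m cliff z *m (cliff z *m cliff u' *m h).
  by move=> zz; rewrite !mulmxA -(mulmxA (cliff u) (cliff z)) cliff_sqr zz mulmx1.
have near u u' h : dot u u = 1 -> dot u' u' = 1 -> dot u u' != -1 -> K h ->
    K (cliff u *m cliff u' *m h).
  move=> hu hu' huu' Kh; have [z [zz uz zu']] := unit_bridge hu hu' huu'.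
  by rewrite (insert _ u z) //; apply: (step) => //; apply: (step).
move=> vv ww Kg; have [vw|] := eqVneq (dot v w) (-1); last by move=> vw; exact: near.
have v0 : dot v 0 = 0 by rewrite -(scale0r v) dotZr mul0r.
have [z [zz zv _]] := unit_orthogonal vv v0 (or_intror erefl).
have : exists u, [/\ dot u u = 1, dot u v = 0 & dot u w != -1].
  have [zw|zw] := eqVneq (dot z w) (-1); last by exists z.
  exists (- z); split; rewrite ?dotE ?zz ?zv ?opprK ?oppr0 //.
  by rewrite zw opprK -subr_eq0 opprK -(natrD _ 1 1) pnatr_eq0.
case=> u [uu uv uw]; rewrite (insert _ v u) //; apply: (near) => //.
  by rewrite dotC uv eq_sym oppr_eq0 oner_eq0.
exact: (near).
Qed.

Lemma spin_ind (K : 'M[C]_(spindim l) -> Prop) :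
  K 1%:M -> spin_generated K -> forall g, spin g -> K g.
Proof.
move=> K1 Kgen _ [s [os us ->]].
elim: {s}(size s).+1 {-2}s (ltnSn (size s)) os us => // m IH [|v [|w s]] //= sz os us.
  by rewrite big_nil.
rewrite !big_cons -!mulmxE mulmxA; apply: cliff_pair_generated => //.
- by apply/unit_vectorE/us; rewrite inE eqxx.
- by apply/unit_vectorE/us; rewrite !inE eqxx orbT.
apply: (IH s) => [||x xs]; first exact: ltnW sz.
  by rewrite -(negbK (odd _)).
by apply: us; rewrite !inE xs !orbT.
Qed.

End SpinGroup.

(** * The Lie algebra of the spin group *)

Section SpinLieAlgebra.

Variables (C : numClosedFieldType) (l : nat).
Hypothesis l_gt0 : (0 < l)%N.

Notation vec := 'cV[C]_(l.*2.+1).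
Notation mat := 'M[C]_(spindim l).

(** The span of the Siegel elements is kept inductive, so that linear statements about so_(2l+1)
    reduce to elements whose one-parameter groups lie in the spin group. *)
Inductive so_lie : mat -> Prop :=
| SoSiegel X of siegel X : so_lie X
| SoAdd X Y of so_lie X & so_lie Y : so_lie (X + Y)
| SoScale c X of so_lie X : so_lie (c *: X).

Lemma exists_third (a b : 'I_l.*2.+1) : exists c : 'I_l.*2.+1, (c != a) && (c != b).
Proof.
have : (0 < #|~: [set a; b]|)%N.
  rewrite cardsCs finset.setCK card_ord subn_gt0 (leq_ltn_trans (leq_card_setU _ _)) //.
  by rewrite !cards1 ltnS; case: (l) l_gt0.
by case/card_gt0P => c; rewrite !inE negb_or => ?; exists c.
Qed.

Lemma dot_basis2 (a b : 'I_l.*2.+1) :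
  dot (basis_vec C a) (basis_vec C b) = (a == b)%:R.
Proof. by rewrite dot_basis mxE eqxx andbT. Qed.

(** For a third index c, gamma_b + i gamma_c and gamma_b - i gamma_c are isotropic and orthogonal to
    gamma_a; so gamma_a gamma_b is half the sum of two Siegel elements. *)
Lemma so_lie_gamma (a b : 'I_l.*2.+1) : a != b ->
  so_lie (gamma C l a *m gamma C l b).
Proof.
move=> ab; have [c /andP[ca cb]] := exists_third a b.
have sieg (e : C) : e ^+ 2 = -1 ->
    so_lie (gamma C l a *m (gamma C l b + e *: gamma C l c)).
  move=> e2; apply: SoSiegel.
  exists (basis_vec C a), (basis_vec C b + e *: basis_vec C c); split.
  - by rewrite dot_basis2 eqxx.
  - rewrite !dotE !dot_basis2 !eqxx (eq_sym b c) (negPf cb) !mulr0 addr0 add0r.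
    by rewrite mulr1 -expr2 e2 subrr.
  - by rewrite !dotE !dot_basis2 (negPf ab) (eq_sym a c) (negPf ca) mulr0 addr0.
  - by rewrite cliffD cliffZ !cliff_basis.
have -> : gamma C l a *m gamma C l b =
  2^-1 *: (gamma C l a *m (gamma C l b + 'i *: gamma C l c)
           + gamma C l a *m (gamma C l b + (- 'i) *: gamma C l c)).
  rewrite -mulmxDr scaleNr addrACA subrr addr0 scalemxAr -mulr2n -scaler_nat scalerA.
  by rewrite mulVf ?pnatr_eq0 // scale1r.
by apply: SoScale; apply: SoAdd; apply: sieg; rewrite ?sqrrN sqrCi.
Qed.

Lemma so_lie0 : so_lie 0.
Proof.
rewrite -(scale0r (gamma C l 0 *m gamma C l 1)); apply: SoScale.
have h1 : (1 < l.*2.+1)%N by case: (l) l_gt0.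
exact: (@so_lie_gamma ord0 (Ordinal h1)).
Qed.

Lemma so_lie_sum (I : Type) (r : seq I) (P : pred I) (F : I -> mat) :
  (forall i, P i -> so_lie (F i)) -> so_lie (\sum_(i <- r | P i) F i).
Proof. by move=> h; apply: big_ind => //; [exact: so_lie0|exact: SoAdd]. Qed.

Lemma mulmx_cliff_orth (v w : vec) : dot v w = 0 -> cliff v *m cliff w =
  \sum_i \sum_(j | i != j) (v i 0 * w j 0) *: (gamma C l i *m gamma C l j).
Proof.
move=> vw; rewrite mulmx_cliff.
have -> : \sum_i \sum_(j | i != j) (v i 0 * w j 0) *: (gamma C l i *m gamma C l j)
   = \sum_i (\sum_j (v i 0 * w j 0) *: (gamma C l i *m gamma C l j)
     - (v i 0 * w i 0)%:M).
  apply: eq_bigr => i _; rewrite [in RHS](bigD1 i) //= -cliff_basis cliff_sqr.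
  rewrite dot_basis2 eqxx scale_scalar_mx mulr1 addrAC subrr add0r.
  by apply: eq_bigl => j; rewrite eq_sym.
by rewrite sumrB -raddf_sum /= -/(dot v w) vw raddf0 subr0.
Qed.

Lemma so_lie_cliff (v w : vec) : dot v w = 0 -> so_lie (cliff v *m cliff w).
Proof.
move=> vw; rewrite mulmx_cliff_orth //.
apply: so_lie_sum => i _; apply: so_lie_sum => j ij.
exact/SoScale/so_lie_gamma.
Qed.

Lemma so_lie_gamma_ind (K : mat -> Prop) :
  (forall a b : 'I_l.*2.+1, a != b -> K (gamma C l a *m gamma C l b)) ->
  (forall X Y, K X -> K Y -> K (X + Y)) -> (forall c X, K X -> K (c *: X)) ->
  forall X, so_lie X -> K X.
Proof.
move=> Kg KD KZ.
have K0 : K 0.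
  rewrite -(scale0r (gamma C l 0 *m gamma C l 1)); apply: KZ.
  have h1 : (1 < l.*2.+1)%N by case: (l) l_gt0.
  exact: (Kg ord0 (Ordinal h1)).
move=> X; elim=> {X} [_ [v [x [_ _ vx ->]]]|X Y _ KX _ KY|c X _ KX]; last 2 first.
- exact: KD.
- exact: KZ.
rewrite mulmx_cliff_orth //.
by apply: big_ind => // i _; apply: big_ind => // j ij; apply/KZ/Kg.
Qed.

Lemma conj_unit_vector (u v : vec) : dot u u = 1 ->
  cliff u *m cliff v *m cliff u = cliff ((dot u v *+ 2) *: u - v).
Proof.
move=> uu; have /eqP := cliff_clifford u v; rewrite eq_sym -subr_eq => /eqP <-.
by rewrite mulmxBl -mulmxA cliff_sqr uu mulmx1 mul_scalar_mx cliffD cliffZ cliffN.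
Qed.

Lemma siegel_conj_unit (u : vec) X : dot u u = 1 -> siegel X ->
  siegel (cliff u *m X *m cliff u).
Proof.
move=> uu [v [x [vv xx vx ->]]].
exists ((dot u v *+ 2) *: u - v), ((dot u x *+ 2) *: u - x); split.
- by rewrite !dotE uu vv (dotC v u); ring.
- by rewrite !dotE uu xx (dotC x u); ring.
- by rewrite !dotE uu vx (dotC v u); ring.
rewrite -!conj_unit_vector // !mulmxA -(mulmxA _ (cliff u) (cliff u)) cliff_sqr uu.
by rewrite mulmx1.
Qed.

(** 1 + t X is the product of the unit vectors v and v + t x, so the conjugation is a composition of
    two maps Y |-> u Y u with u a unit vector. *)
Lemma siegel_conj (X Y : mat) t : siegel X -> siegel Y ->
  siegel ((1%:M + t *: X) *m Y *m (1%:M - t *: X)).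
Proof.
case=> v [x [vv xx vx ->]] sY; pose w := v + t *: x.
have ww : dot w w = 1 by rewrite /w !dotE (dotC x) vv vx xx; ring.
have -> : 1%:M + t *: (cliff v *m cliff x) = cliff v *m cliff w.
  by rewrite cliffD cliffZ mulmxDr cliff_sqr vv scalemxAr.
have -> : 1%:M - t *: (cliff v *m cliff x) = cliff w *m cliff v.
  rewrite cliffD cliffZ mulmxDl cliff_sqr vv -scalemxAl -scalerN.
  by rewrite (cliff_anticomm vx) opprK.
have -> : cliff v *m cliff w *m Y *m (cliff w *m cliff v) =
  cliff v *m (cliff w *m Y *m cliff w) *m cliff v by rewrite !mulmxA.
by do 2!apply: siegel_conj_unit => //.
Qed.

Lemma so_lie_bracket X Y : so_lie X -> so_lie Y -> so_lie (X *m Y - Y *m X).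
Proof.
move=> sX; elim=> {Y} [Y sY|Y Z _ IY _ IZ|c Y _ IY]; last 2 first.
- by rewrite mulmxDr mulmxDl opprD addrACA; apply: SoAdd.
- by rewrite -scalemxAr -scalemxAl -scalerBr; apply: SoScale.
elim: sX => {X} [X sX|X Z _ IX _ IZ|c X _ IX]; last 2 first.
- by rewrite mulmxDr mulmxDl opprD addrACA; apply: SoAdd.
- by rewrite -scalemxAr -scalemxAl -scalerBr; apply: SoScale.
(* (1 + s X) Y (1 - s X) = Y + s [X, Y] - s^2 X Y X, and the values at s = 1 and s = -1 differ by 2
   [X, Y]. *)
have -> : X *m Y - Y *m X = 2^-1 *: ((1%:M + 1 *: X) *m Y *m (1%:M - 1 *: X)
     + (-1) *: ((1%:M + (-1) *: X) *m Y *m (1%:M - (-1) *: X))).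
  rewrite !scaleN1r !scale1r opprK !mulmxDl !mulmxDr !mul1mx !mulmx1 !mulNmx !mulmxN.
  rewrite !opprD !opprK; set A := X *m Y; set B := Y *m X; set D := A *m X.
  apply: (scalerI (a := 2)); rewrite ?pnatr_eq0 // scalerA mulfV ?pnatr_eq0 //.
  by rewrite scale1r scaler_nat mulr2n; apply/matrixP => i j; rewrite !mxE; ring.
by apply: SoScale; apply: SoAdd; [|apply: SoScale]; apply: SoSiegel; apply: siegel_conj.
Qed.

(** Besides the Siegel elements this covers the long root vectors, which are products of two
    orthogonal isotropic vectors. *)
Definition lie_unipotent (X : mat) : Prop :=
  [/\ so_lie X, X *m X = 0 & forall t, spin (1%:M + t *: X)].

Lemma siegel_unipotent X : siegel X -> lie_unipotent X.
Proof.
move=> sX; split; [exact: SoSiegel|exact: siegel_sqr|move=> t; exact: siegel_spin].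
Qed.

(** The velocity of [torus_elt] at z = 1. On a vector of weight sum_j a_j epsilon_j it acts by 2
    a_j, which is an integer. *)
Definition torus_lie (j : nat) : mat :=
  - 'i *: (gamma C l j.*2 *m gamma C l j.*2.+1).

End SpinLieAlgebra.

Section CurveExamples.

Variable C : numClosedFieldType.

Lemma mcurve_affine m n (q : {poly C}) a (A B : 'M[C]_(m, n)) :
  mcurve q a (fun t => A + t *: B) (A + a *: B) B.
Proof.
move=> i j; have := dcurve_poly q a ((A i j)%:P + 'X * (B i j)%:P).
rewrite derivD derivC derivM derivX derivC !hornerE !mxE.
by apply: dcurve_ext => z _; rewrite !hornerE !mxE.
Qed.

Lemma dcurve_inv : dcurve 'X 1 (fun z : C => z^-1) 1 (-1).
Proof.
exists 1%N, 1; split=> [z||]; rewrite ?derivX ?derivC ?hornerE //.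
- by move=> nz; rewrite mulVf.
- by rewrite addNr.
Qed.

Lemma dcurve_exprz (m : int) : dcurve 'X 1 (fun z : C => z ^ m) 1 m%:~R.
Proof.
case: m => n.
  have := dcurve_poly 'X 1 ('X^n : {poly C}).
  rewrite derivXn !hornerE expr1n hornerMn hornerXn expr1n.
  by apply: dcurve_ext => z _; rewrite hornerXn.
exists n.+1, 1; split=> [z||]; rewrite ?derivC ?hornerE ?expr1n ?mulr1 //.
  by move=> nz; rewrite NegzE -exprnN mulVf // expf_neq0.
by rewrite derivXn hornerMn hornerXn expr1n NegzE mulrNz addNr.
Qed.

End CurveExamples.

(** * Representations and their differentials *)

Section RepresentationDifferential.

Variables (C : numClosedFieldType) (l n : nat).
Hypothesis l_gt0 : (0 < l)%N.

Notation mat := 'M[C]_(spindim l).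

Variables (f : mat -> 'M[C]_n) (df : {linear mat -> 'M[C]_n}).
Hypotheses (f_morph : alg_morphism (@spin C l) f) (f_diff : is_diff (@spin C l) f df).

Lemma rep1 : f 1%:M = 1%:M. Proof. by case: f_morph. Qed.

Lemma repM g h : spin g -> spin h -> f (g *m h) = f g *m f h.
Proof. by case: f_morph => _ fM _; apply: fM. Qed.

Lemma rep_curve X : lie_unipotent X ->
  mcurve 1 0 (fun t => f (1%:M + t *: X)) 1%:M (df X).
Proof.
case=> _ _ sX; rewrite -rep1; apply: f_diff => //; first by rewrite hornerC oner_eq0.
by have := mcurve_affine 1 0 1%:M X; rewrite scale0r addr0.
Qed.

Lemma lie_unipotentN X : @lie_unipotent C l X -> lie_unipotent (- X).
Proof.
case=> sX XX hX; split; first by rewrite -scaleN1r; apply: SoScale.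
  by rewrite mulNmx mulmxN opprK.
by move=> t; rewrite scalerN -scaleNr.
Qed.

Lemma lie_unipotent_mul X s t : @lie_unipotent C l X ->
  (1%:M + s *: X) *m (1%:M + t *: X) = 1%:M + (s + t) *: X.
Proof.
case=> _ XX _; rewrite mulmxDl mul1mx mulmxDr mulmx1 -scalemxAl -scalemxAr XX.
by rewrite !scaler0 addr0 scalerDl -addrA [t *: X + _]addrC.
Qed.

Lemma one_horner_neq0 (a : C) : (1 : {poly C}).[a] != 0.
Proof. by rewrite hornerC oner_eq0. Qed.

(** The entries of f (1 + t X) are polynomials in t. Computing the derivative at s also by
    multiplicativity gives a recursion on the coefficients, which makes the curve exp (t df X);
    since its degree is finite, df X is nilpotent. *)
Lemma rep_exp X : lie_unipotent X -> exists N, (df X) ^+ N.+1 = 0 /\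
  forall t, f (1%:M + t *: X) = \sum_(k < N.+1) (t ^+ k / k`!%:R) *: (df X) ^+ k.
Proof.
move=> uX; have [_ _ sX] := uX.
have /choice[P hP] : forall ij : 'I_n * 'I_n, exists P : {poly C},
    forall t, f (1%:M + t *: X) ij.1 ij.2 = P.[t].
  move=> [i j]; have [N [P [h _ _]]] := rep_curve uX i j.
  by exists P => t; rewrite -h ?one_horner_neq0 // hornerC expr1n mulr1.
pose R k := \matrix_(i < n, j < n) (P (i, j))`_k.
pose N := \max_ij size (P ij).
have R0 k : (N < k)%N -> R k = 0.
  move=> Nk; apply/matrixP => i j; rewrite !mxE nth_default //.
  by apply: leq_trans (ltnW Nk); apply: (@leq_bigmax _ (fun ij => size (P ij)) (i, j)).
have fR t : f (1%:M + t *: X) = \sum_(k < N.+1) t ^+ k *: R k.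
  apply/matrixP => i j; rewrite (hP (i, j)) summxE.
  rewrite (horner_coef_wide _ (leqW (@leq_bigmax _ (fun ij => size (P ij)) (i, j)))).
  by apply: eq_bigr => k _; rewrite !mxE mulrC.
have dR s : \matrix_(i, j) (P (i, j))^`().[s] = f (1%:M + s *: X) *m df X.
  have c1 : mcurve 1 0 (fun t => f (1%:M + (s + t) *: X)) (f (1%:M + s *: X))
      (\matrix_(i, j) (P (i, j))^`().[s]).
    move=> i j; rewrite mxE (hP (i, j)).
    have := dcurve_poly 1 0 ((P (i, j)) \Po (s%:P + 'X)).
    rewrite deriv_comp derivD derivC derivX add0r mulr1 !horner_comp !hornerE.
    by apply: dcurve_ext => t _; rewrite (hP (i, j)) horner_comp !hornerE.
  have c2 := mcurve_mull (f (1%:M + s *: X)) (rep_curve uX).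
  apply: (mcurve_uniq (one_horner_neq0 0) c1); apply: mcurve_ext c2 => t _.
  by rewrite -repM // lie_unipotent_mul.
have RS k : R k.+1 *+ k.+1 = R k *m df X.
  apply/matrixP => i j.
  have : (P (i, j))^`() = \sum_r (df X r j) *: P (i, r).
    apply: poly_ext => s; have /matrixP/(_ i j) := dR s; rewrite !mxE => ->.
    rewrite horner_sum; apply: eq_bigr => r _.
    by rewrite hornerZ (hP (i, r)) mulrC.
  move/(congr1 (fun p : {poly C} => p`_k)); rewrite coef_deriv coef_sum.
  rewrite mulmxnE mxE => ->; rewrite [RHS]mxE; apply: eq_bigr => r _.
  by rewrite coefZ [R k i r]mxE mulrC.
have R_0 : R 0%N = 1%:M.
  rewrite -rep1 -[in RHS](addr0 1%:M) -(scale0r X) fR.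
  rewrite big_ord_recl expr0 scale1r big1 ?addr0 // => k _.
  by rewrite expr0n scale0r.
have RE k : df X ^+ k = k`!%:R *: R k.
  elim: k => [|k IH]; first by rewrite R_0 scale1r.
  by rewrite exprSr IH -mulmxE -scalemxAl -RS -scaler_nat scalerA -natrM mulnC -factS.
exists N; split; first by rewrite RE R0 // scaler0.
move=> t; rewrite fR; apply: eq_bigr => k _.
by rewrite RE scalerA divfK // pnatr_eq0 -lt0n fact_gt0.
Qed.

Lemma rep_fixP X v : lie_unipotent X ->
  (forall t, f (1%:M + t *: X) *m v = v) <-> df X *m v = 0 :> 'cV_n.
Proof.
move=> uX; split=> [fv|dv t].
  have c1 := mcurve_mulr v (rep_curve uX).
  have c2 := mcurve_const 1 0 v.
  apply: (mcurve_uniq (one_horner_neq0 0) c1).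
  by apply: mcurve_ext c2 => t _; exact/esym/fv.
have [N [_ ->]] := rep_exp uX.
rewrite big_ord_recl mulmxDl expr0 divr1 scale1r expr0 mul1mx mulmx_suml big1 ?addr0 //.
by move=> k _; rewrite lift0 (exprSr (df X)) -scalemxAl -mulmxE -mulmxA dv mulmx0 scaler0.
Qed.

(** By [spin_ind] only factors 1 + X with X a Siegel element matter, and these act by polynomials in
    df X. *)
Lemma rep_stable (U : 'cV[C]_n -> Prop) :
  (forall u v, U u -> U v -> U (u + v)) -> (forall c u, U u -> U (c *: u)) ->
  (forall X, siegel X -> forall v, U v -> U (df X *m v)) ->
  forall g, spin g -> forall v, U v -> U (f g *m v).
Proof.
move=> UD UZ UX g sg v Uv.
have U0 : U 0 by rewrite -(scale0r v); apply: UZ.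
suff : spin g /\ U (f g *m v) by case.
apply: (@spin_ind C l l_gt0 (fun h => spin h /\ U (f h *m v))) sg => [|X h sX [sh Uh]].
  by split; [exact: spin1|rewrite rep1 mul1mx].
have uX := siegel_unipotent sX; have [_ _ hX] := uX.
have s1 : spin (1%:M + X) by rewrite -(scale1r X).
split; first exact: spinM.
rewrite repM // -mulmxA; move: (f h *m v) Uh => w Uw.
have [N [_ E]] := rep_exp uX; rewrite -(scale1r X) E mulmx_suml.
apply: big_ind => // k _; rewrite -scalemxAl; apply: UZ.
elim: (nat_of_ord k) => [|m IH]; first by rewrite expr0 mul1mx.
by rewrite exprS -mulmxE -mulmxA; apply: UX.
Qed.

(** Both sides are the velocity at t = 0 of f ((1 + s X) (1 + t Y) (1 - s X)). *)
Lemma diff_conj X Y s : lie_unipotent X -> siegel Y ->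
  f (1%:M + s *: X) *m df Y *m f (1%:M - s *: X)
    = df ((1%:M + s *: X) *m Y *m (1%:M - s *: X)).
Proof.
move=> uX sY; have uY := siegel_unipotent sY.
have [_ _ hX] := uX; have [_ _ hY] := uY.
have hN : spin (1%:M - s *: X) by rewrite -scaleNr.
have XN : (1%:M + s *: X) *m (1%:M - s *: X) = 1%:M.
  by rewrite -scaleNr lie_unipotent_mul // subrr scale0r addr0.
have fXN : f (1%:M + s *: X) *m f (1%:M - s *: X) = 1%:M by rewrite -repM // XN rep1.
have c1 := mcurve_mulr (f (1%:M - s *: X)) (mcurve_mull (f (1%:M + s *: X)) (rep_curve uY)).
have c2 : mcurve 1 0 (fun t => f ((1%:M + s *: X) *m (1%:M + t *: Y) *m (1%:M - s *: X)))
    (f 1%:M) (df ((1%:M + s *: X) *m Y *m (1%:M - s *: X))).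
  apply: f_diff; first exact: one_horner_neq0.
    by move=> t _; apply: spinM => //; apply: spinM.
  have := mcurve_affine 1 0 1%:M Y; rewrite scale0r addr0 => cY.
  have := mcurve_mulr (1%:M - s *: X) (mcurve_mull (1%:M + s *: X) cY).
  by rewrite mulmx1 XN.
apply: (mcurve_uniq (one_horner_neq0 0) c1); apply: mcurve_ext c2 => t _.
by rewrite !repM //; apply: spinM.
Qed.

(** For Siegel elements, both sides are the velocity at s = 0 of the two members of [diff_conj].
    Bilinearity does the rest. *)
Lemma diff_bracket X Y : so_lie X -> so_lie Y ->
  df (X *m Y - Y *m X) = df X *m df Y - df Y *m df X.
Proof.
move=> sX; elim=> {Y} [Y sY|Y Z _ IY _ IZ|c Y _ IY]; last 2 first.
- rewrite mulmxDr mulmxDl opprD addrACA linearD IY IZ linearD /= mulmxDr mulmxDl.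
  by rewrite opprD addrACA.
- rewrite -scalemxAr -scalemxAl -scalerBr linearZ IY [df (_ *: _)]linearZ /=.
  by rewrite -scalemxAr -scalemxAl scalerBr.
elim: sX => {X} [X sX|X Z _ IX _ IZ|c X _ IX]; last 2 first.
- rewrite mulmxDr mulmxDl opprD addrACA linearD IX IZ linearD /= mulmxDr mulmxDl.
  by rewrite opprD addrACA.
- rewrite -scalemxAr -scalemxAl -scalerBr linearZ IX [df (_ *: _)]linearZ /=.
  by rewrite -scalemxAr -scalemxAl scalerBr.
have uX := siegel_unipotent sX.
have c1 : mcurve 1 0 (fun s => f (1%:M + s *: X) *m df Y *m f (1%:M - s *: X))
    (df Y) (df X *m df Y - df Y *m df X).
  have cN : mcurve 1 0 (fun s => f (1%:M - s *: X)) 1%:M (- df X).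
    rewrite -[- df X]linearN /=.
    by apply: mcurve_ext (rep_curve (lie_unipotentN uX)) => t _; rewrite scalerN.
  have := mcurve_mul (mcurve_mulr (df Y) (rep_curve uX)) cN.
  by rewrite mul1mx !mulmx1 mulmxN.
have c2 : mcurve 1 0 (fun s => df ((1%:M + s *: X) *m Y *m (1%:M - s *: X)))
    (df Y) (df (X *m Y - Y *m X)).
  have := mcurve_add (mcurve_affine 1 0 (df Y) (df (X *m Y - Y *m X)))
    (mcurve_scale (- df (X *m Y *m X)) (dcurve_poly 1 0 'X^2)).
  rewrite derivXn hornerMn !hornerXn expr1 expr0n mul0rn !scale0r !addr0.
  apply: mcurve_ext => s _; rewrite hornerXn.
  have -> : (1%:M + s *: X) *m Y *m (1%:M - s *: X) =
      Y + s *: (X *m Y - Y *m X) + s ^+ 2 *: - (X *m Y *m X).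
    rewrite !mulmxDl !mulmxDr !mul1mx !mulmx1 !mulmxN -!scalemxAl -!scalemxAr scalerA.
    by rewrite -expr2 scalerBr scalerN; apply/matrixP => i j; rewrite !mxE; ring.
  move: (X *m Y - Y *m X) (X *m Y *m X) => A B.
  by rewrite !(linearD df) !(linearZZ df) (linearN df).
apply: (mcurve_uniq (one_horner_neq0 0) c2).
by apply: mcurve_ext c1 => s _; apply: diff_conj.
Qed.

End RepresentationDifferential.

(** * The maximal torus and its weights *)

Section Torus.

Variables (C : numClosedFieldType) (l j : nat).
Hypotheses (l_gt0 : (0 < l)%N) (j_lt : (j < l)%N).

Let a_lt : (j.*2 < l.*2.+1)%N. Proof. by rewrite ltnS leq_double ltnW. Qed.
Let b_lt : (j.*2.+1 < l.*2.+1)%N. Proof. by rewrite ltnS ltn_double. Qed.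

Notation Gam := (gamma C l j.*2 *m gamma C l j.*2.+1).
Let a := basis_vec C (Ordinal a_lt).
Let b := basis_vec C (Ordinal b_lt).

Let ca : cliff a = gamma C l j.*2. Proof. exact: cliff_basis. Qed.
Let cb : cliff b = gamma C l j.*2.+1. Proof. exact: cliff_basis. Qed.
Let aa : dot a a = 1. Proof. by rewrite dot_basis2 eqxx. Qed.
Let bb : dot b b = 1. Proof. by rewrite dot_basis2 eqxx. Qed.
Let ab : dot a b = 0.
Proof. by rewrite dot_basis2 -val_eqE /= (ltn_eqF (ltnSn _)). Qed.

Lemma torus_gamma_sqr : Gam *m Gam = - 1%:M.
Proof.
rewrite -ca -cb mulmxA -(mulmxA _ (cliff b)) (@cliff_anticomm _ _ b a); last by rewrite dotC ab.
by rewrite mulmxN mulNmx mulmxA cliff_sqr aa mul1mx cliff_sqr bb.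
Qed.

(** For z = exp (i theta), [tcos] and [tsin] are the cosine and the sine of theta. *)
Definition tcos (z : C) : C := (z + z^-1) / 2.
Definition tsin (z : C) : C := (z - z^-1) / (2 * 'i).

Lemma torus_eltE z : torus_elt l j z = (tcos z)%:M + tsin z *: Gam.
Proof. by []. Qed.

Lemma tsinE z : tsin z = - 'i * ((z - z^-1) / 2).
Proof. by rewrite /tsin invfM invCi; ring. Qed.

Lemma mul_sin z y : tsin z * tsin y = - ((z - z^-1) / 2 * ((y - y^-1) / 2)).
Proof.
rewrite !tsinE mulrACA mulrNN -expr2 sqrCi; ring.
Qed.

Lemma torus_spin z : z != 0 -> spin (torus_elt l j z : 'M[C]_(spindim l)).
Proof.
move=> z0; exists [:: a; tcos z *: a + tsin z *: b]; split=> //.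
  move=> v; rewrite !inE => /orP[/eqP->|/eqP->]; apply/unit_vectorE => //.
  rewrite !dotE aa bb ab (dotC b) ab !mulr0 !mulr1 addr0 add0r mul_sin /tcos.
  by field.
rewrite big_cons big_seq1 -mulmxE cliffD !cliffZ mulmxDr -!scalemxAr cliff_sqr aa.
by rewrite ca cb torus_eltE scalemx1.
Qed.

Lemma torus_mul z y : z != 0 -> y != 0 ->
  torus_elt l j z *m torus_elt l j y = torus_elt l j (z * y) :> 'M[C]_(spindim l).
Proof.
move=> z0 y0; rewrite !torus_eltE mulmxDl !mulmxDr -scalar_mxM !mul_scalar_mx.
rewrite !mul_mx_scalar -!scalemxAl -!scalemxAr torus_gamma_sqr !scalerN.
have -> : tcos (z * y) = tcos z * tcos y - tsin z * tsin y.
  by rewrite mul_sin /tcos; field; rewrite ?z0 ?y0.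
have -> : tsin (z * y) = tcos z * tsin y + tcos y * tsin z.
  by rewrite !tsinE /tcos; field; rewrite ?z0 ?y0.
by apply/matrixP => r s; rewrite !mxE; case: (r == s) => /=; ring.
Qed.

Lemma torus_curve : mcurve 'X 1 (fun z => torus_elt l j z : 'M[C]_(spindim l))
  1%:M (torus_lie C l j).
Proof.
have X1 : ('X : {poly C}).[1] = 1 by rewrite hornerX.
have cz := dcurve_exprz C 1; have ci := dcurve_inv C.
have csin : dcurve 'X 1 tsin 0 (- 'i).
  have := dcurve_mul (dcurve_add cz (dcurve_mul (dcurve_const 'X 1 (-1)) ci))
    (dcurve_const 'X 1 (- 'i / 2)).
  have -> : (1 + -1 * 1) * (- 'i / 2) = 0 :> C by ring.
  have -> : (1%:~R + (0 * 1 + -1 * -1)) * (- 'i / 2) + (1 + -1 * 1) * 0 = - 'i :> C.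
    by field.
  apply: dcurve_ext => z _; rewrite tsinE; ring.
have ccos : dcurve 'X 1 tcos 1 0.
  have := dcurve_mul (dcurve_add cz ci) (dcurve_const 'X 1 2^-1).
  have -> : (1 + 1) / 2 = 1 :> C by field.
  have -> : (1%:~R + -1) / 2 + (1 + 1) * 0 = 0 :> C by ring.
  by apply: dcurve_ext => z _.
have := mcurve_add (mcurve_scale 1%:M ccos) (mcurve_scale Gam csin).
rewrite !scale0r !scale1r addr0 add0r.
by apply: mcurve_ext => z _; rewrite torus_eltE scalemx1.
Qed.

Variables (n : nat) (f : 'M[C]_(spindim l) -> 'M[C]_n).
Variable df : {linear 'M[C]_(spindim l) -> 'M[C]_n}.
Hypotheses (f_morph : alg_morphism (@spin C l) f) (f_diff : is_diff (@spin C l) f df).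

Lemma torus_rep_curve :
  mcurve 'X 1 (fun z => f (torus_elt l j z)) 1%:M (df (torus_lie C l j)).
Proof.
rewrite -(rep1 f_morph); apply: f_diff torus_curve.
  by rewrite hornerX oner_eq0.
by move=> z; rewrite hornerX; apply: torus_spin.
Qed.

(** An entry of f (torus_elt z) v has the form P(z) / z^N. Translation in the torus turns the
    eigenvalue equation at z = 1 into z P' = (m + N) P, and comparing coefficients leaves only a
    monomial of degree m + N, or zero if m + N < 0. *)
Lemma torus_weightP (m : int) (v : 'cV_n) :
  (forall z, z != 0 -> f (torus_elt l j z) *m v = z ^ m *: v) <->
  df (torus_lie C l j) *m v = m%:~R *: v.
Proof.
have X1 : ('X : {poly C}).[1] != 0 by rewrite hornerX oner_eq0.
have c1 := mcurve_mulr v torus_rep_curve.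
split=> [fv|dv z z0].
  apply: (mcurve_uniq X1 c1).
  apply: mcurve_ext (mcurve_scale v (dcurve_exprz C m)) => z; rewrite hornerX => z0.
  by rewrite fv.
apply/matrixP => i k; rewrite [RHS]mxE.
have [N [P [hP P1 _]]] := c1 i k; rewrite mul1mx hornerX expr1n mulr1 in P1.
have ode y : y != 0 -> y * P^`().[y] = (m + N%:Z)%:~R * P.[y].
  move=> y0; pose F x := (f (torus_elt l j (y * x)) *m v) i k.
  have d1 : dcurve 'X 1 F (P.[y] / y ^+ N) (m%:~R * P.[y] / y ^+ N).
    have := mcurve_mull (f (torus_elt l j y)) c1; rewrite dv mul1mx => /(_ i k).
    have fy : (f (torus_elt l j y) *m v) i k = P.[y] / y ^+ N.
      by rewrite -hP ?hornerX // mulfK // expf_neq0.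
    have -> : (f (torus_elt l j y) *m (m%:~R *: v)) i k = m%:~R * P.[y] / y ^+ N.
      by rewrite -scalemxAr mxE fy mulrA.
    rewrite fy; apply: dcurve_ext => x; rewrite hornerX => x0; rewrite /F -torus_mul //.
    by rewrite (repM f_morph) ?mulmxA //; apply: torus_spin.
  have d2 : dcurve 'X 1 F (P.[y] / y ^+ N) ((y * P^`().[y] - N%:R * P.[y]) / y ^+ N).
    exists N, ((y ^+ N)^-1 *: (P \Po (y *: 'X))); split.
    - move=> x; rewrite hornerX => x0; rewrite hornerZ horner_comp hornerZ hornerX.
      have yx : y * x != 0 by rewrite mulf_neq0.
      have := hP (y * x); rewrite hornerX => /(_ yx) <-.
      by rewrite exprMn /F; field; rewrite expf_neq0.
    - by rewrite hornerZ horner_comp hornerZ !hornerX mulr1 expr1n mulr1 mulrC.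
    - rewrite derivZ deriv_comp derivZ derivX !hornerZ hornerM horner_comp !hornerZ.
      rewrite hornerC derivXn hornerMn hornerXn !hornerX !mulr1 !expr1n mulr1.
      by rewrite -mulr_natl mulr1; field; rewrite expf_neq0.
  have := dcurve_uniq X1 d1 d2 => /(mulIf _) E.
  have {}E : m%:~R * P.[y] = y * P^`().[y] - N%:R * P.[y].
    by apply: E; rewrite invr_eq0 expf_neq0.
  by rewrite rmorphD mulrDl E /= subrK.
have coefP (r : nat) : r != m + N%:Z :> int -> P`_r = 0.
  move=> rm.
  have : 'X * (P^`() * 'X) = (m + N%:Z)%:~R *: P * 'X.
    apply: poly_ext => y; rewrite !hornerM hornerX hornerZ.
    have [->|y0] := eqVneq y 0; first by rewrite !mulr0.
    by rewrite -ode // mulrA.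
  move/(congr1 (fun p : {poly C} => p`_r.+1)); rewrite mulrC !coefMX coefZ coef_deriv /=.
  case: r rm => [|r] rm /=.
    move=> /eqP; rewrite eq_sym mulf_eq0 intr_eq0 => /orP[/eqP e|/eqP //].
    by rewrite e eqxx in rm.
  rewrite -mulr_natl => /eqP; rewrite -subr_eq0 -mulrBl mulf_eq0 => /orP[|/eqP //].
  by rewrite -[r.+1%:R]/(r.+1%:Z%:~R) -rmorphB intr_eq0 subr_eq0 (negPf rm).
have fz : (f (torus_elt l j z) *m v) i k = P.[z] / z ^+ N.
  by rewrite -hP ?hornerX // mulfK // expf_neq0.
rewrite fz -P1.
have PE y : y != 0 -> P.[y] = y ^ (m + N%:Z) * P.[1].
  case: (m + N%:Z) coefP => r coefP y0.
    have -> : P = P`_r *: 'X^r.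
      apply/polyP => s; rewrite coefZ coefXn.
      by have [->|sr] := eqVneq s r; rewrite ?mulr1 ?mulr0 // coefP.
    by rewrite !hornerZ !hornerXn expr1n mulr1 mulrC.
  have -> : P = 0 by apply/polyP => s; rewrite coef0 coefP.
  by rewrite !horner0 mulr0.
by rewrite PE // expfzDr // mulrAC -exprnP mulfK // expf_neq0.
Qed.

End Torus.

(** * Invariant subspaces and words in the Lie algebra *)

(** Take a subspace of maximal dimension among those inside [P]: a vector of [P] outside it would
    enlarge it by a line. *)
Lemma linear_pred_vspace (K : fieldType) (V : vectType K) (P : V -> Prop) :
  P 0 -> (forall u v, P u -> P v -> P (u + v)) -> (forall c u, P u -> P (c *: u)) ->
  exists U : {vspace V}, forall v, v \in U <-> P v.
Proof.
move=> P0 PD PZ.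
pose Q d := `[< exists U : {vspace V}, \dim U = d /\ forall v, v \in U -> P v >].
have exQ : exists d, Q d.
  exists 0%N; apply/asboolP; exists 0%VS; split; first exact: dimv0.
  by move=> v; rewrite memv0 => /eqP ->.
have bQ d : Q d -> (d <= \dim {: V})%N.
  by case/asboolP => U [<- _]; apply/dimvS/subvf.
case: (ex_maxnP exQ bQ) => d /asboolP[U [dU PU]] dmax.
exists U => v; split=> [/PU //|Pv].
have /dmax : Q (\dim (U + <[v]>)).
  apply/asboolP; exists (U + <[v]>)%VS; split=> // _ /memv_addP[u uU [_ /vlineP[c ->] ->]].
  by apply: PD; [apply: PU|apply: PZ].
rewrite -dU => le_d; have : (U == U + <[v]>)%VS by rewrite eqEdim addvSl.
by move/eqP => ->; apply: (subvP (addvSr _ _)); apply: memv_line.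
Qed.

Section LinearSpan.

Variables (K : fieldType) (V : lmodType K) (S : V -> Prop).

Inductive lspan : V -> Prop :=
| LspanZero : lspan 0
| LspanCons c x y of S x & lspan y : lspan (c *: x + y).

Lemma lspan_in x : S x -> lspan x.
Proof. by move=> Sx; rewrite -[x]addr0 -(scale1r x); apply: LspanCons => //; exact: LspanZero. Qed.

Lemma lspanD x y : lspan x -> lspan y -> lspan (x + y).
Proof.
move=> sx sy; elim: sx => [|c u v Su _ IH]; first by rewrite add0r.
by rewrite -addrA; apply: LspanCons.
Qed.

Lemma lspanZ c x : lspan x -> lspan (c *: x).
Proof.
elim=> [|b u v Su _ IH]; first by rewrite scaler0; exact: LspanZero.
by rewrite scalerDr scalerA; apply: LspanCons.
Qed.

Lemma lspanN x : lspan x -> lspan (- x).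
Proof. by rewrite -scaleN1r; apply: lspanZ. Qed.

End LinearSpan.

(** Induction on the length of the word. In the last letter B + A, the part A is absorbed by [w].
    The part B is moved to the left until it meets [xi]; each transposition costs a word in which
    two neighbours are replaced by their bracket, again a letter in [L], so that the word is
    shorter. *)
Lemma lie_vanish (K : fieldType) n (L : 'M[K]_n -> Prop) (xi : 'rV_n) (w : 'cV_n) :
  (forall X Y, L X -> L Y -> L (X *m Y - Y *m X)) ->
  (forall X, L X -> exists B A, [/\ L B, X = B + A, exists b, xi *m B = b *: xi
                               & exists a, A *m w = a *: w]) ->
  xi *m w = 0 ->
  forall s : seq 'M_n, (forall X, X \in s -> L X) -> xi *m (\prod_(X <- s) X) *m w = 0.
Proof.
move=> Lbr Ldec xiw s; have [m] := ubnP (size s).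
elim: m s => // m IH s /ltnSE sz Ls.
case/lastP: s sz Ls => [|s X] sz Ls; first by rewrite big_nil mulmx1.
rewrite size_rcons in sz.
have LX : L X by apply: Ls; rewrite mem_rcons mem_head.
have {}Ls Y : Y \in s -> L Y by move=> h; apply: Ls; rewrite mem_rcons inE h orbT.
have [B [A [LB -> [b xiB] [a Aw]]]] := Ldec X LX.
rewrite -cats1 big_cat big_seq1 /= -mulmxE mulmxDr mulmxDr mulmxDl.
rewrite !mulmxA -[X in _ + X]mulmxA Aw -scalemxAr IH // scaler0 addr0.
suff move_left s1 s2 : (forall Y, Y \in s1 ++ s2 -> L Y) -> (size (s1 ++ s2) < m)%N ->
    xi *m \prod_(Y <- s1) Y *m B *m \prod_(Y <- s2) Y *m w = 0.
  have := move_left s [::]; rewrite cats0 big_nil mulmx1; exact.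
elim/last_ind: s1 s2 => [|s1 Y IH1] s2 Ls12 sz12.
  by rewrite big_nil mulmx1 xiB -!scalemxAl IH ?scaler0.
rewrite cat_rcons in Ls12 sz12.
have LY : L Y by apply: Ls12; rewrite mem_cat mem_head orbT.
rewrite -cats1 big_cat big_seq1 /= -mulmxE.
have -> : xi *m (\prod_(Z <- s1) Z *m Y) *m B *m \prod_(Z <- s2) Z *m w =
    xi *m (\prod_(Z <- s1 ++ (Y *m B - B *m Y) :: s2) Z) *m w
    + xi *m \prod_(Z <- s1) Z *m B *m \prod_(Z <- Y :: s2) Z *m w.
  rewrite big_cat !big_cons /= -!mulmxE -mulmxDl !mulmxA -mulmxDl; congr (_ *m _ *m _).
  by rewrite mulmxBr !mulmxA subrK.
rewrite IH1 // addr0 IH //.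
  by move: sz12; rewrite !size_cat.
move=> Z; rewrite mem_cat inE => /orP[h|/orP[/eqP->|h]].
- by apply: Ls12; rewrite mem_cat h.
- exact: Lbr.
- by apply: Ls12; rewrite mem_cat inE h !orbT.
Qed.

Section IrreducibleFunctional.

Variables (C : numClosedFieldType) (l n : nat).
Hypothesis l_gt0 : (0 < l)%N.
Notation mat := 'M[C]_(spindim l).
Variables (f : mat -> 'M[C]_n) (df : {linear mat -> 'M[C]_n}).
Hypotheses (f_irr : irreducible_rep (@spin C l) f) (f_diff : is_diff (@spin C l) f df).

Let f_morph : alg_morphism (@spin C l) f. Proof. by case: f_irr. Qed.

Lemma irreducible_pred (P : 'cV[C]_n -> Prop) :
  (forall u v, P u -> P v -> P (u + v)) -> (forall c u, P u -> P (c *: u)) ->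
  (forall X, siegel X -> forall v, P v -> P (df X *m v)) ->
  forall w, w != 0 -> P w -> forall v, P v.
Proof.
move=> PD PZ PX w w0 Pw v.
have P0 : P 0 by rewrite -(scale0r w); apply: PZ.
have [U UP] := linear_pred_vspace P0 PD PZ.
have [_ _ irr] := f_irr; case: (irr U) => [g u sg /UP Pu|U0|Uf].
- by apply/UP; apply: (rep_stable l_gt0 f_morph f_diff).
- by have /UP := Pw; rewrite U0 memv0 (negPf w0).
- by apply/UP; rewrite Uf memvf.
Qed.

(* If B acts on xi and A acts on w by scalars, for B and A in complementary
   subspaces of the Lie algebra, then moving the factors B of a word to the
   left and the factors A to the right reduces xi (word) w to xi w. *)
Lemma irreducible_functional (gen : mat -> Prop) (xi : 'rV[C]_n) (w : 'cV[C]_n) :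
  (forall X, so_lie X -> lspan gen X) ->
  (forall X, gen X -> (so_lie X /\ exists b, xi *m df X = b *: xi)
                      \/ exists a, df X *m w = a *: w) ->
  xi *m w = 0 -> w != 0 -> xi = 0.
Proof.
move=> sp hgen xiw w0.
pose L (Y : 'M_n) := exists2 X, so_lie X & Y = df X.
have Lbr X Y : L X -> L Y -> L (X *m Y - Y *m X).
  move=> [X' sX ->] [Y' sY ->]; exists (X' *m Y' - Y' *m X'); first exact: so_lie_bracket.
  by rewrite (diff_bracket f_morph f_diff).
have Ldec X : L X -> exists B A, [/\ L B, X = B + A, exists b, xi *m B = b *: xi
                               & exists a, A *m w = a *: w].
  case=> X' /sp sX' ->; elim: sX' => [|c Y Z gY _ IH].
    rewrite linear0; exists 0, 0; split; rewrite ?addr0 //.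
    - by exists 0; rewrite ?linear0 //; apply: so_lie0.
    - by exists 0; rewrite mulmx0 scale0r.
    - by exists 0; rewrite mul0mx scale0r.
  rewrite linearD linearZZ.
  have [B [A [[B' sB ->] -> [b xiB] [a Aw]]]] := IH.
  case: (hgen _ gY) => [[sY [b' xiY]]|[a' Yw]].
    exists (df (c *: Y + B')), A; split; last by exists a.
    - by exists (c *: Y + B') => //; apply: SoAdd => //; apply: SoScale.
    - by rewrite linearD linearZZ addrA.
    - exists (c * b' + b).
      by rewrite linearD linearZZ mulmxDr -scalemxAr xiY xiB scalerA scalerDl.
  exists (df B'), (c *: df Y + A); split; [by exists B'|by rewrite addrCA|by exists b|].
  by exists (c * a' + a); rewrite mulmxDl -scalemxAl Yw Aw scalerA scalerDl.
have van := lie_vanish Lbr Ldec xiw.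
(* [P] collects the vectors on which [xi] vanishes after every word. It contains [w] and is stable
   under the Lie algebra, hence contains every vector; the empty word then gives xi = 0. *)
pose P (x : 'cV_n) := forall s : seq 'M_n, (forall X, X \in s -> L X) ->
  xi *m (\prod_(X <- s) X) *m x = 0.
suff allP x : P x.
  apply/trmx_inj/matrixP => i j; rewrite !mxE.
  have nilL X : X \in [::] -> L X by [].
  have := allP (delta_mx i 0) [::] nilL.
  by rewrite big_nil mulmx1 -colE => /matrixP/(_ 0 0); rewrite !mxE (ord1 j).
apply: (irreducible_pred _ _ _ w0 van x) => [u v Pu Pv|c u Pu|X sX v Pv] s Ls.
- by rewrite mulmxDr Pu // Pv // addr0.
- by rewrite -scalemxAr Pu // scaler0.
have := Pv (rcons s (df X)); rewrite -cats1 big_cat big_seq1 -!mulmxE !mulmxA; apply.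
move=> Y; rewrite mem_cat inE => /orP[/Ls //|/eqP->].
by exists X => //; apply: SoSiegel.
Qed.

End IrreducibleFunctional.

(** * Root vectors *)

Section RootVectors.

Variables (C : numClosedFieldType) (l : nat).
Hypothesis l_gt0 : (0 < l)%N.
Notation mat := 'M[C]_(spindim l).
Notation vec := 'cV[C]_(l.*2.+1).

Definition ivec (s : C) (j : nat) : vec :=
  basis_vec C (inord j.*2) + s *: basis_vec C (inord j.*2.+1).
Definition evec : vec := basis_vec C (inord l.*2).

Lemma cliff_inord (k : nat) : (k <= l.*2)%N ->
  cliff (basis_vec C (inord k) : vec) = gamma C l k.
Proof. by move=> kl; rewrite cliff_basis inordK. Qed.

Lemma cliff_ivec s j : (j < l)%N ->
  cliff (ivec s j) = gamma C l j.*2 + s *: gamma C l j.*2.+1.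
Proof.
move=> jl; rewrite cliffD cliffZ !cliff_inord // ?leq_double ?ltn_double //.
exact: ltnW.
Qed.

Lemma iso_plusE j : (j < l)%N -> iso_plus C l j = cliff (ivec 'i j).
Proof. by move=> jl; rewrite cliff_ivec. Qed.

Lemma iso_minusE j : (j < l)%N -> iso_minus C l j = cliff (ivec (- 'i) j).
Proof. by move=> jl; rewrite cliff_ivec // scaleNr. Qed.

Lemma cliff_evec : cliff evec = gamma C l l.*2.
Proof. by rewrite cliff_inord. Qed.

Lemma dot_inord a b : (a <= l.*2)%N -> (b <= l.*2)%N ->
  dot (basis_vec C (inord a) : vec) (basis_vec C (inord b)) = (a == b)%:R.
Proof. by move=> al bl; rewrite dot_basis2 -val_eqE /= !inordK. Qed.

Lemma double_lt j : (j < l)%N -> (j.*2 <= l.*2)%N * (j.*2.+1 <= l.*2)%N.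
Proof. by move=> jl; rewrite leq_double ltn_double ltnW. Qed.

Lemma dot_ivec s t j k : (j < l)%N -> (k < l)%N ->
  dot (ivec s j) (ivec t k) = (j == k)%:R * (1 + s * t).
Proof.
move=> /double_lt[j0 j1] /double_lt[k0 k1]; rewrite /ivec !dotE !dot_inord //.
rewrite eqSS (inj_eq double_inj).
have -> : (j.*2 == k.*2.+1) = false.
  by apply/eqP => /(congr1 odd); rewrite /= !odd_double.
have -> : (j.*2.+1 == k.*2) = false.
  by apply/eqP => /(congr1 odd); rewrite /= !odd_double.
by rewrite /= !mulr0n; ring.
Qed.

Lemma dot_ivec_evec s j : (j < l)%N -> dot (ivec s j) evec = 0.
Proof.
move=> jl; have [j0 j1] := double_lt jl; rewrite /ivec !dotE !dot_inord //.
rewrite (inj_eq double_inj) (ltn_eqF jl).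
have -> : (j.*2.+1 == l.*2) = false.
  by apply/eqP => /(congr1 odd); rewrite /= !odd_double.
by rewrite /= !mulr0n; ring.
Qed.

Lemma dot_evec : dot evec evec = 1.
Proof. by rewrite dot_inord // eqxx. Qed.

(** With Clifford products, 1 + t x y = (1 - t (y + e) x) (1 + t e x), because x e x = 0 and y x = -
    x y. Both factors come from Siegel elements. *)
Lemma iso_pair_unipotent (x y e : vec) : dot x x = 0 -> dot y y = 0 -> dot x y = 0 ->
  dot e e = 1 -> dot e x = 0 -> dot e y = 0 -> lie_unipotent (cliff x *m cliff y).
Proof.
move=> xx yy xy ee ex ey.
have xy_anti := cliff_anticomm xy.
split; first exact: so_lie_cliff.
  rewrite {1}xy_anti mulNmx -mulmxA (mulmxA (cliff x)) cliff_sqr xx.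
  by rewrite mul_scalar_mx scale0r mulmx0 oppr0.
have s1 : siegel (cliff (y + e) *m cliff x).
  by exists (y + e), x; split=> //; rewrite !dotE ?yy ?ee ?(dotC y e) ?(dotC y x) ?xy ?ex ?ey; ring.
have s2 : siegel (cliff e *m cliff x) by exists e, x.
move=> t; have := spinM (siegel_spin (- t) s1) (siegel_spin t s2); congr spin.
have xex : cliff x *m (cliff e *m cliff x) = 0.
  rewrite mulmxA cliff_anticomm ?(dotC x) // mulNmx -mulmxA cliff_sqr xx.
  by rewrite raddf0 mulmx0 oppr0.
rewrite mulmxDl mul1mx mulmxDr mulmx1 -scalemxAl -scalemxAr -mulmxA xex mulmx0.
rewrite !scaler0 addr0 cliffD mulmxDl scalerDr xy_anti scaleNr scalerN scaleNr.
by rewrite addrACA subrr addr0.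
Qed.

Lemma iso_unit_unipotent (x e : vec) : dot x x = 0 -> dot e e = 1 -> dot e x = 0 ->
  lie_unipotent (cliff x *m cliff e).
Proof.
move=> xx ee ex; rewrite cliff_anticomm ?(dotC x) //.
apply/siegel_unipotent/siegelN; by exists e, x.
Qed.

Inductive pos_root : mat -> Prop :=
| PosSub j k of (j < k < l)%N : pos_root (iso_plus C l j *m iso_minus C l k)
| PosAdd j k of (j < k < l)%N : pos_root (iso_plus C l j *m iso_plus C l k)
| PosShort j of (j < l)%N : pos_root (iso_plus C l j *m gamma C l l.*2).

Inductive neg_root : mat -> Prop :=
| NegSub j k of (j < k < l)%N : neg_root (iso_minus C l j *m iso_plus C l k)
| NegAdd j k of (j < k < l)%N : neg_root (iso_minus C l j *m iso_minus C l k)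
| NegShort j of (j < l)%N : neg_root (iso_minus C l j *m gamma C l l.*2).

Lemma pos_root_eltP X t : pos_root X -> pos_root_elt (1%:M + t *: X).
Proof.
by case=> *; [exact: RootSub|exact: RootAdd|exact: RootShort].
Qed.

Lemma pos_root_eltE u : pos_root_elt u -> exists2 X, pos_root X
  & exists t, u = 1%:M + t *: X.
Proof.
case=> [j k t h|j k t h|j t h].
- by exists (iso_plus C l j *m iso_minus C l k); [exact: PosSub|exists t].
- by exists (iso_plus C l j *m iso_plus C l k); [exact: PosAdd|exists t].
- by exists (iso_plus C l j *m gamma C l l.*2); [exact: PosShort|exists t].
Qed.

Lemma ivec_pair_unipotent s t j k : (j < k < l)%N -> s ^+ 2 = -1 -> t ^+ 2 = -1 ->
  lie_unipotent (cliff (ivec s j) *m cliff (ivec t k)).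
Proof.
case/andP => jk kl s2 t2; have jl := ltn_trans jk kl.
apply: (@iso_pair_unipotent _ _ evec); rewrite ?dot_evec ?(dotC evec) ?dot_ivec_evec //.
- by rewrite dot_ivec // -expr2 s2 subrr mulr0.
- by rewrite dot_ivec // -expr2 t2 subrr mulr0.
- by rewrite dot_ivec // (ltn_eqF jk) mul0r.
Qed.

Lemma ivec_evec_unipotent s j : (j < l)%N -> s ^+ 2 = -1 ->
  lie_unipotent (cliff (ivec s j) *m cliff evec).
Proof.
move=> jl s2; apply: iso_unit_unipotent; rewrite ?dot_evec ?(dotC evec) ?dot_ivec_evec //.
by rewrite dot_ivec // -expr2 s2 subrr mulr0.
Qed.

Let i2 : ('i : C) ^+ 2 = -1. Proof. exact: sqrCi. Qed.
Let Ni2 : (- 'i : C) ^+ 2 = -1. Proof. by rewrite sqrrN sqrCi. Qed.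

Lemma pos_root_unipotent X : pos_root X -> lie_unipotent X.
Proof.
case=> [j k|j k|j] h.
- have /andP[jk kl] := h; rewrite iso_plusE ?iso_minusE ?(ltn_trans jk) //.
  exact: ivec_pair_unipotent.
- have /andP[jk kl] := h; rewrite !iso_plusE ?(ltn_trans jk) //.
  exact: ivec_pair_unipotent.
- by rewrite iso_plusE // -cliff_evec; apply: ivec_evec_unipotent.
Qed.

Lemma neg_root_unipotent X : neg_root X -> lie_unipotent X.
Proof.
case=> [j k|j k|j] h.
- have /andP[jk kl] := h; rewrite iso_plusE ?iso_minusE ?(ltn_trans jk) //.
  exact: ivec_pair_unipotent.
- have /andP[jk kl] := h; rewrite !iso_minusE ?(ltn_trans jk) //.
  exact: ivec_pair_unipotent.
- by rewrite iso_minusE // -cliff_evec; apply: ivec_evec_unipotent.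
Qed.

Lemma torus_lieE j : (j < l)%N -> torus_lie C l j =
  - 'i *: (cliff (basis_vec C (inord j.*2)) *m cliff (basis_vec C (inord j.*2.+1) : vec)).
Proof. by move=> /double_lt[j0 j1]; rewrite !cliff_inord. Qed.

Lemma torus_lie_so j : (j < l)%N -> so_lie (torus_lie C l j).
Proof.
move=> jl; rewrite torus_lieE //; apply: SoScale; apply: so_lie_cliff => //.
by have [j0 j1] := double_lt jl; rewrite dot_inord // (ltn_eqF (ltnSn _)).
Qed.

Lemma cliff_bracket (u v w : vec) :
  cliff u *m cliff v *m cliff w - cliff w *m (cliff u *m cliff v)
    = cliff ((dot v w *+ 2) *: u - (dot u w *+ 2) *: v).
Proof.
have e1 := cliff_clifford v w; have e2 := cliff_clifford u w.
rewrite cliffD cliffN !cliffZ -mul_mx_scalar -e1 -[X in _ = _ - X]mul_scalar_mx -e2.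
by rewrite mulmxDr mulmxDl !mulmxA addrKA.
Qed.

Definition adw (X Y : mat) (c : C) : Prop := X *m Y - Y *m X = c *: Y.

Lemma adwM X Y Z c d : adw X Y c -> adw X Z d -> adw X (Y *m Z) (c + d).
Proof.
rewrite /adw => eY eZ; have -> : X *m (Y *m Z) - Y *m Z *m X =
  (X *m Y - Y *m X) *m Z + Y *m (X *m Z - Z *m X).
  by rewrite mulmxBl mulmxBr !mulmxA addrA subrK.
by rewrite eY eZ -scalemxAl -scalemxAr scalerDl.
Qed.

(** The factor -2 i s is 2 for s = i and -2 for s = -i: the two isotropic vectors have weights
    epsilon_k and -epsilon_k, doubled. *)
Lemma adw_torus_ivec j k s : (j < l)%N -> (k < l)%N -> s ^+ 2 = -1 ->
  adw (torus_lie C l j) (cliff (ivec s k)) ((j == k)%:R * (- 'i * s *+ 2)).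
Proof.
move=> jl kl s2; rewrite /adw torus_lieE // -scalemxAl -scalemxAr -scalerBr.
rewrite cliff_bracket -!cliffZ; congr cliff.
have [j0 j1] := double_lt jl; have [k0 k1] := double_lt kl.
rewrite /ivec !dotE !dot_inord // eqSS (inj_eq double_inj).
have -> : (j.*2 == k.*2.+1) = false.
  by apply/eqP => /(congr1 odd); rewrite /= !odd_double.
have -> : (j.*2.+1 == k.*2) = false.
  by apply/eqP => /(congr1 odd); rewrite /= !odd_double.
case: eqVneq => [->|_]; last by rewrite !mulr0 !addr0 !mul0rn !scale0r subrr scaler0 mul0r scale0r.
rewrite !mulr1 mulr0 addr0 add0r mul1r scalerBr !scalerDr !scalerA -scaleNr.
have -> : - 'i * s *+ 2 * s = - (- 'i * (true%:R *+ 2)) :> C.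
  by transitivity (- 'i * s ^+ 2 *+ 2); [ring|rewrite s2 /=; ring].
by congr (_ *: _ + _); rewrite mulrnAr.
Qed.

Lemma adw_torus_evec j : (j < l)%N -> adw (torus_lie C l j) (cliff evec) 0.
Proof.
move=> jl; rewrite /adw torus_lieE // -scalemxAl -scalemxAr -scalerBr cliff_bracket.
have [j0 j1] := double_lt jl; rewrite !dot_inord // (inj_eq double_inj) (ltn_eqF jl).
have -> : (j.*2.+1 == l.*2) = false.
  by apply/eqP => /(congr1 odd); rewrite /= !odd_double.
by rewrite !mul0rn !scale0r subrr cliff0 scaler0.
Qed.

End RootVectors.

(** * The triangular decomposition and the extremal functional *)

Section HighestWeightFunctional.

Variables (C : numClosedFieldType) (l : nat).
Hypothesis l_gt0 : (0 < l)%N.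
Notation mat := 'M[C]_(spindim l).

Inductive triangular_gen : mat -> Prop :=
| TriNeg X of neg_root X : triangular_gen X
| TriTorus j of (j < l)%N : triangular_gen (torus_lie C l j)
| TriPos X of pos_root X : triangular_gen X.

Lemma gamma_isotropic (a : nat) : (a < l.*2)%N -> exists c d : C,
  gamma C l a = c *: iso_plus C l a./2 + d *: iso_minus C l a./2.
Proof.
move=> al; rewrite /iso_plus /iso_minus.
have i0 : 'i != 0 :> C by apply: neq0Ci.
have [oa|ea] := boolP (odd a).
  have -> : a = a./2.*2.+1 by rewrite -{1}(odd_double_half a) oa.
  exists (2 * 'i)^-1, (- (2 * 'i)^-1); rewrite /= uphalf_double !scalerDr !scalerN !scaleNr.
  rewrite opprK addrACA subrr add0r !scalerA -scalerDl.
  have -> : (2 * 'i)^-1 * 'i + (2 * 'i)^-1 * 'i = 1 :> C by field.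
  by rewrite scale1r.
have -> : a = a./2.*2 by rewrite -{1}(odd_double_half a) (negPf ea).
exists 2^-1, 2^-1; rewrite doubleK -scalerDr addrACA subrr addr0 -mulr2n -scaler_nat.
by rewrite scalerA mulVf ?pnatr_eq0 // scale1r.
Qed.

(** A product of two gammas with indices 2j, 2j + 1 is a multiple of a torus element. Any other
    pair, expanded in isotropic vectors, gives root vectors. *)
Lemma triangular_span X : so_lie X -> lspan triangular_gen X.
Proof.
apply: (so_lie_gamma_ind l_gt0); last 2 first.
- exact: lspanD.
- exact: lspanZ.
suff ordered (a b : 'I_l.*2.+1) : (a < b)%N ->
    lspan triangular_gen (gamma C l a *m gamma C l b).
  move=> a b ab; case: (ltngtP a b) => [|ba|/val_inj eab]; first exact: ordered.
    have -> : gamma C l a *m gamma C l b = - (gamma C l b *m gamma C l a).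
      by rewrite -!cliff_basis cliff_anticomm // dot_basis2 (negPf ab).
    exact/lspanN/ordered.
  by rewrite eab eqxx in ab.
case: a b => a ha [b hb] /= ab.
have al : (a < l.*2)%N by apply: leq_trans ab _.
have a2 : (a./2 < l)%N by rewrite -ltn_double (leq_ltn_trans _ al) // -[leqRHS]odd_double_half leq_addl.
rewrite ltnS leq_eqVlt in hb; case/orP: hb => [/eqP->|bl].
  have [c [d ->]] := gamma_isotropic al.
  rewrite mulmxDl -!scalemxAl; apply: lspanD; apply: lspanZ; apply: lspan_in.
    by apply: TriPos; apply: PosShort.
  by apply: TriNeg; apply: NegShort.
have b2 : (b./2 < l)%N by rewrite -ltn_double (leq_ltn_trans _ bl) // -[leqRHS]odd_double_half leq_addl.
have := half_leq (ltnW ab); rewrite leq_eqVlt => /orP[/eqP eab|lab].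
  have ea : a = a./2.*2.
    rewrite -{1}(odd_double_half a); case oa: (odd a) => //=.
    move: ab; rewrite -(odd_double_half a) -(odd_double_half b) -eab oa.
    by rewrite ltn_add2r; case: (odd b).
  have eb : b = a./2.*2.+1.
    rewrite -{1}(odd_double_half b) -eab; case ob: (odd b) => //=.
    by move: ab; rewrite {1}ea -(odd_double_half b) -eab ob ltnn.
  have -> : gamma C l a *m gamma C l b = 'i *: torus_lie C l a./2.
    by rewrite eb {1}ea /torus_lie scalerA mulrN -expr2 sqrCi opprK scale1r.
  by apply/lspanZ/lspan_in/TriTorus.
have [c [d ->]] := gamma_isotropic al.
have [c' [d' ->]] := gamma_isotropic bl.
rewrite mulmxDl !mulmxDr -!scalemxAl -!scalemxAr.
have h : (a./2 < b./2 < l)%N by rewrite lab.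
do !apply: lspanD; do 2!apply: lspanZ; apply: lspan_in.
- by apply: TriPos; apply: PosAdd.
- by apply: TriPos; apply: PosSub.
- by apply: TriNeg; apply: NegSub.
- by apply: TriNeg; apply: NegAdd.
Qed.

(** The coefficients l - j give every simple root the same eigenvalue 2 under the adjoint action, so
    the eigenvalue of a root is twice its height. *)
Definition height_elt : mat := \sum_(j < l) (l - j)%:R *: torus_lie C l j.

Lemma height_so_lie : so_lie height_elt.
Proof.
by apply: so_lie_sum => // j _; apply: SoScale; apply: torus_lie_so.
Qed.

Lemma adw_sum (F : 'I_l -> mat) (c d : 'I_l -> C) Y :
  (forall j, adw (F j) Y (d j)) -> adw (\sum_j c j *: F j) Y (\sum_j c j * d j).
Proof.
move=> h; rewrite /adw mulmx_suml mulmx_sumr -sumrB scaler_suml.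
by apply: eq_bigr => j _; rewrite -scalemxAl -scalemxAr -scalerBr h scalerA.
Qed.

Lemma adw_height_ivec k s : (k < l)%N -> s ^+ 2 = -1 ->
  adw height_elt (cliff (ivec l s k)) ((l - k)%:R * (- 'i * s *+ 2)).
Proof.
move=> kl s2.
have := adw_sum (fun j => (l - j)%:R) (fun j : 'I_l => adw_torus_ivec (ltn_ord j) kl s2).
have -> // : \sum_(j < l) (l - j)%:R * ((val j == k)%:R * (- 'i * s *+ 2)) =
  (l - k)%:R * (- 'i * s *+ 2).
rewrite (bigD1 (Ordinal kl)) //= eqxx mul1r big1 ?addr0 // => j.
by rewrite -val_eqE /= => /negPf ->; rewrite mul0r mulr0.
Qed.

Lemma adw_height_evec : adw height_elt (cliff (evec C l)) 0.
Proof.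
have := adw_sum (fun j => (l - j)%:R) (fun j : 'I_l => adw_torus_evec C (ltn_ord j)).
have -> // : \sum_(j < l) (l - j)%:R * 0 = 0 :> C.
by apply: big1 => j _; rewrite mulr0.
Qed.

Lemma neg_root_height X : neg_root X -> exists2 m, (0 < m)%N & adw height_elt X (- (m%:R *+ 2)).
Proof.
have i2 : ('i : C) ^+ 2 = -1 := sqrCi C.
have Ni2 : (- 'i : C) ^+ 2 = -1 by rewrite sqrrN.
have ep : - 'i * 'i *+ 2 = 2 :> C by rewrite mulNr -expr2 i2 opprK.
have em : - 'i * - 'i *+ 2 = - 2 :> C by rewrite -expr2 Ni2 mulNrn.
case=> [j k|j k|j] h.
- have /andP[jk kl] := h; have jl := ltn_trans jk kl.
  exists (k - j)%N; first by rewrite subn_gt0.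
  rewrite iso_plusE // iso_minusE //.
  have := adwM (adw_height_ivec jl Ni2) (adw_height_ivec kl i2).
  rewrite ep em !natrB // ?(ltnW jl) ?(ltnW kl) ?(ltnW jk) //.
  by congr adw; ring.
- have /andP[jk kl] := h; have jl := ltn_trans jk kl.
  exists ((l - j) + (l - k))%N; first by rewrite addn_gt0 subn_gt0 jl.
  rewrite !iso_minusE //.
  have := adwM (adw_height_ivec jl Ni2) (adw_height_ivec kl Ni2).
  by rewrite em natrD; congr adw; ring.
- exists (l - j)%N; first by rewrite subn_gt0.
  rewrite iso_minusE // -cliff_evec.
  have := adwM (adw_height_ivec h Ni2) adw_height_evec.
  by rewrite em; congr adw; ring.
Qed.

(** An eigenvalue of maximal real part is taken; adding 2 m with m > 0 then leaves the spectrum. *)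
Lemma left_eigenvector n (D : 'M[C]_n) : (0 < n)%N -> exists (a : C) (xi : 'rV_n),
  [/\ xi != 0, xi *m D = a *: xi
    & forall m (eta : 'rV_n), (0 < m)%N -> eta *m D = (a + m%:R *+ 2) *: eta -> eta = 0].
Proof.
move=> n0.
case: (closed_field_poly_normal (char_poly D)) => rs.
rewrite (monicP (char_poly_monic D)) scale1r => rsP.
have eigP b : (b \in rs) = eigenvalue D b.
  by rewrite eigenvalue_root_char rsP root_prod_XsubC.
have rs0 : rs != [::].
  apply/eqP => e; have := size_char_poly D; rewrite rsP e big_nil size_poly1.
  by case; case: n n0 {D rs rsP eigP e}.
have [a ars amax] : exists2 a, a \in rs & forall b, b \in rs -> 'Re b <= 'Re a.
  move: rs0; move: (rs) => s; elim: s => // b s IH _.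
  have [->|/IH[a as_ amax]] := eqVneq s [::].
    by exists b; rewrite ?mem_head // => c; rewrite mem_seq1 => /eqP->.
  have := real_leVge (Creal_Re a) (Creal_Re b) => /orP[ab|ba].
    exists b; rewrite ?mem_head // => c; rewrite inE => /orP[/eqP->//|/amax ca].
    exact: le_trans ca ab.
  exists a; rewrite ?inE ?as_ ?orbT // => c; rewrite inE => /orP[/eqP->//|/amax //].
have /eigenvalueP[xi xiD xi0] : eigenvalue D a by rewrite -eigP.
exists a, xi; split=> // m eta m0 etaD; apply/eqP/negPn/negP => eta0.
have : a + m%:R *+ 2 \in rs by rewrite eigP; apply/eigenvalueP; exists eta.
move/amax; rewrite raddfD /= -mulrnA.
have /Creal_ReP -> : (m * 2)%:R \is @Num.real C by rewrite realn.
by rewrite gerDl lern0 muln_eq0 orbF => /eqP m00; rewrite m00 in m0.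
Qed.

Variables (n : nat) (f : mat -> 'M[C]_n) (df : {linear mat -> 'M[C]_n}).
Hypotheses (f_irr : irreducible_rep (@spin C l) f) (f_diff : is_diff (@spin C l) f df).

Let f_morph : alg_morphism (@spin C l) f. Proof. by case: f_irr. Qed.

Lemma diff_adw X Y c : so_lie X -> so_lie Y -> adw X Y c ->
  df X *m df Y - df Y *m df X = c *: df Y.
Proof. by move=> sX sY e; rewrite -(diff_bracket f_morph f_diff) // e linearZZ. Qed.

Lemma torus_lie_comm j k : (j < l)%N -> (k < l)%N ->
  torus_lie C l j *m torus_lie C l k - torus_lie C l k *m torus_lie C l j = 0.
Proof.
move=> jl kl; have i2 : ('i : C) ^+ 2 = -1 := sqrCi C.
have Ni2 : (- 'i : C) ^+ 2 = -1 by rewrite sqrrN.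
have := adwM (adw_torus_ivec jl kl i2) (adw_torus_ivec jl kl Ni2).
have -> : (j == k)%:R * (- 'i * 'i *+ 2) + (j == k)%:R * (- 'i * - 'i *+ 2) = 0 :> C.
  by rewrite mulrN mulNr; ring.
have -> : cliff (ivec l 'i k) *m cliff (ivec l (- 'i) k) =
    (1%:M + torus_lie C l k) *+ 2 :> mat.
  have [k0 k1] := double_lt kl.
  rewrite /ivec scaleNr cliffD [cliff (_ - _)]cliffD cliffN cliffZ.
  rewrite mulmxDl !mulmxDr !mulmxN !cliff_sqr !dot_inord // !eqxx.
  rewrite -!scalemxAl -!scalemxAr cliff_sqr dot_inord // eqxx scalerA -expr2 i2.
  rewrite (@cliff_anticomm _ _ (basis_vec C (inord k.*2.+1))); last first.
    by rewrite dot_inord // (gtn_eqF (ltnSn _)).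
  rewrite torus_lieE //; move: (_ *m _) => W.
  by apply/matrixP => r s; rewrite !mxE /=; ring.
rewrite /adw scale0r -scaler_nat -scalemxAr -scalemxAl -scalerBr.
move/eqP; rewrite scaler_eq0 pnatr_eq0 /= mulmxDr mulmxDl mulmx1 mul1mx => /eqP <-.
by rewrite opprD addrACA subrr add0r.
Qed.

(** A negative root vector would raise the eigenvalue of [xi] under [height_elt], which is extremal;
    so it kills [xi]. The difference xi h_j - m_j xi has the same eigenvalue, is therefore killed
    too, and vanishes on [v]; [irreducible_functional], applied to it and [v], shows that it is
    zero. *)
Lemma lowest_weight_functional (v : 'cV[C]_n) (m : nat -> C) : v != 0 ->
  (forall j, (j < l)%N -> df (torus_lie C l j) *m v = m j *: v) ->
  (forall X, pos_root X -> df X *m v = 0) ->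
  exists xi : 'rV[C]_n, [/\ xi != 0,
    forall j, (j < l)%N -> xi *m df (torus_lie C l j) = m j *: xi
    & forall X, neg_root X -> xi *m df X = 0].
Proof.
move=> v0 vt vp; have n0 : (0 < n)%N by case: f_irr.
have [a [xi [xi0 xiD amax]]] := left_eigenvector (df height_elt) n0.
have kill (eta : 'rV_n) X : eta *m df height_elt = a *: eta -> neg_root X -> eta *m df X = 0.
  move=> etaD nX; have [d d0 dX] := neg_root_height nX; apply: (amax d) => //.
  have [sX _ _] := neg_root_unipotent l_gt0 nX.
  have := diff_adw height_so_lie sX dX.
  move/(congr1 (mulmx eta)); rewrite mulmxBr !mulmxA etaD -scalemxAr -scalemxAl.
  move/eqP; rewrite subr_eq => /eqP E.
  by rewrite scalerDl E scaleNr addrAC addNr add0r.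
exists xi; split=> // [j jl|X]; last exact: kill.
apply/eqP; rewrite -subr_eq0; apply/eqP.
set eta := _ - _.
have etaD : eta *m df height_elt = a *: eta.
  rewrite /eta mulmxBl -scalemxAl xiD -mulmxA.
  have -> : df (torus_lie C l j) *m df height_elt = df height_elt *m df (torus_lie C l j).
    rewrite /height_elt linear_sum /= mulmx_suml mulmx_sumr; apply: eq_bigr => k _.
    rewrite (linearZZ df (l - k)%:R) -scalemxAl -scalemxAr; congr (_ *: _); apply/eqP.
    rewrite -subr_eq0 -(diff_bracket f_morph f_diff) ?torus_lie_comm ?linear0 //;
      exact: torus_lie_so.
  by rewrite mulmxA xiD -scalemxAl scalerBr !scalerA mulrC.
apply: (irreducible_functional l_gt0 f_irr f_diff triangular_span _ _ v0).
- move=> X [Y nY|k kl|Y pY].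
  + left; split; last by exists 0; rewrite scale0r kill.
    by have [] := neg_root_unipotent l_gt0 nY.
  + by right; exists (m k); apply: vt.
  + by right; exists 0; rewrite scale0r vp.
by rewrite /eta mulmxBl -mulmxA vt // -scalemxAr -scalemxAl subrr.
Qed.

End HighestWeightFunctional.

(** * Lifting orthogonal matrices to the spin group *)

Section OrthogonalLift.

Variables (C : numClosedFieldType) (l : nat).
Hypothesis l_gt0 : (0 < l)%N.
Notation mat := 'M[C]_(spindim l).
Notation vec := 'cV[C]_(l.*2.+1).

Definition orthogonal_mx n (A : 'M[C]_n) : Prop := A^T *m A = 1%:M.

Lemma dot_mx (v w : vec) : v^T *m w = (dot v w)%:M.
Proof.
by rewrite [LHS]mx11_scalar mxE /dot; congr _%:M; apply: eq_bigr => i _; rewrite mxE.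
Qed.

Lemma dot_mulmx (A : 'M[C]_(l.*2.+1)) v w : dot (A *m v) w = dot v (A^T *m w).
Proof.
have := dot_mx (A *m v) w; rewrite trmx_mul -mulmxA dot_mx.
by move=> /matrixP/(_ 0 0); rewrite !mxE eqxx !mulr1n.
Qed.

Lemma dot_orthogonal (A : 'M[C]_(l.*2.+1)) v w : orthogonal_mx A ->
  dot (A *m v) (A *m w) = dot v w.
Proof. by move=> oA; rewrite dot_mulmx mulmxA oA mul1mx. Qed.

(* The elements of the Pin group act through B up to sign. *)
Definition pin_reaches (B : 'M[C]_(l.*2.+1)) : Prop :=
  exists (s : seq vec) (e : C), [/\ forall v, v \in s -> unit_vector v, e ^+ 2 = 1
    & forall v, (\prod_(u <- s) cliff u) *m cliff v *m (\prod_(u <- rev s) cliff u)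
                = e *: cliff (B *m v)].

Lemma pin_reaches_mul B B' : pin_reaches B -> pin_reaches B' -> pin_reaches (B *m B').
Proof.
case=> s [e [us e2 hs]] [s' [e' [us' e2' hs']]]; exists (s ++ s'), (e * e'); split.
- by move=> v; rewrite mem_cat => /orP[/us|/us'].
- by rewrite exprMn e2 e2' mulr1.
move=> v; rewrite rev_cat !big_cat /= -!mulmxE.
have -> : \prod_(u <- s) cliff u *m \prod_(u <- s') cliff u *m cliff v *m
   (\prod_(u <- rev s') cliff u *m \prod_(u <- rev s) cliff u) =
   \prod_(u <- s) cliff u *m (\prod_(u <- s') cliff u *m cliff v *m
   \prod_(u <- rev s') cliff u) *m \prod_(u <- rev s) cliff u by rewrite !mulmxA.
by rewrite hs' -scalemxAr -scalemxAl hs scalerA mulrC mulmxA.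
Qed.

Lemma pin_reaches_reflection (w : vec) : dot w w != 0 ->
  pin_reaches (1%:M - (2 / dot w w) *: (w *m w^T)).
Proof.
move=> ww; pose r := sqrtC (dot w w); pose u := r^-1 *: w.
have r2 : r ^+ 2 = dot w w by rewrite sqrtCK.
have uu : dot u u = 1 by rewrite dotZl dotZr mulrA -expr2 exprVn r2 mulVf.
exists [:: u], (-1); split; first by move=> v; rewrite inE => /eqP->; apply/unit_vectorE.
  by rewrite sqrrN expr1n.
move=> v; rewrite (_ : rev [:: u] = [:: u]) // !big_seq1 conj_unit_vector // scaleN1r -cliffN.
congr cliff; rewrite mulmxBl mul1mx opprB -scalemxAl -mulmxA dot_mx mul_mx_scalar.
rewrite /u dotZl scalerA scalerA; congr (_ *: _ - _).
by rewrite -r2 expr2 invfM; ring.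
Qed.

Lemma reflection_fix (w v : vec) : dot w v = 0 ->
  (1%:M - (2 / dot w w) *: (w *m w^T)) *m v = v.
Proof.
by move=> wv; rewrite mulmxBl mul1mx -scalemxAl -mulmxA dot_mx wv mul_mx_scalar scale0r scaler0 subr0.
Qed.

Lemma reflection_swap (a b : vec) : dot a a = dot b b -> dot (a - b) (a - b) != 0 ->
  (1%:M - (2 / dot (a - b) (a - b)) *: ((a - b) *m (a - b)^T)) *m a = b.
Proof.
move=> ab nz; rewrite mulmxBl mul1mx -scalemxAl -mulmxA dot_mx mul_mx_scalar scalerA.
have -> : dot (a - b) a = dot (a - b) (a - b) / 2.
  by rewrite !dotE (dotC b a) -ab; field.
have -> : 2 / dot (a - b) (a - b) * (dot (a - b) (a - b) / 2) = 1 :> C by field.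
by rewrite scale1r opprB addrC subrK.
Qed.

Lemma reflection_orthogonal (w : vec) : dot w w != 0 ->
  orthogonal_mx (1%:M - (2 / dot w w) *: (w *m w^T)).
Proof.
move=> ww; rewrite /orthogonal_mx.
have -> : (1%:M - (2 / dot w w) *: (w *m w^T))^T = 1%:M - (2 / dot w w) *: (w *m w^T).
  apply/matrixP => i j; rewrite !mxE !big_ord1 !mxE (eq_sym j).
  by rewrite (mulrC (w j 0)).
have ww2 : (w *m w^T) *m (w *m w^T) = dot w w *: (w *m w^T).
  by rewrite mulmxA -(mulmxA w) dot_mx mul_mx_scalar -scalemxAl.
rewrite mulmxBl mul1mx mulmxBr mulmx1 -scalemxAl -scalemxAr ww2 !scalerA.
have -> : 2 / dot w w * (2 / dot w w) * dot w w = (2 / dot w w) *+ 2 by field.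
by move: (w *m w^T) => W; apply/matrixP => i j; rewrite !mxE; ring.
Qed.

Lemma orthogonal_mxM n (A B : 'M[C]_n) : orthogonal_mx A -> orthogonal_mx B ->
  orthogonal_mx (A *m B).
Proof.
move=> oA oB; rewrite /orthogonal_mx trmx_mul mulmxA -(mulmxA _ A^T) oA mulmx1.
exact: oB.
Qed.

(** The Cartan-Dieudonne argument: basis vectors are brought back one at a time by reflections that
    fix the earlier ones. *)
Lemma pin_straighten (A : 'M[C]_(l.*2.+1)) (k : nat) : orthogonal_mx A ->
  (k <= l.*2.+1)%N -> exists B, [/\ pin_reaches B, orthogonal_mx B &
    forall i : 'I_l.*2.+1, (i < k)%N -> B *m A *m basis_vec C i = basis_vec C i].
Proof.
move=> oA; elim: k => [_|k IH kl].
  exists 1%:M; split=> //; last by rewrite /orthogonal_mx trmx1 mulmx1.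
  exists [::], 1; split=> //; first by rewrite expr1n.
  by move=> v; rewrite !big_nil mulmx1 mul1mx scale1r mul1mx.
have [B [rB oB fB]] := IH (ltnW kl).
pose j := Ordinal kl; pose b := basis_vec C j; pose a := B *m A *m b.
have oBA := orthogonal_mxM oB oA.
have aa : dot a a = 1 by rewrite dot_orthogonal // dot_basis2 eqxx.
have bb : dot b b = 1 by rewrite dot_basis2 eqxx.
have bi (i : 'I_l.*2.+1) : (i < k)%N -> dot b (basis_vec C i) = 0.
  by move=> ik; rewrite dot_basis2 -val_eqE /= (gtn_eqF ik).
have ai (i : 'I_l.*2.+1) : (i < k)%N -> dot a (basis_vec C i) = 0.
  by move=> ik; rewrite -(fB i ik) dot_orthogonal // bi.
suff [D [rD oD Da Di]] : exists D, [/\ pin_reaches D, orthogonal_mx D, D *m a = b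
    & forall v, dot a v = 0 -> dot b v = 0 -> D *m v = v].
  exists (D *m B); split; [exact: pin_reaches_mul|exact: orthogonal_mxM|] => i.
  rewrite ltnS leq_eqVlt => /orP[/eqP ik|ik].
    have -> : i = j by apply: val_inj.
    by rewrite -!mulmxA (mulmxA B) -/b -/a Da.
  by rewrite -!mulmxA (mulmxA B) fB // Di // ?ai ?bi.
have [ab0|nz] := eqVneq (dot (a - b) (a - b)) 0; last first.
  exists (1%:M - (2 / dot (a - b) (a - b)) *: ((a - b) *m (a - b)^T)); split.
  - exact: pin_reaches_reflection.
  - exact: reflection_orthogonal.
  - by rewrite reflection_swap // aa bb.
  - by move=> v av bv; rewrite reflection_fix // !dotE av bv subrr.
(* If a - b is isotropic, then a + b has norm 4: one reflection sends a to -b, and the reflection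
   along b sends -b to b. *)
pose c := - b.
have nzc : dot (a - c) (a - c) != 0.
  have -> : dot (a - c) (a - c) = 4 - dot (a - b) (a - b).
    by rewrite /c !dotE aa bb (dotC b a); ring.
  by rewrite ab0 subr0 pnatr_eq0.
have nzb : dot b b != 0 by rewrite bb oner_eq0.
exists ((1%:M - (2 / dot b b) *: (b *m b^T)) *m
  (1%:M - (2 / dot (a - c) (a - c)) *: ((a - c) *m (a - c)^T))); split.
- by apply: pin_reaches_mul; apply: pin_reaches_reflection.
- by apply: orthogonal_mxM; apply: reflection_orthogonal.
- have cc : dot c c = 1 by rewrite /c dotNl dotNr opprK.
  rewrite -mulmxA (reflection_swap (etrans aa (esym cc)) nzc).
  rewrite mulmxBl mul1mx -scalemxAl -mulmxA dot_mx mul_mx_scalar bb /c dotNr bb.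
  rewrite divr1 scaleN1r scalerN opprK scaler_nat mulr2n addrA addNr add0r //.
- move=> v av bv.
  have bv' : dot (a - c) v = 0 by rewrite /c dotDl !dotNl av bv !oppr0 addr0.
  by rewrite -mulmxA (reflection_fix bv') (reflection_fix bv).
Qed.

(** Each basis vector anticommutes with the 2l others, an even number, so the product of all 2l + 1
    is central. It serves to change the parity of a product without changing the conjugation. *)
Lemma conj_all_gamma (v : vec) :
  (\prod_(u <- [seq basis_vec C i | i : 'I_l.*2.+1]) cliff u) *m cliff v *m
  (\prod_(u <- rev [seq basis_vec C i | i : 'I_l.*2.+1]) cliff u) = cliff v.
Proof.
have -> : v = \sum_i v i 0 *: basis_vec C i.
  apply/matrixP => i j; rewrite (ord1 j) summxE (bigD1 i) //= !mxE !eqxx mulr1.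
  by rewrite big1 ?addr0 // => k ki; rewrite !mxE eq_sym (negPf ki) mulr0.
rewrite cliff_sum mulmx_sumr mulmx_suml; apply: eq_bigr => j _.
rewrite cliffZ -scalemxAr -scalemxAl; congr (_ *: _).
have gen (r : seq 'I_l.*2.+1) :
  (\prod_(u <- [seq basis_vec C i | i <- r]) cliff u) *m cliff (basis_vec C j) *m
  (\prod_(u <- rev [seq basis_vec C i | i <- r]) cliff u) =
  (-1) ^+ count (predC (pred1 j)) r *: cliff (basis_vec C j).
  elim: r => [|i r IH]; first by rewrite !big_nil mul1mx mulmx1 expr0 scale1r.
  rewrite /= rev_cons -cats1 big_cons big_cat big_seq1 /= -!mulmxE.
  set P := \prod_(u <- _) _ in IH *; set Q := \prod_(u <- _) _ in IH *.
  have -> : cliff (basis_vec C i) *m P *m cliff (basis_vec C j) *m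
     (Q *m cliff (basis_vec C i)) = cliff (basis_vec C i) *m
     (P *m cliff (basis_vec C j) *m Q) *m cliff (basis_vec C i) by rewrite !mulmxA.
  rewrite IH -scalemxAr -scalemxAl conj_unit_vector ?dot_basis2 ?eqxx //.
  have [->|ij] /= := eqVneq i j.
    by rewrite add0n mulr2n scalerDl scale1r addrK.
  by rewrite mul0rn scale0r sub0r cliffN exprS mulN1r scaleNr scalerN.
rewrite gen; have -> : count (predC (pred1 j)) (enum 'I_l.*2.+1) = l.*2.
  have := count_predC (pred1 j) (enum 'I_l.*2.+1).
  rewrite size_enum_ord (count_uniq_mem _ (enum_uniq _)) mem_enum inE /= add1n.
  by case.
by rewrite -mul2n exprM sqrrN expr1n expr1n scale1r.
Qed.

(** If A has determinant -1, then -A, not A, is in the image of the spin group, whence the sign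
    [e]. *)
Lemma spin_lift (A : 'M[C]_(l.*2.+1)) : orthogonal_mx A ->
  exists x e, [/\ spin x, e ^+ 2 = 1
    & forall v, x *m cliff v *m invmx x = e *: cliff (A *m v)].
Proof.
move=> oA.
have [B [[s [e [us e2 hs]]] oB BA]] := pin_straighten oA (leqnn _).
have {}BA : B *m A = 1%:M.
  apply/matrixP => i j; have := BA j (ltn_ord j).
  by rewrite /basis_vec -colE => /matrixP/(_ i 0); rewrite !mxE eqxx andbT.
pose all := [seq basis_vec C i | i : 'I_l.*2.+1].
have uall v : v \in all -> unit_vector v.
  by case/mapP => i _ ->; apply/unit_vectorE; rewrite dot_basis2 eqxx.
have [t [ut ot ht]] : exists t : seq vec, [/\ forall v, v \in t -> unit_vector v,
    ~~ odd (size t) & forall v, (\prod_(u <- t) cliff u) *m cliff v *m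
      (\prod_(u <- rev t) cliff u) = e *: cliff (B *m v)].
  have [os|os] := boolP (odd (size s)); last by exists s.
  exists (s ++ all); split.
  - by move=> v; rewrite mem_cat => /orP[/us|/uall].
  - by rewrite size_cat oddD os size_map size_enum_ord /= odd_double.
  move=> v; rewrite rev_cat !big_cat /= -!mulmxE.
  have -> : \prod_(u <- s) cliff u *m \prod_(u <- all) cliff u *m cliff v *m
     (\prod_(u <- rev all) cliff u *m \prod_(u <- rev s) cliff u) =
     \prod_(u <- s) cliff u *m (\prod_(u <- all) cliff u *m cliff v *m
     \prod_(u <- rev all) cliff u) *m \prod_(u <- rev s) cliff u by rewrite !mulmxA.
  by rewrite conj_all_gamma hs.
pose y := \prod_(u <- t) cliff u; pose x := \prod_(u <- rev t) cliff u.
have urt v : v \in rev t -> unit_vector v by rewrite mem_rev => /ut.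
have yx : y *m x = 1%:M := prod_cliff_rev ut.
have xy : x *m y = 1%:M by have := prod_cliff_rev urt; rewrite revK.
have sx : spin x by exists (rev t); split=> //; rewrite size_rev.
exists x, e; split=> // v.
have ux := spin_unitmx sx.
have -> : invmx x = y by rewrite -[RHS]mulmx1 -(mulmxV ux) mulmxA yx mul1mx.
have := ht (A *m v); rewrite mulmxA BA mul1mx -/y -/x => E.
have : x *m (y *m cliff (A *m v) *m x) *m y = x *m (e *: cliff v) *m y by rewrite E.
rewrite !mulmxA xy mul1mx -mulmxA xy mulmx1 -scalemxAr -scalemxAl => ->.
by rewrite scalerA -expr2 e2 scale1r.
Qed.

End OrthogonalLift.

(** * Computation with matrices of Gaussian integers *)

Section GaussianMatrices.

(** The pair (a, b) stands for a + b i. The operations below are the bare ones on [int], which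
    [vm_compute] evaluates. *)
Definition gauss : Type := (int * int)%type.
Definition gadd (x y : gauss) : gauss :=
  (intZmod.addz x.1 y.1, intZmod.addz x.2 y.2).
Definition gopp (x : gauss) : gauss := (intZmod.oppz x.1, intZmod.oppz x.2).
Definition gmul (x y : gauss) : gauss :=
  (intZmod.addz (intRing.mulz x.1 y.1) (intZmod.oppz (intRing.mulz x.2 y.2)),
   intZmod.addz (intRing.mulz x.1 y.2) (intRing.mulz x.2 y.1)).
Definition gconj (x : gauss) : gauss := (x.1, intZmod.oppz x.2).
Definition g0 : gauss := (Posz 0, Posz 0).
Definition g1 : gauss := (Posz 1, Posz 0).
Definition gi : gauss := (Posz 0, Posz 1).

(** A list of rows without a recorded size: missing entries are read as zero, so [[::]] is the zero
    matrix of every size. *)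
Definition gmat : Type := seq (seq gauss).
Definition gget (A : gmat) (i j : nat) : gauss := nth g0 (nth [::] A i) j.
Definition gbuild (m n : nat) (F : nat -> nat -> gauss) : gmat :=
  mkseq (fun i => mkseq (F i) n) m.
Definition gsum (s : seq gauss) : gauss := foldr gadd g0 s.
Fixpoint grow2 (f : gauss -> gauss -> gauss) (n : nat) (r s : seq gauss) : seq gauss :=
  if n is n'.+1 then f (head g0 r) (head g0 s) :: grow2 f n' (behead r) (behead s) else [::].
Definition gzero (x : gauss) : bool := if x is (Posz 0, Posz 0) then true else false.
(** A row times a matrix. Zero coefficients skip their row of [B], which pays off because the
    matrices involved are sparse. *)
Fixpoint growmul (p n : nat) (r : seq gauss) (B : gmat) : seq gauss :=
  if n is n'.+1 then
    let t := growmul p n' (behead r) (behead B) in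
    if gzero (head g0 r) then t
    else grow2 (fun b u => gadd (gmul (head g0 r) b) u) p (head [::] B) t
  else [::].
Definition gmulmx (m n p : nat) (A B : gmat) : gmat :=
  mkseq (fun i => growmul p n (nth [::] A i) B) m.
Definition gaddmx (m n : nat) (A B : gmat) : gmat :=
  mkseq (fun i => grow2 gadd n (nth [::] A i) (nth [::] B i)) m.
Definition gscalemx (m n : nat) (c : gauss) (A : gmat) : gmat :=
  mkseq (fun i => grow2 (fun x _ => gmul c x) n (nth [::] A i) [::]) m.
Definition gtrmx (m n : nat) (A : gmat) : gmat := gbuild n m (fun i j => gget A j i).
Definition gstarmx (m n : nat) (A : gmat) : gmat :=
  gbuild n m (fun i j => gconj (gget A j i)).
Definition gscalar (n : nat) (c : gauss) : gmat :=
  gbuild n n (fun i j => if eqn i j then c else g0).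
Definition gblock (m n : nat) (A B D E : gmat) : gmat :=
  gbuild (m + n) (m + n) (fun i j =>
    if (i < m)%N then (if (j < m)%N then gget A i j else gget B i (j - m))
    else (if (j < m)%N then gget D (i - m) j else gget E (i - m) (j - m))).

Fixpoint ggamma (l k : nat) : gmat :=
  match l with
  | 0 => gscalar 1 g1
  | l'.+1 => let n := spindim l' in
    match k with
    | 0 => gblock n n [::] (gscalar n g1) (gscalar n g1) [::]
    | 1 => gblock n n [::] (gscalar n (gopp gi)) (gscalar n gi) [::]
    | k'.+2 => gblock n n (ggamma l' k') [::] [::]
                 (gscalemx n n (gopp g1) (ggamma l' k'))
    end
  end.

Fixpoint groweq (n : nat) (r s : seq gauss) : bool :=
  if n is n'.+1 then (head g0 r == head g0 s) && groweq n' (behead r) (behead s) else true.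
Definition geqmx (m n : nat) (A B : gmat) : bool :=
  all (fun i => groweq n (nth [::] A i) (nth [::] B i)) (iota 0 m).

Variable C : numClosedFieldType.

Definition gval (x : gauss) : C := x.1%:~R + 'i * x.2%:~R.

Lemma gvalD x y : gval (gadd x y) = gval x + gval y.
Proof. rewrite /gval !(rmorphD (intr : int -> C)); ring. Qed.

Lemma gvalN x : gval (gopp x) = - gval x.
Proof. rewrite /gval !(rmorphN (intr : int -> C)); ring. Qed.

Lemma gvalM x y : gval (gmul x y) = gval x * gval y.
Proof.
rewrite /gval !(rmorphD (intr : int -> C)) !(rmorphN (intr : int -> C)).
rewrite !(rmorphM (intr : int -> C)).
transitivity (x.1%:~R * y.1%:~R + 'i * (x.1%:~R * y.2%:~R + x.2%:~R * y.1%:~R)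
   + 'i ^+ 2 * (x.2%:~R * y.2%:~R) : C); last by ring.
by rewrite sqrCi; ring.
Qed.

Lemma gval_conj x : gval (gconj x) = (gval x)^*.
Proof.
rewrite /gval (rmorphN (intr : int -> C)) rmorphD rmorphM /= conjCi.
by rewrite !(CrealP _) ?realz //; ring.
Qed.

Lemma gval0 : gval g0 = 0. Proof. by rewrite /gval /= mulr0 addr0. Qed.
Lemma gval1 : gval g1 = 1. Proof. by rewrite /gval /= mulr0 addr0. Qed.
Lemma gvali : gval gi = 'i. Proof. by rewrite /gval /= mulr1 add0r. Qed.

Definition mx_of m n (A : gmat) : 'M[C]_(m, n) := \matrix_(i, j) gval (gget A i j).

Lemma gget_build m n F i j : (i < m)%N -> (j < n)%N -> gget (gbuild m n F) i j = F i j.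
Proof. by move=> im jn; rewrite /gget nth_mkseq // nth_mkseq. Qed.

Lemma mx_of_build m n F : mx_of m n (gbuild m n F) = \matrix_(i, j) gval (F i j).
Proof. by apply/matrixP => i j; rewrite !mxE gget_build. Qed.

Lemma gval_sum n (F : nat -> gauss) : gval (gsum (mkseq F n)) = \sum_(k < n) gval (F k).
Proof.
rewrite -(big_mkord xpredT (fun k => gval (F k))) /mkseq /index_iota subn0.
by elim: (iota 0 n) => [|k s IH]; rewrite ?big_nil ?gval0 // big_cons /= gvalD IH.
Qed.

Lemma nth_grow2 f n r s j : (j < n)%N ->
  nth g0 (grow2 f n r s) j = f (nth g0 r j) (nth g0 s j).
Proof.
elim: n r s j => [//|n IH] r s [_|j jn]; first by case: r s => [|? ?] [|? ?].
by rewrite /= IH // !nth_behead.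
Qed.

Lemma nth_growmul p n r B j : (j < p)%N -> gval (nth g0 (growmul p n r B) j) =
  \sum_(k < n) gval (nth g0 r k) * gval (gget B k j).
Proof.
move=> jp; elim: n r B => [|n IH] r B; first by rewrite big_ord0 nth_nil gval0.
rewrite big_ord_recl /=.
have -> : \sum_(k < n) gval (nth g0 r (bump 0 k)) * gval (gget B (bump 0 k) j)
    = gval (nth g0 (growmul p n (behead r) (behead B)) j).
  by rewrite IH; apply: eq_bigr => k _; rewrite /gget !nth_behead.
rewrite -!nth0; case: ifP => [|_]; last by rewrite nth_grow2 // gvalD gvalM.
by case: (nth g0 r 0) => [[[|?]|?] [[|?]|?]] // _; rewrite gval0 mul0r add0r.
Qed.

Lemma mx_of_rows m n (F : nat -> seq gauss) :
  mx_of m n (mkseq F m) = \matrix_(i, j) gval (nth g0 (F i) j).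
Proof. by apply/matrixP => i j; rewrite !mxE /gget nth_mkseq. Qed.

Lemma mx_ofM m n p A B : mx_of m p (gmulmx m n p A B) = mx_of m n A *m mx_of n p B.
Proof.
rewrite mx_of_rows; apply/matrixP => i j; rewrite !mxE nth_growmul //.
by apply: eq_bigr => k _; rewrite !mxE.
Qed.

Lemma mx_ofD m n A B : mx_of m n (gaddmx m n A B) = mx_of m n A + mx_of m n B.
Proof. by rewrite mx_of_rows; apply/matrixP => i j; rewrite !mxE nth_grow2 ?gvalD. Qed.

Lemma mx_ofZ m n c A : mx_of m n (gscalemx m n c A) = gval c *: mx_of m n A.
Proof. by rewrite mx_of_rows; apply/matrixP => i j; rewrite !mxE nth_grow2 ?gvalM. Qed.

Lemma mx_ofT m n A : mx_of n m (gtrmx m n A) = (mx_of m n A)^T.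
Proof. by rewrite mx_of_build; apply/matrixP => i j; rewrite !mxE. Qed.

Lemma mx_of_star m n A : mx_of n m (gstarmx m n A) = map_mx Num.conj (mx_of m n A)^T.
Proof. by rewrite mx_of_build; apply/matrixP => i j; rewrite !mxE gval_conj. Qed.

Lemma mx_of_scalar n c : mx_of n n (gscalar n c) = (gval c)%:M.
Proof.
rewrite mx_of_build; apply/matrixP => i j; rewrite !mxE -val_eqE /=.
by rewrite eqnE; case: eqP => _; rewrite ?gval0.
Qed.

Lemma mx_of_nil m n : mx_of m n [::] = 0.
Proof. by apply/matrixP => i j; rewrite !mxE /gget nth_nil nth_nil gval0. Qed.

Lemma mx_of_block m n A B D E : mx_of (m + n) (m + n) (gblock m n A B D E) =
  block_mx (mx_of m m A) (mx_of m n B) (mx_of n m D) (mx_of n n E).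
Proof.
rewrite mx_of_build; apply/matrixP => i j; rewrite /block_mx [LHS]mxE.
rewrite [RHS]mxE; case: (splitP i) => i' ei; rewrite [RHS]mxE.
  case: (splitP j) => j' ej; rewrite [RHS]mxE ei ej ?ltn_ord //.
  by rewrite addKn.
case: (splitP j) => j' ej; rewrite [RHS]mxE ei ej ?ltn_ord ?addKn //.
Qed.

Lemma gammaE l k : gamma C l k = mx_of (spindim l) (spindim l) (ggamma l k).
Proof.
elim: l k => [|l IH] [|[|k]] /=; rewrite ?mx_of_scalar ?gval1 //.
- by rewrite mx_of_block !mx_of_nil !mx_of_scalar gval1.
- by rewrite mx_of_block !mx_of_nil !mx_of_scalar gvalN gvali.
- by rewrite mx_of_block !mx_of_nil mx_ofZ gvalN gval1 scaleN1r IH.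
Qed.

Lemma groweqP n r s j : groweq n r s -> (j < n)%N -> nth g0 r j = nth g0 s j.
Proof.
elim: n r s j => [//|n IH] r s [|j] /andP[/eqP e rs] jn.
  by case: r s e {rs} => [|? ?] [|? ?].
by rewrite -!nth_behead; apply: IH.
Qed.

Lemma geqmxP m n A B : geqmx m n A B -> mx_of m n A = mx_of m n B.
Proof.
move=> /allP h; apply/matrixP => i j; rewrite !mxE.
have hi : nat_of_ord i \in iota 0 m by rewrite mem_iota ltn_ord.
by rewrite /gget (groweqP (h _ hi)).
Qed.

End GaussianMatrices.

Lemma spindim_gt0 l : (0 < spindim l)%N.
Proof. by elim: l => //= l IH; rewrite addn_gt0 IH. Qed.

(** * Skew matrices in the Clifford algebra and the differential of an embedding *)

Section SoElements.

Variables (C : numClosedFieldType) (l : nat).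
Hypothesis l_gt0 : (0 < l)%N.
Notation mat := 'M[C]_(spindim l).
Notation vec := 'cV[C]_(l.*2.+1).

Definition so_of (M : 'M[C]_(l.*2.+1)) : mat :=
  \sum_a \sum_b M a b *: (gamma C l a *m gamma C l b).

Lemma so_ofD M N : so_of (M + N) = so_of M + so_of N.
Proof.
rewrite /so_of -big_split; apply: eq_bigr => a _; rewrite -big_split.
by apply: eq_bigr => b _; rewrite mxE scalerDl.
Qed.

Lemma so_ofZ c M : so_of (c *: M) = c *: so_of M.
Proof.
rewrite /so_of scaler_sumr; apply: eq_bigr => a _; rewrite scaler_sumr.
by apply: eq_bigr => b _; rewrite mxE scalerA.
Qed.

(** Termwise, [gamma_a gamma_b, v] = 2 v_b gamma_a - 2 v_a gamma_b. So a quarter of [so_of M] is the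
    Clifford element that acts on vectors as the skew matrix [M]. *)
Lemma so_of_bracket M (v : vec) : M^T = - M ->
  so_of M *m cliff v - cliff v *m so_of M = 4 *: cliff (M *m v).
Proof.
move=> aM.
have Mv (N : 'M[C]_(l.*2.+1)) :
    \sum_a \sum_b (N a b * v b 0) *: basis_vec C a = N *m v.
  apply/matrixP => i j; rewrite (ord1 j) summxE (bigD1 i) //= [X in _ + X]big1 ?addr0.
    rewrite summxE mxE; apply: eq_bigr => b _.
    by rewrite !mxE !eqxx mulr1.
  move=> a ai; rewrite summxE big1 // => b _.
  by rewrite !mxE eq_sym (negPf ai) mulr0.
rewrite /so_of mulmx_suml mulmx_sumr -sumrB.
transitivity (\sum_a \sum_b cliff ((M a b * v b 0) *: basis_vec C a *+ 2
    - (M a b * v a 0) *: basis_vec C b *+ 2)).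
  apply: eq_bigr => a _; rewrite mulmx_suml mulmx_sumr -sumrB; apply: eq_bigr => b _.
  rewrite -scalemxAl -scalemxAr -scalerBr -!cliff_basis cliff_bracket -cliffZ.
  rewrite !dot_basis scalerBr !scalerA !mulrnAr -!scaler_nat !scalerA.
  by rewrite !mulr_natl.
rewrite -cliffZ; transitivity (cliff ((M *m v) *+ 2 - (M^T *m v) *+ 2)); last first.
  by rewrite aM mulNmx mulNrn opprK -mulrnDr scaler_nat.
under eq_bigr => a _ do rewrite -cliff_sum.
rewrite -cliff_sum; congr cliff.
under eq_bigr => a _ do rewrite sumrB !sumrMnl.
rewrite sumrB !sumrMnl Mv; congr (_ - _ *+ 2); rewrite exchange_big -(Mv M^T).
by apply: eq_bigr => a _; apply: eq_bigr => b _; rewrite mxE.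
Qed.

Lemma antisym_diag (M : 'M[C]_(l.*2.+1)) i : M^T = - M -> M i i = 0.
Proof.
move=> /matrixP/(_ i i); rewrite !mxE => /eqP; rewrite -addr_eq0 -mulr2n.
by rewrite mulrn_eq0 => /eqP.
Qed.

Lemma so_of_lie M : M^T = - M -> so_lie (so_of M).
Proof.
move=> aM; apply: so_lie_sum => // a _; apply: so_lie_sum => // b _.
have [<-|ab] := eqVneq a b; last exact/SoScale/so_lie_gamma.
by rewrite antisym_diag // scale0r; apply: so_lie0.
Qed.

Lemma so_lie_trace (X : mat) : so_lie X -> \tr X = 0.
Proof.
apply: (so_lie_gamma_ind l_gt0 (K := fun X => \tr X = 0)) => [a b ab|{}X Y tX tY|c {}X tX].
- have : \tr (gamma C l a *m gamma C l b) = - \tr (gamma C l a *m gamma C l b).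
    rewrite {1}mxtrace_mulC -raddfN /=; congr (\tr _).
    have := @cliff_anticomm _ _ (basis_vec C b) (basis_vec C a).
    by rewrite !cliff_basis dot_basis2 eq_sym (negPf ab); apply.
  by move/eqP; rewrite -addr_eq0 -mulr2n mulrn_eq0 => /eqP.
- by rewrite mxtraceD tX tY addr0.
- by rewrite mxtraceZ tX mulr0.
Qed.

(** The commutator with [D] kills the scalar v v, so v and M v anticommute, that is, dot v (M v) =
    0. Polarization gives skewness. *)
Lemma bracket_antisym (D : mat) (M : 'M[C]_(l.*2.+1)) :
  (forall v : vec, D *m cliff v - cliff v *m D = cliff (M *m v)) -> M^T = - M.
Proof.
move=> hD.
have vMv v : dot v (M *m v) = 0.
  have := cliff_clifford v (M *m v); rewrite -hD mulmxBr mulmxBl !mulmxA.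
  rewrite cliff_sqr -(mulmxA D) cliff_sqr mul_mx_scalar mul_scalar_mx.
  rewrite addrC addrA subrK subrr => /matrixP/(_ (Ordinal (spindim_gt0 l)) (Ordinal (spindim_gt0 l))).
  by rewrite !mxE eqxx mulr1n => /esym/eqP; rewrite mulrn_eq0 => /eqP.
apply/matrixP => i j; rewrite !mxE; apply/eqP; rewrite -addr_eq0.
have := vMv (basis_vec C i + basis_vec C j).
rewrite mulmxDr !dotE !vMv addr0 add0r !dot_basis /basis_vec -!colE !mxE => e.
by rewrite addrC e.
Qed.

End SoElements.

(** Commuting with the first two gammas forces the block form diag (P, P). The other gammas are diag
    (gamma, - gamma), so [P] commutes with the gammas of the smaller algebra. *)
Lemma clifford_commutant (C : numClosedFieldType) l (X : 'M[C]_(spindim l)) :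
  (forall k, (k <= l.*2)%N -> gamma C l k *m X = X *m gamma C l k) ->
  exists c, X = c%:M.
Proof.
elim: l X => [|l IH] X comm; first by exists (X 0 0); apply: mx11_scalar.
have X0 := comm 0 isT; have X1 := comm 1 isT.
have X2 k : (k <= l.*2)%N -> gamma C l.+1 k.+2 *m X = X *m gamma C l.+1 k.+2.
  by move=> kl; apply: comm; rewrite doubleS !ltnS.
move: X0 X1 X2 {comm}; rewrite -[X](@submxK C (spindim l) (spindim l) (spindim l)).
set P := ulsubmx _; set Q := ursubmx _; set R := dlsubmx _; set S := drsubmx _.
rewrite /= !mulmx_block !mul0mx !mulmx0 !mul1mx !mulmx1 !addr0 !add0r.
case/eq_block_mx => RQ SP _ _; rewrite SP RQ.
rewrite !mul_scalar_mx !mul_mx_scalar => /eq_block_mx[/eqP QQ _ _ _] X2.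
have {}QQ : Q = 0.
  move: QQ; rewrite scaleNr eq_sym -addr_eq0 -scalerDl scaler_eq0 -mulr2n.
  by rewrite mulrn_eq0 /= (negPf (neq0Ci C)) => /eqP.
have [|c ->] := IH P.
  move=> k kl; have := X2 k kl; rewrite mulmx_block !mul0mx mulmx_block !mulmx0 !addr0.
  by case/eq_block_mx.
by exists c; rewrite QQ -scalar_mx_block.
Qed.

Section EmbeddingDifferential.

Variables (C : numClosedFieldType) (m l : nat).
Hypotheses (m_gt0 : (0 < m)%N) (l_gt0 : (0 < l)%N).
Variable phi : 'M[C]_(spindim m) -> 'M[C]_(spindim l).
Variable dphi : {linear 'M[C]_(spindim m) -> 'M[C]_(spindim l)}.
Hypotheses (phi_morph : alg_morphism (@spin C m) phi)
  (phi_diff : is_diff (@spin C m) phi dphi)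
  (phi_spin : forall h, spin h -> spin (phi h)).

(** gamma_a gamma_b is half the bracket of gamma_a gamma_c and gamma_c gamma_b, so its image under
    [dphi] is a commutator. *)
Lemma diff_trace X : so_lie X -> \tr (dphi X) = 0.
Proof.
apply: (so_lie_gamma_ind m_gt0 (K := fun X => \tr (dphi X) = 0)) => [a b ab|{}X Y tX tY|c {}X tX]; last 2 first.
- by rewrite linearD mxtraceD tX tY addr0.
- by rewrite linearZZ mxtraceZ tX mulr0.
have [c /andP[ca cb]] := exists_third m_gt0 a b.
pose g (i : 'I_m.*2.+1) : 'M[C]_(spindim m) := gamma C m i.
have gg i : g i *m g i = 1%:M.
  by rewrite /g -cliff_basis cliff_sqr dot_basis2 eqxx.
have anti i j : i != j -> g i *m g j = - (g j *m g i).
  by move=> ij; rewrite /g -!cliff_basis cliff_anticomm // dot_basis2 (negPf ij).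
have sac : so_lie (g a *m g c) by apply: so_lie_gamma => //; rewrite eq_sym.
have scb : so_lie (g c *m g b) by apply: so_lie_gamma.
have := diff_bracket phi_morph phi_diff sac scb.
have -> : g a *m g c *m (g c *m g b) - g c *m g b *m (g a *m g c) = (g a *m g b) *+ 2.
  have -> : g a *m g c *m (g c *m g b) = g a *m g b.
    by rewrite -mulmxA (mulmxA (g c)) gg mul1mx.
  have -> : g c *m g b *m (g a *m g c) = g b *m g a.
    rewrite (anti c b) // mulNmx mulmxA -(mulmxA (g b)) (anti c a) // mulmxN mulNmx.
    by rewrite opprK mulmxA -(mulmxA _ (g c)) gg mulmx1.
  by rewrite (anti b a) 1?eq_sym // opprK mulr2n.
move/(congr1 mxtrace); rewrite raddfB /= mxtrace_mulC subrr raddfMn /= raddfMn => /eqP.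
by rewrite mulrn_eq0 => /eqP.
Qed.

(** The two sides have the same commutator with every vector, so they differ by a scalar; both are
    traceless, so the scalar is zero. *)
Lemma diff_embedding X M : lie_unipotent X ->
  (forall t, so_image (phi (1%:M + t *: X)) (1%:M + t *: M)) ->
  dphi X = 4^-1 *: so_of M.
Proof.
move=> uX hM; have [sX _ hX] := uX.
have comm v : dphi X *m cliff v - cliff v *m dphi X = cliff (M *m v).
  have c1 := mcurve_mulr (cliff v) (rep_curve phi_morph phi_diff uX).
  have := mcurve_mul (mcurve_affine 1 0 (cliff v) (cliff (M *m v)))
    (rep_curve phi_morph phi_diff uX).
  rewrite scale0r addr0 !mulmx1 => c2.
  suff c3 : mcurve 1 0 (fun t => phi (1%:M + t *: X) *m cliff v) (1%:M *m cliff v)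
      (cliff (M *m v) + cliff v *m dphi X).
    by rewrite (mcurve_uniq (one_horner_neq0 (0 : C)) c1 c3) addrK.
  rewrite mul1mx; apply: mcurve_ext c2 => t _.
  have sg := phi_spin (hX t); have := hM t v.
  rewrite mulmxDl mul1mx -scalemxAl cliffD cliffZ => <-.
  by rewrite mulmxKV // spin_unitmx.
have aM := bracket_antisym comm.
have [c ec] : exists c, dphi X - 4^-1 *: so_of M = c%:M.
  apply: clifford_commutant => k kl; apply/eqP; rewrite eq_sym -subr_eq0.
  rewrite mulmxBl mulmxBr opprD addrACA opprK -scalemxAl -scalemxAr.
  rewrite -(cliff_inord C kl) comm [_ + 4^-1 *: _]addrC -scalerBr.
  by rewrite -opprB so_of_bracket // scalerN scalerA mulVf ?pnatr_eq0 // scale1r subrr.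
have := congr1 mxtrace ec; rewrite raddfB /= mxtraceZ diff_trace //.
rewrite (so_lie_trace l_gt0 (so_of_lie l_gt0 aM)) mulr0 subr0.
rewrite mxtrace_scalar => /esym/eqP; rewrite mulrn_eq0 (gtn_eqF (spindim_gt0 l)) /=.
by move/eqP => c0; move/eqP: ec; rewrite c0 raddf0 subr_eq0 => /eqP.
Qed.

End EmbeddingDifferential.

(** * Root vectors as matrices of Gaussian integers *)

Section GaussianSpin.

Variable l : nat.
Notation N := (spindim l).

Definition gaddN : gmat -> gmat -> gmat := gaddmx N N.
Definition gscaleN : gauss -> gmat -> gmat := gscalemx N N.
Definition giso_plus (j : nat) : gmat :=
  gaddN (ggamma l j.*2) (gscaleN gi (ggamma l j.*2.+1)).
Definition giso_minus (j : nat) : gmat :=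
  gaddN (ggamma l j.*2) (gscaleN (gopp gi) (ggamma l j.*2.+1)).
Definition gmulN : gmat -> gmat -> gmat := gmulmx N N N.
Definition gtorus (j : nat) : gmat :=
  gscaleN (gopp gi) (gmulN (ggamma l j.*2) (ggamma l j.*2.+1)).
Definition gsummx (s : seq gmat) : gmat := foldr (gaddmx N N) [::] s.
Definition gbracket (A B : gmat) : gmat :=
  gaddN (gmulN A B) (gscaleN (gopp g1) (gmulN B A)).

Definition ordered_pairs : seq (nat * nat) :=
  [seq (j, k) | j <- iota 0 l, k <- iota j.+1 (l - j.+1)].

Definition gpos_roots : seq gmat :=
  [seq gmulN (giso_plus p.1) (giso_minus p.2) | p <- ordered_pairs] ++
  [seq gmulN (giso_plus p.1) (giso_plus p.2) | p <- ordered_pairs] ++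
  [seq gmulN (giso_plus j) (ggamma l l.*2) | j <- iota 0 l].
Definition gneg_roots : seq gmat :=
  [seq gmulN (giso_minus p.1) (giso_plus p.2) | p <- ordered_pairs] ++
  [seq gmulN (giso_minus p.1) (giso_minus p.2) | p <- ordered_pairs] ++
  [seq gmulN (giso_minus j) (ggamma l l.*2) | j <- iota 0 l].
Definition gtori : seq gmat := [seq gtorus j | j <- iota 0 l].

Definition gso_of (M : gmat) : gmat :=
  let gammas := mkseq (ggamma l) l.*2.+1 in
  gsummx (mkseq (fun a => gmulmx N N N (nth [::] gammas a)
    (gsummx (mkseq (fun b => if gget M a b == g0 then [::]
      else gscalemx N N (gget M a b) (nth [::] gammas b)) l.*2.+1))) l.*2.+1).

Variable C : numClosedFieldType.
Notation mxN := (mx_of C N N).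

Lemma mx_of_mulN A B : mxN (gmulN A B) = mxN A *m mxN B.
Proof. exact: mx_ofM. Qed.

Lemma mx_of_addN A B : mxN (gaddN A B) = mxN A + mxN B.
Proof. exact: mx_ofD. Qed.

Lemma mx_of_scaleN c A : mxN (gscaleN c A) = gval C c *: mxN A.
Proof. exact: mx_ofZ. Qed.

Lemma mx_of_iso_plus j : mxN (giso_plus j) = iso_plus C l j.
Proof. by rewrite mx_ofD mx_ofZ gvali -!gammaE. Qed.

Lemma mx_of_iso_minus j : mxN (giso_minus j) = iso_minus C l j.
Proof. by rewrite mx_ofD mx_ofZ gvalN gvali scaleNr -!gammaE. Qed.

Lemma mx_of_torus j : mxN (gtorus j) = torus_lie C l j.
Proof. by rewrite mx_ofZ gvalN gvali mx_of_mulN -!gammaE. Qed.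

Lemma mx_of_bracket A B : mxN (gbracket A B) = mxN A *m mxN B - mxN B *m mxN A.
Proof. by rewrite mx_ofD mx_ofZ gvalN gval1 scaleN1r !mx_of_mulN. Qed.

Lemma mx_of_sum s : mxN (gsummx s) = \sum_(A <- s) mxN A.
Proof. by elim: s => [|A s IH]; rewrite ?big_nil ?mx_of_nil // big_cons /= mx_ofD IH. Qed.

Lemma mx_of_sum_mkseq F n : mxN (gsummx (mkseq F n)) = \sum_(i < n) mxN (F i).
Proof.
by rewrite mx_of_sum /mkseq big_map -(big_mkord xpredT (fun i => mxN (F i))) /index_iota subn0.
Qed.

Lemma mx_of_so_of M : mxN (gso_of M) = so_of (mx_of C l.*2.+1 l.*2.+1 M).
Proof.
rewrite mx_of_sum_mkseq; apply: eq_bigr => a _.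
rewrite mx_ofM mx_of_sum_mkseq mulmx_sumr nth_mkseq // -gammaE; apply: eq_bigr => b _.
rewrite mxE; case: eqP => [->|_]; first by rewrite gval0 scale0r mx_of_nil mulmx0.
by rewrite mx_ofZ nth_mkseq // -gammaE scalemxAr.
Qed.

Lemma mem_ordered_pairs j k : ((j, k) \in ordered_pairs) = (j < k < l)%N.
Proof.
apply/allpairsPdep/idP => [[j' [k' []]]|/andP[jk kl]].
  rewrite !mem_iota => /andP[_ jl] /andP[jk kl] [-> ->].
  by rewrite jk; move: kl; rewrite subnKC.
exists j, k; rewrite !mem_iota add0n (ltn_trans jk kl) jk /= subnKC //.
exact: ltn_trans jk kl.
Qed.

Lemma pos_root_list X : pos_root X -> exists2 A, A \in gpos_roots & X = mxN A.
Proof.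
case=> [j k h|j k h|j h].
- exists (gmulN (giso_plus j) (giso_minus k)).
    by rewrite mem_cat; apply/orP; left; apply/mapP; exists (j, k); rewrite ?mem_ordered_pairs.
  by rewrite mx_of_mulN mx_of_iso_plus mx_of_iso_minus.
- exists (gmulN (giso_plus j) (giso_plus k)).
    rewrite !mem_cat; apply/orP; right; apply/orP; left.
    by apply/mapP; exists (j, k); rewrite ?mem_ordered_pairs.
  by rewrite mx_of_mulN !mx_of_iso_plus.
- exists (gmulN (giso_plus j) (ggamma l l.*2)).
    rewrite !mem_cat; apply/orP; right; apply/orP; right.
    by apply/mapP; exists j; rewrite ?mem_iota.
  by rewrite mx_of_mulN mx_of_iso_plus -gammaE.
Qed.

Lemma gpos_rootsP A : A \in gpos_roots -> pos_root (mxN A).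
Proof.
rewrite !mem_cat => /or3P[] /mapP[].
- move=> [j k]; rewrite mem_ordered_pairs => h ->.
  by rewrite mx_of_mulN mx_of_iso_plus mx_of_iso_minus; apply: PosSub.
- move=> [j k]; rewrite mem_ordered_pairs => h ->.
  by rewrite mx_of_mulN !mx_of_iso_plus; apply: PosAdd.
- move=> j; rewrite mem_iota => /andP[_ h] ->.
  by rewrite mx_of_mulN mx_of_iso_plus -gammaE; apply: PosShort.
Qed.

Lemma gneg_rootsP A : A \in gneg_roots -> neg_root (mxN A).
Proof.
rewrite !mem_cat => /or3P[] /mapP[].
- move=> [j k]; rewrite mem_ordered_pairs => h ->.
  by rewrite mx_of_mulN mx_of_iso_plus mx_of_iso_minus; apply: NegSub.
- move=> [j k]; rewrite mem_ordered_pairs => h ->.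
  by rewrite mx_of_mulN !mx_of_iso_minus; apply: NegAdd.
- move=> j; rewrite mem_iota => /andP[_ h] ->.
  by rewrite mx_of_mulN mx_of_iso_minus -gammaE; apply: NegShort.
Qed.

End GaussianSpin.
(* The change of basis is chosen so that Qmx^T Qmx is the Spin_7-invariant form
   and Qmx^* Qmx is block scalar; the rows are ordered so that the negative Borel
   subalgebra of so_9 and the image of gparabolic span so_9. *)
Definition gQ : gmat := ([::
  [:: (0, 0); (0, 0); (0, 0); (0, 0); (0, 0); (0, 0); (0, 0); (0, 0); (1, 0)];
  [:: (0, 0); (0, 0); (1, 0); (0, 0); (0, 0); (1, 0); (0, 0); (0, 0); (0, 0)];
  [:: (0, 0); (0, 0); (0, 1); (0, 0); (0, 0); (0, -1); (0, 0); (0, 0); (0, 0)];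
  [:: (0, 0); (1, 0); (0, 0); (0, 0); (0, 0); (0, 0); (-1, 0); (0, 0); (0, 0)];
  [:: (0, 0); (0, 0); (0, 0); (1, 0); (-1, 0); (0, 0); (0, 0); (0, 0); (0, 0)];
  [:: (0, 0); (0, 1); (0, 0); (0, 0); (0, 0); (0, 0); (0, 1); (0, 0); (0, 0)];
  [:: (1, 0); (0, 0); (0, 0); (0, 0); (0, 0); (0, 0); (0, 0); (1, 0); (0, 0)];
  [:: (0, 1); (0, 0); (0, 0); (0, 0); (0, 0); (0, 0); (0, 0); (0, -1); (0, 0)];
  [:: (0, 0); (0, 0); (0, 0); (0, 1); (0, 1); (0, 0); (0, 0); (0, 0); (0, 0)]])%Z.

(* Row (a, b, i) stands for (a + b i) times entry i of gspan. *)
Definition decomposition_table : seq (seq (int * int * nat)) := ([::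
  [:: (0, 16, 3%N); (16, 0, 6%N); (0, -16, 9%N); (2, 0, 22%N); (4, 0, 30%N); (-4, 0, 31%N); (2, 0, 32%N)];
  [:: (16, 0, 3%N); (-32, 0, 4%N); (16, 0, 7%N); (16, 0, 9%N); (0, 32, 17%N); (0, -32, 18%N); (0, 2, 20%N); (0, 2, 21%N); (0, -2, 22%N); (0, 2, 23%N); (0, -2, 24%N); (0, 4, 27%N); (0, -4, 28%N); (0, 2, 32%N)];
  [:: (32, 0, 3%N); (16, 0, 8%N); (32, 0, 9%N); (32, 0, 10%N); (0, 32, 11%N); (0, 64, 13%N); (32, 0, 15%N); (0, 4, 20%N); (0, 4, 21%N); (0, -4, 33%N); (0, 8, 34%N); (0, 8, 35%N)];
  [:: (16, 0, 3%N); (-32, 0, 4%N); (0, -32, 5%N); (0, 32, 17%N); (0, -32, 18%N); (0, 2, 21%N); (0, -2, 22%N); (0, 4, 23%N); (0, -2, 24%N); (0, 2, 25%N); (0, -4, 26%N); (0, 4, 27%N)];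
  [:: (32, 0, 3%N); (32, 0, 9%N); (16, 0, 10%N); (0, 32, 11%N); (0, 64, 13%N); (-64, 0, 14%N); (32, 0, 15%N); (0, -64, 18%N); (0, 64, 19%N); (0, 4, 20%N); (0, 8, 21%N); (0, -8, 30%N); (0, -8, 31%N); (0, -4, 33%N); (0, 8, 35%N)];
  [:: (-16, 0, 11%N); (0, 32, 15%N); (4, 0, 33%N)];
  [:: (16, 0, 0%N); (0, -16, 3%N); (0, 16, 9%N); (64, 0, 19%N); (-2, 0, 22%N); (-8, 0, 29%N); (-4, 0, 30%N); (-4, 0, 31%N); (-2, 0, 32%N)];
  [:: (16, 0, 1%N); (16, 0, 3%N); (-32, 0, 4%N); (16, 0, 9%N); (0, -32, 17%N); (0, -32, 18%N); (0, 2, 20%N); (0, 2, 21%N); (0, 2, 22%N); (0, 2, 23%N); (0, -2, 24%N); (0, 4, 27%N); (0, -4, 28%N); (0, -2, 32%N)];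
  [:: (16, 0, 2%N); (-16, 0, 3%N); (32, 0, 4%N); (0, 32, 5%N); (16, 0, 9%N); (0, -32, 17%N); (0, -32, 19%N); (0, 2, 22%N); (0, -4, 23%N); (0, 4, 24%N); (0, -2, 25%N); (0, 4, 26%N); (0, 4, 29%N); (0, 4, 30%N)];
  [:: (32, 0, 3%N); (-32, 0, 4%N); (0, -32, 5%N); (-16, 0, 9%N); (0, 32, 17%N); (0, -32, 18%N); (0, 64, 19%N); (0, 2, 21%N); (0, -2, 22%N); (0, 4, 23%N); (0, -2, 24%N); (0, 2, 25%N); (0, -4, 26%N); (0, 4, 27%N); (0, -8, 29%N); (0, -8, 30%N)];
  [:: (-16, 0, 3%N); (16, 0, 4%N); (0, 32, 5%N); (16, 0, 9%N); (0, -32, 17%N); (0, -32, 19%N); (0, 2, 22%N); (0, -4, 23%N); (0, -2, 25%N); (0, 4, 26%N); (0, 4, 29%N); (0, 4, 30%N)];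
  [:: (0, -16, 3%N); (-16, 0, 5%N); (0, 16, 9%N); (32, 0, 17%N); (32, 0, 19%N); (-2, 0, 22%N); (2, 0, 25%N); (-4, 0, 26%N); (-4, 0, 29%N); (-4, 0, 30%N)];
  [:: (0, -32, 4%N); (16, 0, 12%N); (32, 0, 13%N); (0, 32, 14%N); (32, 0, 19%N); (2, 0, 20%N); (2, 0, 21%N); (-2, 0, 23%N); (2, 0, 24%N); (-4, 0, 27%N); (4, 0, 28%N); (-4, 0, 30%N); (-4, 0, 31%N)];
  [:: (0, 16, 3%N); (0, -32, 4%N); (32, 0, 5%N); (0, -16, 9%N); (16, 0, 13%N); (0, 32, 14%N); (-32, 0, 17%N); (2, 0, 21%N); (2, 0, 22%N); (-4, 0, 23%N); (2, 0, 24%N); (-2, 0, 25%N); (4, 0, 26%N); (-4, 0, 27%N); (4, 0, 29%N); (-4, 0, 31%N)];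
  [:: (-16, 0, 14%N); (0, 32, 19%N); (0, -4, 30%N); (0, -4, 31%N)];
  [:: (8, 0, 3%N); (-8, 0, 9%N); (0, 16, 17%N); (0, 16, 19%N); (0, -1, 22%N); (0, -1, 25%N); (0, -2, 26%N); (0, -2, 29%N); (0, -2, 30%N)]])%Z.
(** Negative root vectors of so_5, the semisimple part of the Levi factor of the stabilizer of a
    line of weight k epsilon_1. With 9 positive roots and 3 torus elements of so_7 this makes 16
    elements, to be added to the 20 of the negative Borel subalgebra of so_9. *)
Definition glevi : seq gmat :=
  [:: gmulN 3 (giso_minus 3 1) (giso_plus 3 2); gmulN 3 (giso_minus 3 1) (giso_minus 3 2);
      gmulN 3 (giso_minus 3 1) (ggamma 3 6); gmulN 3 (giso_minus 3 2) (ggamma 3 6)].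

Definition gparabolic : seq gmat := gpos_roots 3 ++ gtori 3 ++ glevi.

(** Eight times the Lie algebra embedding, so that all entries stay Gaussian integers. *)
Definition gembed (A : gmat) : gmat :=
  gso_of 4 (gmulmx 9 9 9 (gmulmx 9 9 9 gQ (gblock 8 1 A [::] [::] [::])) (gstarmx 9 9 gQ)).

Definition gspan : seq gmat :=
  gneg_roots 4 ++ gtori 4 ++ [seq gembed A | A <- gparabolic].

Definition gcombination (s : seq gmat) (r : seq (int * int * nat)) : gmat :=
  gsummx 4 [seq gscaleN 4 x.1 (nth [::] s x.2) | x <- r].

(** A certificate for spanning: the negative root vectors and the torus of so_9 already belong to
    [gspan], so only positive roots need a row. The factor 16 clears the denominators. *)
Lemma decomposition_table_correct :
  let s := gspan in
  all2 (fun A r => geqmx (spindim 4) (spindim 4) (gscaleN 4 (Posz 16, Posz 0) A)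
                     (gcombination s r))
    (gpos_roots 4) decomposition_table.
Proof. by vm_compute. Qed.

(* (E, F, a, b, c) with [E, F] = a h_1 + b h_2 and [[E, F], F] = c F *)
Definition levi_table : seq (gmat * gmat * int * int * int) :=
  [:: (gmulN 3 (giso_plus 3 1) (giso_minus 3 2),
       gmulN 3 (giso_minus 3 1) (giso_plus 3 2), Negz 7, Posz 8, Posz 32);
      (gmulN 3 (giso_plus 3 1) (giso_plus 3 2),
       gmulN 3 (giso_minus 3 1) (giso_minus 3 2), Negz 7, Negz 7, Posz 32);
      (gmulN 3 (giso_plus 3 1) (ggamma 3 6),
       gmulN 3 (giso_minus 3 1) (ggamma 3 6), Negz 3, Posz 0, Posz 8);
      (gmulN 3 (giso_plus 3 2) (ggamma 3 6),
       gmulN 3 (giso_minus 3 2) (ggamma 3 6), Posz 0, Negz 3, Posz 8)].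

Definition levi_row_ok (x : gmat * gmat * int * int * int) : bool :=
  let: (E, F, a, b, c) := x in
  [&& E \in gpos_roots 3, F \in gneg_roots 3, c != Posz 0,
      geqmx (spindim 3) (spindim 3) (gbracket 3 E F)
        (gaddN 3 (gscaleN 3 (a, Posz 0) (gtorus 3 1)) (gscaleN 3 (b, Posz 0) (gtorus 3 2)))
    & geqmx (spindim 3) (spindim 3) (gbracket 3 (gbracket 3 E F) F)
        (gscaleN 3 (c, Posz 0) F)].

Lemma levi_table_correct :
  (glevi == [seq x.1.1.1.2 | x <- levi_table]) && all levi_row_ok levi_table.
Proof. by vm_compute. Qed.

Lemma gQ_star : geqmx 9 9 (gmulmx 9 9 9 (gstarmx 9 9 gQ) gQ)
  (gblock 8 1 (gscalar 8 (Posz 2, Posz 0)) [::] [::] (gscalar 1 g1)).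
Proof. by vm_compute. Qed.

(** * The explicit embedding of so_7 in so_9 *)

Section SpinEmbeddingSetup.

Variable C : numClosedFieldType.

Definition Qmx : 'M[C]_(4.*2.+1) := mx_of C (4.*2.+1) (4.*2.+1) gQ.
Definition Qstar : 'M[C]_(4.*2.+1) := map_mx Num.conj Qmx^T.
(** The last basis vector is fixed by the group, so group elements take [c] = 1 and their velocities
    take [c] = 0. *)
Definition extend_mx (c : C) (X : 'M[C]_(spindim 3)) : 'M[C]_(4.*2.+1) :=
  (block_mx X 0 0 c%:M : 'M[C]_(spindim 3 + 1)).

(* The differential of an embedding Spin_7 -> Spin_9 whose image in SO_9 is
   conjugate through Qmx to h |-> h (+) 1. *)
Definition embed_lie (X : 'M[C]_(spindim 3)) : 'M[C]_(spindim 4) :=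
  8^-1 *: so_of (Qmx *m extend_mx 0 X *m Qstar).

Lemma extend_mxD c d X Y : extend_mx (c + d) (X + Y) = extend_mx c X + extend_mx d Y.
Proof.
by rewrite /extend_mx raddfD /= (@add_block_mx _ (spindim 3) 1 (spindim 3) 1) !addr0.
Qed.

Lemma extend_mxZ c d X : extend_mx (c * d) (c *: X) = c *: extend_mx d X.
Proof.
by rewrite /extend_mx (@scale_block_mx _ (spindim 3) 1 (spindim 3) 1) !scaler0 scale_scalar_mx.
Qed.

Lemma extend_mxM c d X Y : extend_mx (c * d) (X *m Y) = extend_mx c X *m extend_mx d Y.
Proof.
rewrite /extend_mx (@mulmx_block _ (spindim 3) 1 (spindim 3) 1 (spindim 3) 1).
by rewrite !mul0mx !mulmx0 !addr0 add0r scalar_mxM.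
Qed.

Lemma extend_mx1 : extend_mx 1 1%:M = 1%:M.
Proof. exact/esym/(@scalar_mx_block _ (spindim 3) 1). Qed.

Lemma embed_lieD X Y : embed_lie (X + Y) = embed_lie X + embed_lie Y.
Proof.
have := extend_mxD 0 0 X Y; rewrite addr0 /embed_lie => ->.
by rewrite mulmxDr mulmxDl so_ofD scalerDr.
Qed.

Lemma embed_lieZ c X : embed_lie (c *: X) = c *: embed_lie X.
Proof.
have := extend_mxZ c 0 X; rewrite mulr0 /embed_lie => ->; rewrite -scalemxAr -scalemxAl so_ofZ.
by rewrite !scalerA mulrC.
Qed.

Lemma Qstar_mul : Qstar *m Qmx = extend_mx 1 (2%:M).
Proof.
have := geqmxP C gQ_star; rewrite [LHS]mx_ofM [in LHS]mx_of_star => e0.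
have := @mx_of_block C 8 1 (gscalar 8 (Posz 2, Posz 0)) [::] [::] (gscalar 1 g1).
rewrite !mx_of_nil !mx_of_scalar gval1.
have -> : gval C (Posz 2, Posz 0) = 2 by rewrite /gval /= mulr0 addr0.
by move=> e1; rewrite -[RHS]e1 -e0.
Qed.

Lemma Qmx_unit : Qmx \in unitmx.
Proof.
have : extend_mx 1 (2^-1)%:M *m Qstar *m Qmx = 1%:M.
  rewrite -mulmxA Qstar_mul -extend_mxM mulr1 -scalar_mxM mulVf ?pnatr_eq0 //.
  exact: extend_mx1.
by case/mulmx1_unit.
Qed.

Lemma invmx_Qmx : invmx Qmx = extend_mx 1 (2^-1)%:M *m Qstar.
Proof.
apply: (can_inj (mulmxK Qmx_unit)); rewrite mulVmx ?Qmx_unit //.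
rewrite -mulmxA Qstar_mul -extend_mxM mulr1 -scalar_mxM mulVf ?pnatr_eq0 //.
exact/esym/extend_mx1.
Qed.

Lemma mx_of_embed A : mx_of C (spindim 4) (spindim 4) (gembed A) =
  8 *: embed_lie (mx_of C (spindim 3) (spindim 3) A).
Proof.
rewrite /embed_lie scalerA mulfV ?pnatr_eq0 // scale1r mx_of_so_of; congr so_of.
rewrite mx_ofM mx_ofM mx_of_star.
have := @mx_of_block C 8 1 A [::] [::] [::]; rewrite !mx_of_nil => e.
by rewrite /extend_mx raddf0; congr (_ *m _ *m _).
Qed.

End SpinEmbeddingSetup.

Lemma all2_mem (S : eqType) (T : Type) (r : S -> T -> bool) s t x :
  all2 r s t -> x \in s -> exists y, r x y.
Proof.
elim: s t => [|a s IH] [|b t] //= /andP[rab rst].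
by rewrite inE => /orP[/eqP->|]; [exists b|exact: IH rst].
Qed.

Section Sl2.

Variables (C : numClosedFieldType) (n : nat).

Lemma nilpotent_least (F : 'M[C]_n) m (w : 'M[C]_(n, m)) (N : nat) : F ^+ N = 0 -> w != 0 ->
  exists k, F ^+ k *m w != 0 /\ F ^+ k.+1 *m w = 0.
Proof.
move=> FN w0.
have exk : exists k, F ^+ k *m w == 0 by exists N; rewrite FN mul0mx.
case: (ex_minnP exk) => -[|k] /eqP k0 kmin.
  by rewrite expr0 mul1mx in k0; rewrite k0 eqxx in w0.
by exists k; split=> //; apply/negP => /kmin; rewrite ltnn.
Qed.

(** From H w = 0 one gets E F^(i+1) w = c binom(i+1, 2) F^i w. If F^k w is the last nonzero power,
    then i = k forces binom(k+1, 2) = 0, so k = 0. *)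
Lemma sl2_kill (E F H : 'M[C]_n) (c : C) (w : 'cV_n) (N : nat) :
  E *m F - F *m E = H -> H *m F - F *m H = c *: F -> c != 0 -> F ^+ N = 0 ->
  E *m w = 0 -> H *m w = 0 -> F *m w = 0.
Proof.
move=> EF HF c0 FN Ew Hw.
have [->|w0] := eqVneq w 0; first by rewrite mulmx0.
have [k [Fk Fk1]] := nilpotent_least FN w0.
have HFk i : H *m (F ^+ i *m w) = (c *+ i) *: (F ^+ i *m w).
  elim: i => [|i IH]; first by rewrite expr0 mul1mx Hw mulr0n scale0r.
  rewrite exprS -mulmxE -mulmxA mulmxA.
  have -> : H *m F = F *m H + c *: F by rewrite -HF addrC subrK.
  by rewrite mulmxDl -mulmxA IH -scalemxAr -scalemxAl -scalerDl mulrSr.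
have EFk i : E *m (F ^+ i.+1 *m w) = (c *+ 'C(i.+1, 2)) *: (F ^+ i *m w).
  elim: i => [|i IH].
    rewrite bin_small // mulr0n scale0r expr1 mulmxA.
    have -> : E *m F = F *m E + H by rewrite -EF addrC subrK.
    by rewrite mulmxDl -mulmxA Ew mulmx0 Hw addr0.
  rewrite exprS -mulmxE -mulmxA mulmxA.
  have -> : E *m F = F *m E + H by rewrite -EF addrC subrK.
  rewrite mulmxDl -mulmxA IH HFk -scalemxAr (exprS F i) -mulmxE -mulmxA -scalerDl.
  have -> : 'C(i.+2, 2) = ('C(i.+1, 2) + i.+1)%N by rewrite binS bin1.
  by rewrite -mulrnDr.
case: k Fk Fk1 => [|k] Fk Fk1; first by rewrite expr1 in Fk1.
have := EFk k.+1; rewrite Fk1 mulmx0 => /esym/eqP.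
by rewrite scaler_eq0 (negPf Fk) orbF mulrn_eq0 (negPf c0) orbF eqn0Ngt bin_gt0.
Qed.

End Sl2.

Section HighestWeightLie.

Variables (C : numClosedFieldType) (l' n : nat).
Notation l := l'.+1.
Variables (f : 'M[C]_(spindim l) -> 'M[C]_n).
Variable df : {linear 'M[C]_(spindim l) -> 'M[C]_n}.
Hypotheses (f_morph : alg_morphism (@spin C l) f) (f_diff : is_diff (@spin C l) f df).

Lemma highest_weight_lie (lam : 'rV[rat]_l) : highest_weight f lam ->
  exists v : 'cV_n, [/\ v != 0,
    forall j, (j < l)%N -> df (torus_lie C l j) *m v = (numq (2 * lam 0 (inord j)))%:~R *: v
    & forall X, pos_root X -> df X *m v = 0].
Proof.
case=> v [v0 tv pv]; exists v; split=> // [j jl|X pX].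
  apply/(torus_weightP jl f_morph f_diff) => z z0.
  by have := tv (inord j) z z0; rewrite inordK.
have uX := pos_root_unipotent (ltn0Sn l') pX.
by apply/(rep_fixP f_morph f_diff v uX) => t; apply/pv/pos_root_eltP.
Qed.

End HighestWeightLie.

Section SpinEmbedding.

Variables (C : numClosedFieldType).
Variable phi : 'M[C]_(spindim 3) -> 'M[C]_(spindim 4).
Hypotheses (phi_morph : alg_morphism (@spin C 3) phi)
  (phi_spin : forall h, @spin C 3 h -> @spin C 4 (phi h))
  (phi_image : forall h, @spin C 3 h ->
     so_image (phi h) (Qmx C *m extend_mx 1 h *m invmx (Qmx C))).

Lemma diff_embed (dphi : {linear 'M[C]_(spindim 3) -> 'M[C]_(spindim 4)}) X :
  is_diff (@spin C 3) phi dphi -> so_lie X -> dphi X = embed_lie X.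
Proof.
move=> phi_diff; elim=> {X} [X sX|X Y _ IX _ IY|c X _ IX]; last 2 first.
- by rewrite linearD embed_lieD IX IY.
- by rewrite linearZZ embed_lieZ IX.
have uX := siegel_unipotent sX; have [_ _ hX] := uX.
rewrite (diff_embedding (ltn0Sn 2) (ltn0Sn 3) phi_morph phi_diff phi_spin uX
  (M := 2^-1 *: (Qmx C *m extend_mx 0 X *m Qstar C))).
  (* The factor 1/8 is 1/4 from [diff_embedding] times 1/2 from the inverse of [Qmx]. *)
  rewrite so_ofZ scalerA /embed_lie; congr (_ *: _).
  by rewrite -invfM -natrM.
move=> t; have := phi_image (hX t); congr so_image.
have -> : extend_mx 1 (1%:M + t *: X) = 1%:M + t *: extend_mx 0 X.
  by rewrite -extend_mx1 -extend_mxZ mulr0 -extend_mxD addr0.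
rewrite mulmxDr mulmx1 mulmxDl mulmxV ?Qmx_unit // -scalemxAr -scalemxAl.
congr (_ + _ *: _); rewrite invmx_Qmx mulmxA -(mulmxA (Qmx C) (extend_mx 0 X) (extend_mx 1 _)).
have -> : extend_mx 0 X *m extend_mx 1 (2^-1)%:M = 2^-1 *: extend_mx 0 X.
  by rewrite -extend_mxM mul0r mul_mx_scalar -(extend_mxZ 2^-1 0) mulr0.
by rewrite -scalemxAr -scalemxAl.
Qed.

Inductive borel_parabolic : 'M[C]_(spindim 4) -> Prop :=
| BorelNeg X of neg_root X : borel_parabolic X
| BorelTorus j of (j < 4)%N : borel_parabolic (torus_lie C 4 j)
| ParabolicIn A of A \in gparabolic :
    borel_parabolic (embed_lie (mx_of C (spindim 3) (spindim 3) A)).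

Lemma gspan_borel_parabolic A : A \in gspan ->
  lspan borel_parabolic (mx_of C (spindim 4) (spindim 4) A).
Proof.
rewrite !mem_cat => /or3P[h|/mapP[j]|/mapP[B hB ->]].
- by apply/lspan_in/BorelNeg/gneg_rootsP; rewrite !mem_cat.
- rewrite mem_iota => /andP[_ jl] ->; rewrite mx_of_torus.
  exact/lspan_in/BorelTorus.
- by rewrite mx_of_embed; apply/lspanZ/lspan_in/ParabolicIn.
Qed.

Lemma borel_parabolic_span X : so_lie X -> lspan borel_parabolic X.
Proof.
move=> /(triangular_span (ltn0Sn 3)); elim=> [|c Y Z gY _ IH]; first exact: LspanZero.
apply: lspanD IH; apply: lspanZ; case: gY => {Y} [Y nY|j jl|Y pY].
- exact/lspan_in/BorelNeg.
- exact/lspan_in/BorelTorus.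
have [A hA ->] := pos_root_list pY.
have [r hr] := all2_mem decomposition_table_correct hA.
have := geqmxP C hr; rewrite mx_of_scaleN /gcombination mx_of_sum big_map => e.
have -> : mx_of C (spindim 4) (spindim 4) A = 16^-1 *:
    (gval C (Posz 16, Posz 0) *: mx_of C (spindim 4) (spindim 4) A).
  by rewrite scalerA /gval /= mulr0 addr0 mulVf ?pnatr_eq0 // scale1r.
rewrite e; apply: lspanZ; apply: big_ind => [|x y|x _].
- exact: LspanZero.
- exact: lspanD.
rewrite mx_of_scaleN; apply: lspanZ.
have [h|h] := ltnP x.2 (size gspan); first exact/gspan_borel_parabolic/mem_nth.
by rewrite nth_default // mx_of_nil; apply: LspanZero.
Qed.

End SpinEmbedding.

(** * The multiplicity bound *)

(** Root vectors for epsilon_4 and -epsilon_4; then for -epsilon_2 - epsilon_3 and -epsilon_2 +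
    epsilon_3. The last two commute with the first because adding epsilon_4 to their roots does not
    give a root. *)
Definition gshort_root : gmat := gmulN 4 (giso_plus 4 3) (ggamma 4 8).
Definition gshort_root_neg : gmat := gmulN 4 (giso_minus 4 3) (ggamma 4 8).
Definition gtilt_neg1 : gmat := gmulN 4 (giso_minus 4 1) (giso_minus 4 2).
Definition gtilt_neg2 : gmat := gmulN 4 (giso_minus 4 1) (giso_plus 4 2).

Lemma short_root_relations :
  let N := spindim 4 in
  [&& geqmx N N (gbracket 4 (gtorus 4 3) gshort_root) (gscaleN 4 (Posz 2, Posz 0) gshort_root),
      geqmx N N (gbracket 4 (gtorus 4 1) gshort_root) [::],
      geqmx N N (gbracket 4 gtilt_neg1 gshort_root) [::],
      geqmx N N (gbracket 4 gtilt_neg2 gshort_root) [::],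
      geqmx N N (gbracket 4 gshort_root gshort_root_neg) (gscaleN 4 (Negz 3, Posz 0) (gtorus 4 3)),
      gshort_root \in gpos_roots 4, gshort_root_neg \in gneg_roots 4,
      gtilt_neg1 \in gneg_roots 4 & gtilt_neg2 \in gneg_roots 4].
Proof. by vm_compute. Qed.

Lemma gtilt_roots : [/\ gmulN 3 (giso_plus 3 0) (ggamma 3 6) \in gpos_roots 3,
  gmulN 3 (giso_plus 3 1) (giso_minus 3 2) \in gpos_roots 3
  & gmulN 3 (giso_plus 3 1) (giso_plus 3 2) \in gpos_roots 3].
Proof. by split; vm_compute. Qed.

(** The source of the relation between k and lambda. On weight k epsilon_1 the torus part 2 h_1 + 2
    h_2 of so_7 takes the value 4 k, and the other terms of the argument are positive root vectors.
    In the image the torus part is a multiple of h_2 + h_4 of so_9, which sees a_2 + a_4; apart from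
    [gshort_root], the remaining terms are negative root vectors. [Negz 15] is -16. *)
Lemma gtilt_sum : geqmx (spindim 4) (spindim 4)
  (gembed (gscaleN 3 (gopp gi) (gsummx 3
   [:: gmulN 3 (giso_plus 3 0) (ggamma 3 6); gmulN 3 (giso_plus 3 0) (ggamma 3 6);
       gmulN 3 (giso_plus 3 1) (giso_minus 3 2); gmulN 3 (giso_plus 3 1) (giso_plus 3 2);
       gtorus 3 0; gtorus 3 0; gtorus 3 1; gtorus 3 1])))
  (gsummx 4 [seq gscaleN 4 x.1 x.2 | x <- [:: ((Posz 16, Posz 0), gshort_root);
     ((Posz 0, Negz 15), gtorus 4 3); ((Posz 0, Negz 15), gtorus 4 1);
     ((Posz 8, Posz 0), gtilt_neg1); ((Negz 7, Posz 0), gtilt_neg2)]]).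
Proof. by vm_compute. Qed.

Opaque gpos_roots gneg_roots gtori glevi gparabolic gmulN gtorus gembed gscaleN gsummx gbracket.

Lemma gbracketP (C : numClosedFieldType) l A B D : geqmx (spindim l) (spindim l) (gbracket l A B) D ->
  let mxN := mx_of C (spindim l) (spindim l) in mxN A *m mxN B - mxN B *m mxN A = mxN D.
Proof. by move/(geqmxP C); rewrite mx_of_bracket. Qed.

Lemma gbracket_scaleP (C : numClosedFieldType) l A B D c :
  geqmx (spindim l) (spindim l) (gbracket l A B) (gscaleN l (c, Posz 0) D) ->
  let mxN := mx_of C (spindim l) (spindim l) in
  mxN A *m mxN B - mxN B *m mxN A = c%:~R *: mxN D.
Proof. by move=> /(gbracketP C) /= ->; rewrite mx_of_scaleN /gval /= mulr0 addr0. Qed.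

Lemma gbracket_combP (C : numClosedFieldType) l A B T1 T2 a b t1 t2 :
  mx_of C (spindim l) (spindim l) T1 = t1 -> mx_of C (spindim l) (spindim l) T2 = t2 ->
  geqmx (spindim l) (spindim l) (gbracket l A B)
    (gaddN l (gscaleN l a T1) (gscaleN l b T2)) ->
  let mxN := mx_of C (spindim l) (spindim l) in
  mxN A *m mxN B - mxN B *m mxN A = gval C a *: t1 + gval C b *: t2.
Proof. by move=> <- <- /(gbracketP C) /= ->; rewrite mx_of_addN !mx_of_scaleN. Qed.

Lemma gembed_sumP (C : numClosedFieldType) c s (t : seq (gauss * gmat)) :
  geqmx (spindim 4) (spindim 4) (gembed (gscaleN 3 c (gsummx 3 s)))
    (gsummx 4 [seq gscaleN 4 x.1 x.2 | x <- t]) ->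
  8 *: embed_lie (gval C c *: \sum_(A <- s) mx_of C (spindim 3) (spindim 3) A)
    = \sum_(x <- t) gval C x.1 *: mx_of C (spindim 4) (spindim 4) x.2.
Proof.
move/(geqmxP C); rewrite mx_of_embed mx_of_scaleN !mx_of_sum => ->.
by rewrite big_map; apply: eq_bigr => x _; rewrite mx_of_scaleN.
Qed.

Lemma gembed_tiltP (C : numClosedFieldType) (X1 X2 X3 T0 T1 E U3 U1 N1 N2 : gmat) t0 t1 u3 u1 :
  mx_of C (spindim 3) (spindim 3) T0 = t0 -> mx_of C (spindim 3) (spindim 3) T1 = t1 ->
  mx_of C (spindim 4) (spindim 4) U3 = u3 -> mx_of C (spindim 4) (spindim 4) U1 = u1 ->
  geqmx (spindim 4) (spindim 4)
    (gembed (gscaleN 3 (gopp gi) (gsummx 3 [:: X1; X1; X2; X3; T0; T0; T1; T1])))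
    (gsummx 4 [seq gscaleN 4 x.1 x.2 | x <- [:: ((Posz 16, Posz 0), E);
     ((Posz 0, Negz 15), U3); ((Posz 0, Negz 15), U1); ((Posz 8, Posz 0), N1);
     ((Negz 7, Posz 0), N2)]]) ->
  let mxN := mx_of C (spindim 4) (spindim 4) in let mxH := mx_of C (spindim 3) (spindim 3) in
  8 *: embed_lie (- 'i *: (mxH X1 + (mxH X1 + (mxH X2 + (mxH X3 + (t0 + (t0 + (t1 + t1)))))))) =
  16 *: mxN E + ((- 'i * 16) *: u3 + ((- 'i * 16) *: u1 + (8 *: mxN N1 + (- 8) *: mxN N2))).
Proof.
move=> <- <- <- <- /(gembed_sumP C); rewrite gvalN gvali !big_cons !big_nil !addr0 /= => ->.
congr (_ *: _ + (_ *: _ + (_ *: _ + (_ *: _ + _ *: _))));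
  by rewrite /gval /= ?mulr0 ?addr0 ?add0r // mulrN mulNr.
Qed.

Lemma tilt_relations (C : numClosedFieldType) :
  exists E F N1 N2 X1 X2 X3, [/\ [/\ pos_root E, neg_root F, neg_root N1 & neg_root N2],
  [/\ torus_lie C 4 3 *m E - E *m torus_lie C 4 3 = 2 *: E,
      E *m F - F *m E = (- 4) *: torus_lie C 4 3,
      torus_lie C 4 1 *m E - E *m torus_lie C 4 1 = 0,
      N1 *m E - E *m N1 = 0 & N2 *m E - E *m N2 = 0],
  [/\ pos_root X1, pos_root X2 & pos_root X3]
  & 8 *: embed_lie (- 'i *: (X1 + (X1 + (X2 + (X3 + (torus_lie C 3 0 +
        (torus_lie C 3 0 + (torus_lie C 3 1 + torus_lie C 3 1)))))))) =
    16 *: E + ((- 'i * 16) *: torus_lie C 4 3 + ((- 'i * 16) *: torus_lie C 4 1 +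
      (8 *: N1 + (- 8) *: N2)))].
Proof.
pose mxN A := mx_of C (spindim 4) (spindim 4) A; pose mxH A := mx_of C (spindim 3) (spindim 3) A.
have /and5P[r1 r2 r3 r4 /and5P[r5 posE negF neg1 neg2]] := short_root_relations.
have [p1 p2 p3] := gtilt_roots.
exists (mxN gshort_root), (mxN gshort_root_neg), (mxN gtilt_neg1), (mxN gtilt_neg2).
exists (mxH (gmulN 3 (giso_plus 3 0) (ggamma 3 6))).
exists (mxH (gmulN 3 (giso_plus 3 1) (giso_minus 3 2))).
exists (mxH (gmulN 3 (giso_plus 3 1) (giso_plus 3 2))).
split.
- by split; [exact: (gpos_rootsP C posE)|exact: (gneg_rootsP C negF)
            |exact: (gneg_rootsP C neg1)|exact: (gneg_rootsP C neg2)].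
- have nil0 : mxN [::] = 0 := mx_of_nil _ _ _.
  rewrite -(mx_of_torus 4 C 3) -(mx_of_torus 4 C 1) -nil0; split.
  + exact: (gbracket_scaleP C r1).
  + exact: (gbracket_scaleP C r5).
  + exact: (gbracketP C r2).
  + exact: (gbracketP C r3).
  exact: (gbracketP C r4).
- by split; [exact: (gpos_rootsP C p1)|exact: (gpos_rootsP C p2)|exact: (gpos_rootsP C p3)].
exact: (gembed_tiltP (mx_of_torus 3 C 0) (mx_of_torus 3 C 1) (mx_of_torus 4 C 3)
  (mx_of_torus 4 C 1) gtilt_sum).
Qed.

Lemma levi_relations (C : numClosedFieldType) A : A \in glevi ->
  let F := mx_of C (spindim 3) (spindim 3) A in
  exists E a b c, [/\ pos_root E, neg_root F, c != 0,
    E *m F - F *m E = a *: torus_lie C 3 1 + b *: torus_lie C 3 2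
  & (E *m F - F *m E) *m F - F *m (E *m F - F *m E) = c *: F].
Proof.
have /andP[/eqP gl /allP ok] := levi_table_correct.
move=> hA; rewrite gl in hA; have /mapP[[[[[E F] a] b] c] hx /= ->] := hA.
have := ok _ hx => /and5P[posE negF c0 e1 e2].
have {}e1 := gbracket_combP (mx_of_torus 3 C 1) (mx_of_torus 3 C 2) e1.
move/(geqmxP C): e2; rewrite !mx_of_bracket mx_of_scaleN => e2.
exists (mx_of C (spindim 3) (spindim 3) E), (gval C (a, Posz 0)), (gval C (b, Posz 0)).
exists (gval C (c, Posz 0)); split.
- exact: (gpos_rootsP C posE).
- exact: (gneg_rootsP C negF).
- by rewrite /gval /= mulr0 addr0 intr_eq0.
- exact: e1.
- exact: e2.
Qed.

Section LowestFunctionalPowers.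

Variables (C : numClosedFieldType) (n : nat) (xi : 'rV[C]_n) (E H : 'M[C]_n) (a : C).
Hypotheses (HE : H *m E - E *m H = 2 *: E) (xiH : xi *m H = a *: xi).

Lemma functional_pow_torus m : xi *m E ^+ m *m H = (a - m%:R *+ 2) *: (xi *m E ^+ m).
Proof.
have EH : E *m H = H *m E - 2 *: E by rewrite -HE opprB addrC subrK.
elim: m => [|m IH]; first by rewrite expr0 mulmx1 xiH mulr0n mul0rn subr0.
rewrite exprSr -mulmxE -!mulmxA EH mulmxBr mulmxBr !mulmxA IH -scalemxAl -scalemxAr.
by rewrite -scalerBl -natr1; congr (_ *: _); ring.
Qed.

Lemma functional_pow_commute (X : 'M[C]_n) b m : X *m E - E *m X = 0 ->
  xi *m X = b *: xi -> xi *m E ^+ m *m X = b *: (xi *m E ^+ m).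
Proof.
move=> /eqP; rewrite subr_eq0 => /eqP XE xiX.
elim: m => [|m IH]; first by rewrite expr0 mulmx1.
by rewrite exprSr -mulmxE -!mulmxA -XE !mulmxA IH -scalemxAl.
Qed.

Variables (F : 'M[C]_n) (c : C).
Hypotheses (EF : E *m F - F *m E = c *: H) (xiF : xi *m F = 0) (c0 : c != 0).

Lemma functional_pow_lower m :
  xi *m E ^+ m.+1 *m F = (c * (m.+1%:R * (a - m%:R))) *: (xi *m E ^+ m).
Proof.
have EF' : E *m F = F *m E + c *: H by rewrite -EF addrC subrK.
elim: m => [|m IH].
  rewrite expr1 expr0 mulmx1 -mulmxA EF' mulmxDr mulmxA xiF mul0mx add0r.
  by rewrite -scalemxAr xiH scalerA mul1r subr0.
rewrite (exprSr E m.+1) -mulmxE mulmxA -(mulmxA _ E F) EF' mulmxDr mulmxA IH.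
rewrite -scalemxAr functional_pow_torus -scalemxAl -mulmxA mulmxE -exprSr scalerA -scalerDl.
by congr (_ *: _); rewrite -!natr1; ring.
Qed.

(** Applying F to the vanishing functional xi E^(m+1) leaves c (m + 1) (a - m) times xi E^m. *)
Lemma functional_pow_top m : xi *m E ^+ m != 0 -> xi *m E ^+ m.+1 = 0 -> a = m%:R.
Proof.
move=> nz z; have := functional_pow_lower m; rewrite z mul0mx => /esym/eqP.
rewrite scaler_eq0 (negPf nz) orbF mulf_eq0 (negPf c0) mulf_eq0 pnatr_eq0 /=.
by rewrite subr_eq0 => /eqP.
Qed.

End LowestFunctionalPowers.

Lemma short_root_string (C : numClosedFieldType) n (xi : 'rV[C]_n) (w : 'cV_n)
    (E F H3 H1 N1 N2 : 'M_n) (a3 a1 : C) (k N : nat) :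
  H3 *m E - E *m H3 = 2 *: E -> E *m F - F *m E = (- 4) *: H3 ->
  H1 *m E - E *m H1 = 0 -> N1 *m E - E *m N1 = 0 -> N2 *m E - E *m N2 = 0 ->
  xi *m H3 = a3 *: xi -> xi *m H1 = a1 *: xi ->
  xi *m F = 0 -> xi *m N1 = 0 -> xi *m N2 = 0 -> xi *m w != 0 -> E ^+ N = 0 ->
  (16 *: E + ((- 'i * 16) *: H3 + ((- 'i * 16) *: H1 + (8 *: N1 + (- 8) *: N2)))) *m w
    = (8 * (- 'i * (k%:R *+ 4))) *: w ->
  exists m M : nat, [/\ (m <= M)%N, a3 = M%:R & a1 + M%:R = (k%:R + m%:R) *+ 2].
Proof.
move=> HE EF H1E N1E N2E xiH3 xiH1 xiF xiN1 xiN2 xw EN tiltw.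
have xi0 : xi != 0 by apply: contraNneq xw => ->; rewrite mul0mx.
have n4 : - 4 != 0 :> C by rewrite oppr_eq0 pnatr_eq0.
(* [M] is the length of the string of [xi] under E. The last power [m] that is nonzero on [w] cannot
   exceed it. *)
have [M [M0 M1]] : exists M, xi *m E ^+ M != 0 /\ xi *m E ^+ M.+1 = 0.
  have ex : exists M, xi *m E ^+ M == 0 by exists N; rewrite EN mulmx0.
  case: (ex_minnP ex) => -[|M] /eqP MM Mmin.
    by rewrite expr0 mulmx1 in MM; rewrite MM eqxx in xi0.
  by exists M; split=> //; apply/negP => /Mmin; rewrite ltnn.
have aM := functional_pow_top HE xiH3 EF xiF n4 M0 M1.
have [m [m0 m1]] : exists m, xi *m E ^+ m *m w != 0 /\ xi *m E ^+ m.+1 *m w = 0.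
  have ex : exists m, xi *m E ^+ m *m w == 0 by exists M.+1; rewrite M1 mul0mx.
  case: (ex_minnP ex) => -[|m] /eqP mm mmin.
    by rewrite expr0 mulmx1 in mm; rewrite mm eqxx in xw.
  by exists m; split=> //; apply/negP => /mmin; rewrite ltnn.
have mM : (m <= M)%N.
  rewrite leqNgt; apply/negP => Mm; move: m0.
  by rewrite -(subnKC Mm) exprD -mulmxE mulmxA M1 !mul0mx eqxx.
exists m, M; split=> //.
(* The given operator is evaluated by xi E^m: its term in E gives xi E^(m+1) w = 0, N1 and N2
   commute with E and kill [xi], and moving H3 across E^m lowers its eigenvalue by 2 m. *)
have : xi *m E ^+ m *m ((8 * (- 'i * (k%:R *+ 4))) *: w) =
    ((- 'i * 16) * (a3 - m%:R *+ 2) + (- 'i * 16) * a1) *: (xi *m E ^+ m *m w).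
  rewrite -tiltw mulmxA !mulmxDr !mulmxDl -!scalemxAr -!scalemxAl.
  have -> : xi *m E ^+ m *m E = xi *m E ^+ m.+1 by rewrite exprSr mulmxA.
  rewrite m1 scaler0 add0r (functional_pow_torus HE xiH3).
  rewrite (functional_pow_commute m H1E xiH1).
  rewrite (functional_pow_commute m N1E (b := 0)) ?scale0r //.
  rewrite (functional_pow_commute m N2E (b := 0)) ?scale0r //.
  by rewrite !mul0mx !scaler0 !addr0 -!scalemxAl !scalerA -scalerDl.
rewrite -scalemxAr => /eqP; rewrite -subr_eq0 -scalerBl.
rewrite scaler_eq0 (negPf m0) orbF aM => /eqP e.
have nz : 'i * 16 != 0 :> C by rewrite mulf_neq0 ?neq0Ci ?pnatr_eq0.
by apply: (mulfI nz); apply/eqP; rewrite -subr_eq0; apply/eqP; rewrite -[RHS]e; ring.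
Qed.

Lemma linear_sum_weight (R : comRingType) m n (d : {linear 'M[R]_m -> 'M[R]_n})
    (X1 X2 X3 H0 H1 : 'M[R]_m) (w : 'cV_n) (c a b : R) :
  d X1 *m w = 0 -> d X2 *m w = 0 -> d X3 *m w = 0 -> d H0 *m w = a *: w ->
  d H1 *m w = b *: w ->
  d (c *: (X1 + (X1 + (X2 + (X3 + (H0 + (H0 + (H1 + H1)))))))) *m w
    = (c * ((a + b) *+ 2)) *: w.
Proof.
move=> e1 e2 e3 h0 h1; rewrite (linearZZ d) !(linearD d) -scalemxAl !mulmxDl.
rewrite e1 e2 e3 h0 h1 !add0r -!scalerDl scalerA; congr (_ *: _); congr (_ * _).
by rewrite mulrnDl !mulr2n addrA addrAC -!addrA; congr (_ + _); rewrite addrA [RHS]addrC.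
Qed.

Section MultiplicityBound.

Variables (C : numClosedFieldType).
Variable phi : 'M[C]_(spindim 3) -> 'M[C]_(spindim 4).
Hypotheses (phi_morph : alg_morphism (@spin C 3) phi)
  (phi_spin : forall h, @spin C 3 h -> @spin C 4 (phi h))
  (phi_image : forall h, @spin C 3 h ->
     so_image (phi h) (Qmx C *m extend_mx 1 h *m invmx (Qmx C))).

Variables (n p k : nat) (lam : 'rV[rat]_4).
Variables (f : 'M[C]_(spindim 4) -> 'M[C]_n) (g : 'M[C]_(spindim 3) -> 'M[C]_p).
Hypotheses (f_irr : irrep_of_hw lam f) (g_irr : irrep_of_hw (eps 0 *+ k) g).

Definition intertwiner (T : 'M[C]_(n, p)) : Prop :=
  forall h, spin h -> T *m g h = f (phi h) *m T.

Let f_morph : alg_morphism (@spin C 4) f. Proof. by case: f_irr => -[]. Qed.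
Let g_morph : alg_morphism (@spin C 3) g. Proof. by case: g_irr => -[]. Qed.

Lemma intertwiner_kernel T (w : 'cV_p) : intertwiner T -> w != 0 -> T *m w = 0 -> T = 0.
Proof.
move=> Tint w0 Tw.
have [U UP] : exists U : {vspace 'cV[C]_p}, forall v, v \in U <-> T *m v = 0.
  apply: linear_pred_vspace => [|u v Tu Tv|c u Tu]; first by rewrite mulmx0.
    by rewrite mulmxDr Tu Tv addr0.
  by rewrite -scalemxAr Tu scaler0.
have [[_ _ irr] _] := g_irr; case: (irr U) => [h v sh /UP Tv|U0|Uf].
- by apply/UP; rewrite mulmxA Tint // -mulmxA Tv mulmx0.
- by have /UP := Tw; rewrite U0 memv0 (negPf w0).
apply/matrixP => i j; have : T *m delta_mx j 0 = 0 :> 'cV_n by apply/UP; rewrite Uf memvf.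
by rewrite -colE => /matrixP/(_ i 0); rewrite !mxE.
Qed.

Variables (df : {linear 'M[C]_(spindim 4) -> 'M[C]_n})
  (dg : {linear 'M[C]_(spindim 3) -> 'M[C]_p}).
Hypotheses (f_diff : is_diff (@spin C 4) f df) (g_diff : is_diff (@spin C 3) g dg).

Lemma intertwiner_diff T X : intertwiner T -> so_lie X ->
  T *m dg X = df (embed_lie X) *m T.
Proof.
move=> Tint; have [_ _ reg] := phi_morph; have [dphi phi_diff] := regular_diff reg.
elim=> {X} [X sX|X Y _ IX _ IY|c X _ IX]; last 2 first.
- by rewrite embed_lieD (linearD dg) (linearD df) mulmxDr mulmxDl IX IY.
- by rewrite embed_lieZ (linearZZ dg) (linearZZ df) -scalemxAr -scalemxAl IX.
have uX := siegel_unipotent sX; have [sX' _ hX] := uX.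
rewrite -(diff_embed phi_morph phi_spin phi_image phi_diff sX').
have c1 := mcurve_mull T (rep_curve g_morph g_diff uX).
have c2 : mcurve 1 0 (fun t => f (phi (1%:M + t *: X)) *m T) (f 1%:M *m T) (df (dphi X) *m T).
  apply: mcurve_mulr; apply: f_diff; first exact: one_horner_neq0.
    by move=> t _; apply/phi_spin/hX.
  exact: rep_curve.
apply: (mcurve_uniq (one_horner_neq0 (0 : C)) c1).
apply: mcurve_ext c2 => t _; rewrite Tint //.
Qed.

Lemma weight_eps0 j : (j < 3)%N ->
  (numq (2 * (eps 0 *+ k : 'rV[rat]_3) 0 (inord j)))%:~R = (if j == 0 then k%:R *+ 2 else 0) :> C.
Proof.
move=> j3; rewrite mulmxnE mxE eqxx /= -val_eqE /= inordK //.
case: j j3 => [|j] j3 /=; last by rewrite mul0rn mulr0 (numq_int 0).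
by rewrite -natrM -[(2 * k)%:R]/(((2 * k)%N%:Z)%:~R) numq_int -pmulrn natrM mulr_natl.
Qed.

(** The torus elements with indices 1 and 2 vanish on weight k epsilon_1, so [sl2_kill] makes the
    negative root vectors of the Levi factor kill the highest weight vector. *)
Lemma parabolic_weight_vector : exists w0 : 'cV_p, [/\ w0 != 0,
   forall j, (j < 3)%N ->
     dg (torus_lie C 3 j) *m w0 = (if j == 0 then k%:R *+ 2 else 0) *: w0,
   forall X, pos_root X -> dg X *m w0 = 0
   & forall A, A \in gparabolic ->
       exists c, dg (mx_of C (spindim 3) (spindim 3) A) *m w0 = c *: w0].
Proof.
have [_ hw] := g_irr; have [w0 [w00 tw pw]] := highest_weight_lie g_morph g_diff hw.
have {}tw j : (j < 3)%N ->
    dg (torus_lie C 3 j) *m w0 = (if j == 0 then k%:R *+ 2 else 0) *: w0.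
  by move=> j3; rewrite tw // weight_eps0.
exists w0; split=> // A.
rewrite !mem_cat => /or3P[hA|/mapP[j]|hA].
- by exists 0; rewrite scale0r; apply/pw/gpos_rootsP; rewrite !mem_cat.
- rewrite mem_iota => /andP[_ j3] ->; rewrite mx_of_torus tw //.
  by eexists.
have [E [a [b [c [posE negF c0 e1 e2]]]]] := levi_relations C hA.
exists 0; rewrite scale0r.
have [sE _ _] := pos_root_unipotent (ltn0Sn 2) posE.
have uF := neg_root_unipotent (ltn0Sn 2) negF; have [sF _ _] := uF.
have [N [FN _]] := rep_exp g_morph g_diff uF.
apply: (sl2_kill (esym (diff_bracket g_morph g_diff sE sF)) _ c0 FN).
- by rewrite -(diff_bracket g_morph g_diff (so_lie_bracket sE sF) sF) e2 linearZZ.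
- exact: pw.
rewrite e1 (linearD dg) (linearZZ dg a) (linearZZ dg b) mulmxDl -!scalemxAl (tw 1%N isT) (tw 2%N isT).
by rewrite !scale0r !scaler0 addr0.
Qed.

Lemma gparabolic_so_lie A : A \in gparabolic -> so_lie (mx_of C (spindim 3) (spindim 3) A).
Proof.
rewrite !mem_cat => /or3P[hA|/mapP[j]|hA].
- have hA' : A \in gpos_roots 3 by rewrite !mem_cat.
  by have [] := pos_root_unipotent (ltn0Sn 2) (gpos_rootsP C hA').
- rewrite mem_iota => /andP[_ j3] ->; rewrite mx_of_torus.
  exact: torus_lie_so.
have [E [a [b [c [_ negF _ _ _]]]]] := levi_relations C hA.
by have [] := neg_root_unipotent (ltn0Sn 2) negF.
Qed.

Theorem multiplicity_bound T : intertwiner T -> T != 0 ->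
  (forall T', intertwiner T' -> exists c, T' = c *: T) /\
  exists m M : nat, [/\ (m <= M)%N, (M%:Z = numq (2 * lam 0 (inord 3)))
    & numq (2 * lam 0 (inord 1)) + M%:Z = (k%:Z + m%:Z) *+ 2].
Proof.
move=> Tint T0.
have [w0 [w00 tw pw par]] := parabolic_weight_vector.
have [_ hw] := f_irr; have [v [v0 tv pv]] := highest_weight_lie f_morph f_diff hw.
have firr : irreducible_rep (@spin C 4) f by case: f_irr.
have [xi [xi0 txi nxi]] := lowest_weight_functional (ltn0Sn 3) firr f_diff
  (m := fun j => (numq (2 * lam 0 (inord j)))%:~R) v0 tv pv.
have separates T' : intertwiner T' -> xi *m (T' *m w0) = 0 -> T' = 0.
  move=> T'int e; apply/eqP/negPn/negP => T'0.
  have Tw : T' *m w0 != 0.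
    by apply/negP => /eqP /(intertwiner_kernel T'int w00) E; rewrite E eqxx in T'0.
  suff /eqP : xi = 0 by rewrite (negPf xi0).
  apply: (irreducible_functional (ltn0Sn 3) firr f_diff (@borel_parabolic_span C) _ e Tw).
  move=> X [Y nY|j jl|A hA].
  - left; split; last by exists 0; rewrite scale0r nxi.
    by have [] := neg_root_unipotent (ltn0Sn 3) nY.
  - left; split; first exact: torus_lie_so.
    by eexists; apply: txi.
  - right; have [c ec] := par A hA; exists c.
    by rewrite mulmxA -(intertwiner_diff T'int (gparabolic_so_lie hA)) -mulmxA ec -scalemxAr.
pose w := T *m w0.
have xw : xi *m w != 0 by apply/negP => /eqP /(separates T Tint) e; rewrite e eqxx in T0.
split.
  move=> T' T'int.
  have x11 (u : 'cV_n) : xi *m u = ((xi *m u) 0 0)%:M by apply: mx11_scalar.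
  (* The scalar is chosen so that [xi] cannot distinguish T' w0 from c T w0; [separates] then
     identifies T' with c T. *)
  pose c := (xi *m (T' *m w0)) 0 0 / (xi *m w) 0 0.
  exists c; apply/eqP; rewrite -subr_eq0; apply/eqP/separates.
    by move=> h sh; rewrite mulmxBl mulmxBr -scalemxAl -scalemxAr T'int // Tint.
  rewrite mulmxBl mulmxBr -scalemxAl -scalemxAr -/w (x11 w) (x11 (T' *m w0)).
  rewrite scale_scalar_mx divfK ?subrr //.
  by apply: contraNneq xw => e; rewrite (x11 w) e raddf0.
have [E [F [N1 [N2 [X1 [X2 [X3 [[pE nF n1 n2] [r1 r2 r3 r4 r5] [p1 p2 p3] tilt]]]]]]]] :=
  tilt_relations C.
have uE := pos_root_unipotent (ltn0Sn 3) pE; have [sE _ _] := uE.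
have so_neg X : @neg_root C 4 X -> so_lie X by move=> h; have [] := neg_root_unipotent (ltn0Sn 3) h.
have so_pos X : @pos_root C 3 X -> so_lie X by move=> h; have [] := pos_root_unipotent (ltn0Sn 2) h.
have s3 : so_lie (torus_lie C 4 3) by exact: torus_lie_so.
have s1 : so_lie (torus_lie C 4 1) by exact: torus_lie_so.
have br X Y Z : so_lie X -> so_lie Y -> X *m Y - Y *m X = Z ->
    df X *m df Y - df Y *m df X = df Z.
  by move=> sX sY <-; rewrite (diff_bracket f_morph f_diff sX sY).
have [N [EN _]] := rep_exp f_morph f_diff uE.
set Y := - 'i *: _ in tilt.
have sY : so_lie Y.
  by apply: SoScale; do !apply: SoAdd; first [exact: so_pos|exact: torus_lie_so].
have Yw : dg Y *m w0 = (- 'i * (k%:R *+ 4)) *: w0.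
  rewrite (linear_sum_weight (- 'i) (pw _ p1) (pw _ p2) (pw _ p3) (tw 0%N isT) (tw 1%N isT)).
  by rewrite /= addr0 -mulrnA.
have [m [M [mM a3 a1]]] : exists m M : nat, [/\ (m <= M)%N,
    (numq (2 * lam 0 (inord 3)))%:~R = M%:R :> C
    & (numq (2 * lam 0 (inord 1)))%:~R + M%:R = (k%:R + m%:R) *+ 2 :> C].
  apply: (@short_root_string C n xi w (df E) (df F) (df (torus_lie C 4 3))
    (df (torus_lie C 4 1)) (df N1) (df N2) _ _ k N.+1).
  - by rewrite (br _ _ _ s3 sE r1) linearZZ.
  - by rewrite (br _ _ _ sE (so_neg _ nF) r2) linearZZ.
  - by rewrite (br _ _ _ s1 sE r3) linear0.
  - by rewrite (br _ _ _ (so_neg _ n1) sE r4) linear0.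
  - by rewrite (br _ _ _ (so_neg _ n2) sE r5) linear0.
  - exact: txi.
  - exact: txi.
  - exact: nxi.
  - exact: nxi.
  - exact: nxi.
  - exact: xw.
  - exact: EN.
  rewrite -!(linearZZ df) -!(linearD df) -tilt (linearZZ df) -scalemxAl /w mulmxA.
  by rewrite -(intertwiner_diff Tint sY) -mulmxA Yw -scalemxAr scalerA.
exists m, M; split=> //.
  by apply/eqP; rewrite -(eqr_int C) a3.
by apply/eqP; rewrite -(eqr_int C) rmorphD rmorphMn rmorphD /= a1.
Qed.

End MultiplicityBound.

(** * Normal form of the embedding *)

(** The corner of Q^T Q, that is, the invariant bilinear form of the spin representation of Spin_7.
    That its square is 4 shows that it is nondegenerate; that the gammas are skew for it gives
    invariance. *)
Definition gform : gmat :=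
  gbuild 8 8 (fun i j => gget (gmulmx 9 9 9 (gtrmx 9 9 gQ) gQ) i j).

Lemma gform_correct : [&& geqmx 9 9 (gmulmx 9 9 9 (gtrmx 9 9 gQ) gQ)
     (gblock 8 1 gform [::] [::] (gscalar 1 g1)),
   geqmx 8 8 (gmulmx 8 8 8 gform gform) (gscalar 8 (Posz 4, Posz 0))
 & all (fun k => geqmx 8 8 (gmulmx 8 8 8 (gtrmx 8 8 (ggamma 3 k)) gform)
     (gscalemx 8 8 (gopp g1) (gmulmx 8 8 8 gform (ggamma 3 k)))) (iota 0 7)].
Proof. by vm_compute. Qed.

Lemma gvolume : geqmx 8 8 (ggamma 3 6) (gscalemx 8 8 gi
  (foldr (gmulmx 8 8 8) (gscalar 8 g1) [seq ggamma 3 k | k <- iota 0 6])).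
Proof. by vm_compute. Qed.

Section SpinNormalForm.

Variable C : numClosedFieldType.
Notation vec := 'cV[C]_(3.*2.+1).

Lemma spin_form : exists B : 'M[C]_(spindim 3), [/\ B \in unitmx,
  forall k, (k <= 6)%N -> (gamma C 3 k)^T *m B = - (B *m gamma C 3 k)
  & (Qmx C)^T *m Qmx C = extend_mx 1 B].
Proof.
have /and3P[e1 e2 /allP e3] := gform_correct.
exists (mx_of C 8 8 gform); split.
- move/(geqmxP C): e2; rewrite [LHS]mx_ofM mx_of_scalar => e2.
  have : 4^-1 *: mx_of C 8 8 gform *m mx_of C 8 8 gform = 1%:M.
    rewrite -scalemxAl e2 /gval /= mulr0 addr0 scale_scalar_mx mulVf //.
    by rewrite pnatr_eq0.
  by case/mulmx1_unit.
- move=> k k6; have := e3 k; rewrite mem_iota => /(_ k6)/(geqmxP C).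
  rewrite [LHS]mx_ofM [in LHS]mx_ofT [RHS]mx_ofZ gvalN gval1 scaleN1r [in RHS]mx_ofM => e.
  by rewrite gammaE.
move/(geqmxP C): e1; rewrite [LHS]mx_ofM [in LHS]mx_ofT => e0.
have := @mx_of_block C 8 1 gform [::] [::] (gscalar 1 g1).
rewrite !mx_of_nil !mx_of_scalar gval1 => e1.
by rewrite -[RHS]e1 -e0.
Qed.

Lemma mx_of_foldr n s : mx_of C n n (foldr (gmulmx n n n) (gscalar n g1) s) =
  foldr (fun A M => mx_of C n n A *m M) 1%:M s.
Proof.
elim: s => [|A s IH] /=; first by rewrite mx_of_scalar gval1.
by rewrite mx_ofM IH.
Qed.

Lemma spin_cliff_pair l (v w : 'cV[C]_(l.*2.+1)) : dot v v = 1 -> dot w w = 1 ->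
  @spin C l (cliff v *m cliff w).
Proof.
move=> vv ww; exists [:: v; w]; split=> //; last by rewrite !big_cons big_nil mulr1 -mulmxE.
by move=> u; rewrite !inE => /orP[/eqP->|/eqP->]; apply/unit_vectorE.
Qed.

Lemma spin_gamma_pair l a b : (a <= l.*2)%N -> (b <= l.*2)%N ->
  @spin C l (gamma C l a *m gamma C l b).
Proof.
move=> al bl; have -> : gamma C l a = cliff (basis_vec C (Ordinal (al : (a < l.*2.+1)%N))).
  by rewrite cliff_basis.
have -> : gamma C l b = cliff (basis_vec C (Ordinal (bl : (b < l.*2.+1)%N))).
  by rewrite cliff_basis.
by apply: spin_cliff_pair; rewrite dot_basis mxE !eqxx.
Qed.

Lemma volume_element : exists2 h, @spin C 3 h & gamma C 3 6 = 'i *: h.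
Proof.
have e : mx_of C 8 8 (ggamma 3 6) = _ := geqmxP C gvolume.
rewrite [RHS]mx_ofZ gvali [in RHS]mx_of_foldr in e.
exists (foldr (fun A M => mx_of C 8 8 A *m M) 1%:M [seq ggamma 3 k | k <- iota 0 6]); last first.
  exact: (etrans (gammaE C 3 6) e).
have pair a b h : (a <= 6)%N -> (b <= 6)%N -> @spin C 3 h ->
    @spin C 3 (mx_of C 8 8 (ggamma 3 a) *m (mx_of C 8 8 (ggamma 3 b) *m h)).
  move=> a6 b6 sh; rewrite mulmxA; apply: (spinM _ sh).
  have := @spin_gamma_pair 3 a b a6 b6; rewrite !gammaE; exact.
by apply: (pair 0 1) => //; apply: (pair 2 3) => //; apply: (pair 4 5) => //; apply: spin1.
Qed.

(** Schur's lemma for the spin representation. gamma_6 is i times an element of Spin_7, and gamma_k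
    = (gamma_k gamma_6) gamma_6; so commuting with Spin_7 implies commuting with every gamma. *)
Lemma spin3_commutant (X : 'M[C]_(spindim 3)) :
  (forall h, @spin C 3 h -> h *m X = X *m h) -> exists c, X = c%:M.
Proof.
move=> comm.
have c6 : gamma C 3 6 *m X = X *m gamma C 3 6.
  have [h sh ->] := volume_element.
  by rewrite -scalemxAl -scalemxAr comm.
have sq : gamma C 3 6 *m gamma C 3 6 = 1%:M.
  have -> : gamma C 3 6 = cliff (basis_vec C (ord_max : 'I_(3.*2.+1))) by rewrite cliff_basis.
  by rewrite cliff_sqr dot_basis mxE !eqxx.
apply: clifford_commutant => k k6.
have -> : gamma C 3 k = gamma C 3 k *m gamma C 3 6 *m gamma C 3 6.
  by rewrite -mulmxA sq mulmx1.
by rewrite -mulmxA c6 mulmxA (comm _ (@spin_gamma_pair 3 k 6 k6 isT)) !mulmxA.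
Qed.

(** Each unit vector changes the sign of the form, and the number of factors is even. *)
Lemma spin3_preserves_form (B h : 'M[C]_(spindim 3)) :
  (forall k, (k <= 6)%N -> (gamma C 3 k)^T *m B = - (B *m gamma C 3 k)) ->
  spin h -> h^T *m B *m h = B.
Proof.
move=> hB [s [os us ->]].
have cB (v : vec) : (cliff v)^T *m B = - (B *m cliff v).
  have -> : (cliff v)^T = \sum_i v i 0 *: (gamma C 3 i)^T.
    by apply/matrixP => a b; rewrite !(mxE, summxE); apply: eq_bigr => i _; rewrite !mxE.
  rewrite /cliff mulmx_suml mulmx_sumr -sumrN; apply: eq_bigr => i _.
  by rewrite -scalemxAl hB ?scalerN ?scalemxAr // -ltnS.
have step (v : vec) Y : unit_vector v -> (cliff v *m Y)^T *m B *m (cliff v *m Y) = - (Y^T *m B *m Y).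
  move/unit_vectorE => vv; rewrite trmx_mul -(mulmxA Y^T (cliff v)^T B) cB.
  rewrite mulmxN mulNmx -!mulmxA (mulmxA (cliff v)) cliff_sqr vv mul1mx.
  by rewrite !mulmxA.
suff gen (t : seq vec) : (forall v, v \in t -> unit_vector v) ->
    (\prod_(v <- t) cliff v)^T *m B *m (\prod_(v <- t) cliff v) = (-1) ^+ odd (size t) *: B.
  by rewrite gen // (negPf os) expr0 scale1r.
elim: t => [|v t IH] ut; first by rewrite big_nil trmx1 mul1mx mulmx1 expr0 scale1r.
have /IH e : forall u, u \in t -> unit_vector u by move=> u uS; apply: ut; rewrite inE uS orbT.
rewrite big_cons /= signrN scaleNr -e.
by apply: step; apply: ut; rewrite mem_head.
Qed.

End SpinNormalForm.

Section OrthogonalImage.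

Variables (C : numClosedFieldType) (l : nat).

(** Conjugation preserves the scalar v w + w v, which is twice the product of v and w. *)
Lemma so_image_orthogonal (g : 'M[C]_(spindim l)) A : g \in unitmx -> so_image g A ->
  orthogonal_mx A.
Proof.
move=> gu gA.
have gM (X Y : 'M_(spindim l)) : g *m X *m invmx g *m (g *m Y *m invmx g) = g *m (X *m Y) *m invmx g.
  by rewrite !mulmxA mulmxKV.
have dA v w : dot (A *m v) (A *m w) = dot v w.
  have e : (dot (A *m v) (A *m w) *+ 2)%:M = (dot v w *+ 2)%:M :> 'M[C]_(spindim l).
    rewrite -!cliff_clifford -!gA !gM -mulmxDl -mulmxDr cliff_clifford.
    by rewrite mul_mx_scalar -scalemxAl mulmxV // scalemx1.
  have i0 : 'I_(spindim l) by exists 0; apply: spindim_gt0.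
  by move/matrixP/(_ i0 i0): e; rewrite !mxE eqxx !mulr1n => /eqP;
  rewrite -subr_eq0 -mulrnBl mulrn_eq0 subr_eq0 => /eqP.
apply/matrixP => i j.
have := dA (basis_vec C i) (basis_vec C j).
rewrite dot_mulmx !dot_basis mulmxA /basis_vec -colE [LHS]mxE => ->.
by rewrite !mxE eqxx andbT.
Qed.

End OrthogonalImage.

Lemma regular_on_conj (C : numClosedFieldType) N n m (S : set 'M[C]_N) (f : 'M[C]_N -> 'M[C]_n)
    (A : 'M_(m, n)) (B : 'M_(n, m)) :
  regular_on S f -> regular_on S (fun g => A *m f g *m B).
Proof.
move=> reg i j.
have /choice[p hp] : forall kl : 'I_n * 'I_n, exists p : {mpoly C[N * N]},
    forall g, S g -> f g kl.1 kl.2 = p.@[fun k => mxvec g 0 k] by move=> kl; apply: reg.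
exists (\sum_l \sum_k (A i k * B l j) *: p (k, l)) => g Sg.
rewrite raddf_sum mxE; apply: eq_bigr => l _; rewrite raddf_sum mxE mulr_suml.
by apply: eq_bigr => k _; rewrite /= mevalZ -(hp (k, l)) // mulrAC.
Qed.

Section Normalization.

Variable C : numClosedFieldType.

(** P^T P and B are both invariant, so P^T P = c B by Schur's lemma. Rescaling P makes c = 1 without
    changing P h P^-1. Then diag (P, 1) and Q have the same Gram matrix, so they differ by an
    orthogonal matrix O on the left, and a lift x of O up to sign conjugates the embedding. *)
Lemma spin7_normal_form (phi : 'M[C]_(spindim 3) -> 'M[C]_(spindim 4)) :
  spin7_embedding phi -> exists2 x, @spin C 4 x &
  let phi0 h := invmx x *m phi h *m x in
  [/\ alg_morphism (@spin C 3) phi0, forall h, @spin C 3 h -> @spin C 4 (phi0 h)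
    & forall h, @spin C 3 h -> so_image (phi0 h) (Qmx C *m extend_mx 1 h *m invmx (Qmx C))].
Proof.
move=> [[phi1 phiM phi_reg] phi_spin [P Pu hP]].
have [B [Bu hB QB]] := spin_form C.
have [S SE] : exists S, S = P^T *m P by exists (P^T *m P).
have PSP h : spin h -> h^T *m S *m h = S.
  rewrite SE => sh; have o := so_image_orthogonal (spin_unitmx (phi_spin _ sh)) (hP _ sh).
  have {o} : (P *m h *m invmx P)^T *m (P *m h *m invmx P) = 1%:M.
    have : (extend_mx 1 (P *m h *m invmx P))^T *m extend_mx 1 (P *m h *m invmx P) = 1%:M.
      exact: o.
    have -> : (extend_mx 1 (P *m h *m invmx P))^T = extend_mx 1 (P *m h *m invmx P)^T.
      by rewrite /extend_mx (@tr_block_mx _ (spindim 3) 1 (spindim 3) 1) !trmx0 tr_scalar_mx.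
    rewrite -extend_mxM mulr1 -(extend_mx1 C).
    by move/(@eq_block_mx _ (spindim 3) 1 (spindim 3) 1); case.
  rewrite !trmx_mul => /(congr1 (fun Z => P^T *m Z *m P)).
  by rewrite mulmx1 !mulmxA -trmx_mul mulVmx // trmx1 mul1mx mulmxKV.
have Su : S \in unitmx by rewrite SE unitmx_mul unitmx_tr Pu.
have [c Sc] : exists c, invmx B *m S = c%:M.
  apply: spin3_commutant => h sh; apply: (can_inj (mulKmx Bu)); rewrite !mulmxA mulmxV // mul1mx.
  have eB := spin3_preserves_form hB sh; have eS := PSP h sh.
  have hu := spin_unitmx sh.
  have hTu : h^T \in unitmx by rewrite unitmx_tr.
  by apply: (can_inj (mulKmx hTu)); rewrite !mulmxA eB mulmxV // mul1mx eS.
have SB : S = c *: B by rewrite -mul_mx_scalar -Sc mulKVmx.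
have c0 : c != 0.
  apply: contraTneq Su => cz; by rewrite SB cz scale0r unitmxE det0 unitr0.
pose a := sqrtC c^-1; have a2 : a * a * c = 1 by rewrite -expr2 sqrtCK mulVf.
have a0 : a != 0 by rewrite sqrtC_eq0 invr_eq0.
pose D := extend_mx 1 (a *: P); pose O := D *m invmx (Qmx C).
have aPu : a *: P \in unitmx by rewrite unitmxZ ?unitfE.
have DD : D^T *m D = (Qmx C)^T *m Qmx C.
  have -> : D^T = extend_mx 1 (a *: P^T).
    by rewrite /D /extend_mx (@tr_block_mx _ (spindim 3) 1 (spindim 3) 1) !trmx0 tr_scalar_mx linearZ.
  by rewrite QB -extend_mxM mulr1 -scalemxAl -scalemxAr -SE SB !scalerA a2 scale1r.
have Qu := Qmx_unit C.
have OO : orthogonal_mx O.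
  rewrite /orthogonal_mx trmx_mul mulmxA -(mulmxA _ D^T) DD mulmxA -trmx_mul.
  by rewrite mulmxV // trmx1 mul1mx mulmxV.
have [x [e [sx e2 hx]]] := spin_lift OO.
have xu := spin_unitmx sx.
have e0 : e != 0 by apply: contra_eq_neq e2 => ->; rewrite expr0n eq_sym oner_eq0.
exists x => //; split.
- split; first by rewrite phi1 mulmx1 mulVmx.
    by move=> g h sg sh; rewrite phiM // !mulmxA mulmxK.
  exact: regular_on_conj.
- by move=> h sh; apply/spinM => //; apply/spinM; [apply: spin_invmx|apply: phi_spin].
move=> h sh v.
have pu := spin_unitmx (phi_spin _ sh).
have -> : invmx (invmx x *m phi h *m x) = invmx x *m invmx (phi h) *m x.
  apply: (can_inj (mulmxK (_ : invmx x *m phi h *m x \in unitmx))).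
    by rewrite !unitmx_mul unitmx_inv xu pu.
  rewrite mulVmx ?unitmx_mul ?unitmx_inv ?xu ?pu // !mulmxA mulmxK //.
  by rewrite mulmxKV // mulVmx.
have -> : invmx x *m phi h *m x *m cliff v *m (invmx x *m invmx (phi h) *m x) =
    invmx x *m (phi h *m (x *m cliff v *m invmx x) *m invmx (phi h)) *m x.
  by rewrite !mulmxA.
rewrite hx -scalemxAr -scalemxAl hP // -/(extend_mx 1 _).
set A := extend_mx 1 _; have AO : A *m O = O *m (Qmx C *m extend_mx 1 h *m invmx (Qmx C)).
  rewrite /O !mulmxA; congr (_ *m _); rewrite mulmxKV // -!extend_mxM mulr1.
  by congr (extend_mx _ _); rewrite -scalemxAr -scalemxAl mulmxKV.
(* The sign [e] from the first use of [hx] is consumed by its second use, backwards and at v'. *)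
rewrite (mulmxA A O v) AO -(mulmxA O); set v' := Qmx C *m _ *m _ *m v.
by rewrite -mulmxA -hx mulmxKV // mulKmx.
Qed.

End Normalization.

(** * Equivariant projections *)

Section Star.

Variable C : numClosedFieldType.

Definition star m n (A : 'M[C]_(m, n)) : 'M[C]_(n, m) := map_mx Num.conj A^T.

Lemma starM m n p (A : 'M_(m, n)) (B : 'M_(n, p)) : star (A *m B) = star B *m star A.
Proof. by rewrite /star trmx_mul map_mxM. Qed.

Lemma starK m n (A : 'M_(m, n)) : star (star A) = A.
Proof. by apply/matrixP => i j; rewrite !mxE conjCK. Qed.

Lemma starD m n (A B : 'M_(m, n)) : star (A + B) = star A + star B.
Proof. by apply/matrixP => i j; rewrite !mxE rmorphD. Qed.

Lemma starN m n (A : 'M_(m, n)) : star (- A) = - star A.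
Proof. by apply/matrixP => i j; rewrite !mxE rmorphN. Qed.

Lemma starZ m n c (A : 'M_(m, n)) : star (c *: A) = c^* *: star A.
Proof. by apply/matrixP => i j; rewrite !mxE rmorphM. Qed.

Lemma star_scalar n c : star (c%:M : 'M_n) = (c^*)%:M.
Proof. by rewrite /star tr_scalar_mx map_scalar_mx. Qed.

Lemma star0 m n : star (0 : 'M_(m, n)) = 0.
Proof. by apply/matrixP => i j; rewrite !mxE rmorph0. Qed.

Lemma star_inv n (A : 'M_n) : star (invmx A) = invmx (star A).
Proof. by rewrite /star trmx_inv map_invmx. Qed.

Lemma star_self_eq0 n (x : 'cV_n) : star x *m x = 0 -> x = 0.
Proof.
move/matrixP/(_ 0 0); rewrite !mxE => /eqP; rewrite psumr_eq0 => [/allP h|i _]; last first.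
  by rewrite !mxE mulrC mul_conjC_ge0.
apply/matrixP => i j; have := h i (mem_index_enum _).
by rewrite (ord1 j) !mxE mulrC mul_conjC_eq0 => /eqP.
Qed.

Lemma gram_unit n r (Q : 'M_(n, r)) : (forall x : 'cV_r, Q *m x = 0 -> x = 0) ->
  star Q *m Q \in unitmx.
Proof.
move=> Qinj; rewrite unitmxE unitfE; apply/det0P => -[v v0 e].
have : star v = 0.
  by apply/Qinj/star_self_eq0; rewrite starM starK mulmxA -(mulmxA v) e mul0mx.
by move/(congr1 (@star _ _)); rewrite starK star0 => /eqP; rewrite (negPf v0).
Qed.

End Star.

Lemma idempotent_factor (C : fieldType) n (P : 'M[C]_n) : P *m P = P ->
  exists m (A : 'M_(m, n)) (B : 'M_(n, m)), [/\ \rank P = m, A *m B = 1%:M & B *m A = P].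
Proof.
move=> PP; exists (\rank P), (row_base P), (col_base P); split=> //; last exact: mulmx_base.
have /row_freeP[R AR] : row_free (row_base P) by apply: row_base_free.
have /row_fullP[L LB] := col_base_full P.
move: (col_base P) (row_base P) (mulmx_base P) L LB R AR PP => B A BA L LB R AR.
rewrite -{1 2 3}BA => /(congr1 (fun X => L *m X *m R)).
by rewrite !mulmxA LB mul1mx -!mulmxA AR !mulmx1.
Qed.

Section IrreducibleSummand.

Variables (C : numClosedFieldType) (N n : nat) (S : set 'M[C]_N) (f : 'M[C]_N -> 'M[C]_n).
Hypothesis f_morph : alg_morphism S f.
(** The scalar [c] is there for restrictions along phi: star (phi h) equals phi (star h) only up to
    a scalar. *)
Hypothesis f_star : forall g, S g -> exists h c, [/\ S h, c != 0 & star (f g) = c *: f h].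

Definition equivariant_projection (P : 'M_n) : Prop :=
  [/\ P *m P = P, star P = P & forall g, S g -> P *m f g = f g *m P].

(** P = Q (star Q * Q)^-1 star Q is the orthogonal projection onto the column space of Q. Invariance
    gives f P = P f P on [S]; the star of this relation for the partner h of g gives P f g = P f g
    P. *)
Lemma projection_onto_invariant r (Q : 'M_(n, r)) :
  (forall x : 'cV_r, Q *m x = 0 -> x = 0) ->
  (forall g, S g -> exists Y, f g *m Q = Q *m Y) ->
  exists P, [/\ equivariant_projection P, P *m Q = Q & exists Z, P = Q *m Z].
Proof.
move=> Qinj Qinv; have G := gram_unit Qinj.
pose Z := invmx (star Q *m Q) *m star Q; pose P := Q *m Z.
have PQ : P *m Q = Q by rewrite /P /Z -!mulmxA mulVmx // mulmx1.
have PP : P *m P = P by rewrite {2}/P mulmxA PQ.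
have sP : star P = P.
  by rewrite /P /Z !starM star_inv starM starK mulmxA.
have inv g : S g -> f g *m P = P *m f g *m P.
  move=> Sg; have [Y e] := Qinv g Sg.
  have fP : f g *m P = Q *m Y *m Z by rewrite /P mulmxA e.
  by rewrite -mulmxA fP !mulmxA PQ.
exists P; split=> //; last by exists Z.
split=> // g Sg; have [h [c [Sh c0 e]]] := f_star Sg.
rewrite (inv g Sg); have := congr1 (@star C n n) (inv h Sh).
have -> : f h = c^-1 *: star (f g) by rewrite e scalerA mulVf // scale1r.
rewrite -scalemxAl -scalemxAr -scalemxAl !starZ (starM (star (f g)) P).
rewrite (starM (P *m star (f g)) P) (starM P (star (f g))) starK sP mulmxA => /scalerI.
by apply; rewrite conjC_eq0 invr_eq0.
Qed.

Lemma compression_morphism m (A : 'M_(m, n)) (B : 'M_(n, m)) :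
  A *m B = 1%:M -> (forall g, S g -> B *m A *m f g = f g *m (B *m A)) ->
  alg_morphism S (fun g => A *m f g *m B).
Proof.
have [f1 fM f_reg] := f_morph; move=> AB BA; split.
- by rewrite f1 mulmx1.
- move=> g h Sg Sh; rewrite fM // -!mulmxA (mulmxA B A) (mulmxA (B *m A)) BA // !mulmxA.
  by rewrite -(mulmxA _ A B) AB mulmx1.
exact: regular_on_conj.
Qed.

(** Descent on the rank. If the image of P is reducible, a proper nonzero invariant subspace yields
    equivariant projections P' and P - P' of smaller rank, and xi P' w and xi (P - P') w cannot both
    vanish. *)
Lemma irreducible_summand (xi : 'rV_n) (w : 'cV_n) : xi *m w != 0 ->
  exists m (A : 'M_(m, n)) (B : 'M_(n, m)),
  [/\ A *m B = 1%:M /\ star (B *m A) = B *m A,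
    forall g, S g -> B *m A *m f g = f g *m (B *m A), xi *m (B *m A) *m w != 0
    & irreducible_rep S (fun g => A *m f g *m B)].
Proof.
move=> xw.
suff gen d (P : 'M_n) : (\rank P <= d)%N -> equivariant_projection P -> xi *m P *m w != 0 ->
    exists m (A : 'M_(m, n)) (B : 'M_(n, m)),
    [/\ A *m B = 1%:M /\ star (B *m A) = B *m A,
    forall g, S g -> B *m A *m f g = f g *m (B *m A), xi *m (B *m A) *m w != 0
    & irreducible_rep S (fun g => A *m f g *m B)].
  apply: (gen n 1%:M) => //; first by rewrite rank_leq_row.
    split; rewrite ?mulmx1 ?star_scalar ?rmorph1 // => g _.
    by rewrite mul1mx mulmx1.
  by rewrite mulmx1.
elim: d P => [|d IH] P rP [PP sP Pf] xPw.
  move: rP; rewrite leqn0 mxrank_eq0 => /eqP P0.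
  by rewrite P0 mulmx0 mul0mx eqxx in xPw.
have [m [A [B [rm AB BA]]]] := idempotent_factor PP.
have [irr|nirr] := pselect (irreducible_rep S (fun g => A *m f g *m B)).
  by exists m, A, B; rewrite BA.
have [U [Uinv U0 Uf]] : exists U : {vspace 'cV[C]_m},
    [/\ forall g v, S g -> v \in U -> A *m f g *m B *m v \in U, U <> 0%VS & U <> fullv].
  apply: contrapT => no; apply: nirr; split.
  - by apply: compression_morphism => //; rewrite BA.
  - by rewrite lt0n -rm mxrank_eq0; apply: contraNneq xPw => ->; rewrite mulmx0 mul0mx.
  move=> U Uinv; have [->|U0] := eqVneq U 0%VS; first by left.
  have [->|Uf] := eqVneq U fullv; first by right.
  by case: no; exists U; split=> //; apply/eqP.
pose b := vbasis U; pose K : 'M_(m, \dim U) := \matrix_(i, j) b`_j i 0.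
have Kx (x : 'cV_(\dim U)) : K *m x = \sum_j x j 0 *: b`_j.
  apply/matrixP => i j; rewrite (ord1 j) mxE summxE; apply: eq_bigr => l _.
  by rewrite !mxE mulrC.
have Kin j : b`_j \in U.
  by have [h|h] := ltnP j (\dim U); [apply/vbasis_mem/mem_nth; rewrite size_tuple
    |rewrite nth_default ?mem0v // size_tuple].
pose Q := B *m K.
have Qinj (x : 'cV_(\dim U)) : Q *m x = 0 -> x = 0.
  move=> e; have : K *m x = 0.
    by rewrite -[K *m x]mul1mx -AB -(mulmxA A) (mulmxA B) e mulmx0.
  rewrite Kx => e'; have /freeP/(_ (fun j => x j 0) e') h := basis_free (vbasisP U).
  by apply/matrixP => i j; rewrite (ord1 j) h mxE.
have Qinv g : S g -> exists Y, f g *m Q = Q *m Y.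
  move=> Sg; exists (\matrix_(i, j) coord b i (A *m f g *m B *m b`_j)).
  have e : A *m f g *m B *m K = K *m \matrix_(i, j) coord b i (A *m f g *m B *m b`_j).
    apply/matrixP => i j.
    have := coord_vbasis (Uinv g b`_j Sg (Kin j)) => /(congr1 (fun u : 'cV_m => u i 0)).
    rewrite summxE => h; rewrite [LHS](_ : _ = (A *m f g *m B *m b`_j) i 0).
      by rewrite h [RHS]mxE; apply: eq_bigr => l _; rewrite !mxE mulrC.
    by rewrite !mxE; apply: eq_bigr => l _; rewrite !mxE.
  by rewrite /Q -(mulmxA B) -e !mulmxA BA Pf // -BA !mulmxA -(mulmxA _ A) AB mulmx1.
have [P' [[PP' sP' Pf'] PQ [Z P'Z]]] := projection_onto_invariant Qinj Qinv.
have P'P : P *m P' = P' by rewrite P'Z /Q -BA !mulmxA -(mulmxA _ A) AB mulmx1.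
have PP'' : P' *m P = P' by rewrite -sP' -{1}sP -starM P'P.
have dU : (\dim U < m)%N.
  rewrite ltn_neqAle -[X in _ && (_ <= X)%N](_ : \dim (fullv : {vspace 'cV[C]_m}) = m).
    rewrite dimvS ?subvf // andbT; apply/eqP => e; apply: Uf; apply/eqP.
    by rewrite eqEdim subvf e dimvf /dim /= muln1 leqnn.
  by rewrite dimvf /dim /= muln1.
have r1 : (\rank P' <= d)%N.
  rewrite -ltnS; apply: leq_trans rP; rewrite rm; apply: leq_ltn_trans dU; rewrite P'Z.
  by apply: leq_trans (mxrankM_maxl _ _) _; apply: rank_leq_col.
have r2 : (\rank (P - P')%R <= d)%N.
  rewrite -ltnS; apply: leq_trans rP; rewrite ltnNge; apply/negP => le.
  have sub : ((P - P')%R <= P)%MS.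
    by apply/submxP; exists (1%:M - P'); rewrite mulmxBl mul1mx PP''.
  have /eqmxP eq : ((P - P')%R == P)%MS.
    by rewrite -(geq_leqif (mxrank_leqif_eq sub)).
  have /submxP[X e] : (P <= (P - P')%R)%MS by rewrite eq.
  have P'0 : P' = 0.
    by rewrite -P'P {1}e -mulmxA mulmxBl PP' P'P subrr mulmx0.
  apply: U0; apply/eqP; rewrite -dimv_eq0 -leqn0 leqNgt; apply/negP => U0.
  have Q0 : Q = 0 by rewrite -PQ P'0 mul0mx.
  have := Qinj (const_mx 1); rewrite Q0 mul0mx => /(_ erefl)/matrixP/(_ (Ordinal U0) 0).
  by rewrite !mxE => /eqP; rewrite oner_eq0.
have [z|nz] := eqVneq (xi *m P' *m w) 0; last first.
  by apply: (IH P') => //.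
apply: (IH (P - P')) => //; last by rewrite mulmxBr mulmxBl z subr0.
split.
- by rewrite mulmxBl !mulmxBr PP P'P PP'' PP' subrr subr0.
- by rewrite starD starN sP sP'.
by move=> g Sg; rewrite mulmxBl mulmxBr Pf // Pf'.
Qed.

End IrreducibleSummand.

(** * Tensor products and unitary models *)

Section TensorVectors.

Variables (C : numClosedFieldType) (m n : nat).

(** Tensors are written as matrices, with x1 x2^T for the tensor of x1 and x2. The action of A (x) B
    becomes M |-> A M B^T, and the Hermitian product becomes the trace of star M * M'. *)
Definition vec (M : 'M[C]_(m, n)) : 'cV[C]_(m * n) :=
  \col_i M (mxtens_unindex i).1 (mxtens_unindex i).2.

Lemma sum_tensor_index (F : 'I_(m * n) -> C) :
  \sum_k F k = \sum_i \sum_j F (mxtens_index (i, j)).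
Proof.
rewrite pair_bigA /= (reindex (@mxtens_index m n)) /=; last first.
  by exists (@mxtens_unindex m n) => i _; rewrite (mxtens_indexK, mxtens_unindexK).
by apply: eq_bigr => -[].
Qed.

Lemma tens_vec (A : 'M_m) (B : 'M_n) M : (A *t B) *m vec M = vec (A *m M *m B^T).
Proof.
apply/matrixP => i j; rewrite (ord1 j) !mxE sum_tensor_index.
rewrite exchange_big /=; apply: eq_bigr => l _; rewrite !mxE mulr_suml.
by apply: eq_bigr => k _; rewrite !mxE mxtens_indexK /= mulrAC.
Qed.

Lemma vecD M M' : vec (M + M') = vec M + vec M'.
Proof. by apply/matrixP => i j; rewrite !mxE. Qed.

Lemma vecZ c M : vec (c *: M) = c *: vec M.
Proof. by apply/matrixP => i j; rewrite !mxE. Qed.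

Lemma vec0 : vec 0 = 0.
Proof. by apply/matrixP => i j; rewrite !mxE. Qed.

Lemma star_vec M M' : star (vec M) *m vec M' = (\tr (star M *m M'))%:M.
Proof.
rewrite [LHS]mx11_scalar; congr (_%:M); rewrite mxE sum_tensor_index exchange_big /=.
apply: eq_bigr => j _; rewrite mxE; apply: eq_bigr => i _.
by rewrite !mxE mxtens_indexK.
Qed.

Lemma tens1 : (1%:M : 'M[C]_m) *t (1%:M : 'M[C]_n) = 1%:M.
Proof.
apply/matrixP => i j; rewrite !mxE -natrM mulnb -xpair_eqE -!surjective_pairing.
by rewrite (can_eq (@mxtens_unindexK m n)).
Qed.

Lemma star_tens (A : 'M[C]_m) (B : 'M[C]_n) : star (A *t B) = star A *t star B.
Proof. by apply/matrixP => i j; rewrite !mxE rmorphM. Qed.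

End TensorVectors.

Section TensorRepresentation.

Variables (C : numClosedFieldType) (l n1 n2 : nat).
Variables (f : 'M[C]_(spindim l) -> 'M[C]_n1) (g : 'M[C]_(spindim l) -> 'M[C]_n2).
Hypotheses (f_morph : alg_morphism (@spin C l) f) (g_morph : alg_morphism (@spin C l) g).

Lemma tens_morphism : alg_morphism (@spin C l) (fun x => f x *t g x).
Proof.
have [f1 fM f_reg] := f_morph; have [g1 gM g_reg] := g_morph; split.
- by rewrite f1 g1 tens1.
- by move=> x y sx sy; rewrite fM // gM // tensmx_mul.
move=> i j; have [p hp] := f_reg (mxtens_unindex i).1 (mxtens_unindex j).1.
have [r hr] := g_reg (mxtens_unindex i).2 (mxtens_unindex j).2.
by exists (p * r) => x sx; rewrite mxE mevalM hp // hr.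
Qed.

Variables (df : {linear 'M[C]_(spindim l) -> 'M[C]_n1})
  (dg : {linear 'M[C]_(spindim l) -> 'M[C]_n2})
  (D : {linear 'M[C]_(spindim l) -> 'M[C]_(n1 * n2)}).
Hypotheses (f_diff : is_diff (@spin C l) f df) (g_diff : is_diff (@spin C l) g dg)
  (D_diff : is_diff (@spin C l) (fun x => f x *t g x) D).

Lemma diff_tens X M : so_lie X ->
  D X *m vec M = vec (df X *m M + M *m (dg X)^T).
Proof.
elim=> {X} [X sX|X Y _ IX _ IY|c X _ IX]; last 2 first.
- rewrite (linearD D) (linearD df) (linearD dg) mulmxDl IX IY -vecD; congr (vec _).
  by rewrite linearD /= mulmxDl mulmxDr addrACA.
- rewrite (linearZZ D) (linearZZ df) (linearZZ dg) -scalemxAl IX -vecZ; congr (vec _).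
  by rewrite linearZ /= -scalemxAl -scalemxAr scalerDr.
have uX := siegel_unipotent sX.
have c1 := mcurve_mulr (vec M) (rep_curve tens_morphism D_diff uX).
have cf := rep_curve f_morph f_diff uX; have cg := rep_curve g_morph g_diff uX.
have cgT : mcurve 1 0 (fun t => (g (1%:M + t *: X))^T) 1%:M^T (dg X)^T.
  by move=> i j; have := cg j i; rewrite !mxE; apply: dcurve_ext => z _; rewrite mxE.
have c2 := mcurve_mul (mcurve_mulr M cf) cgT.
have c3 : mcurve 1 0 (fun t => (f (1%:M + t *: X) *t g (1%:M + t *: X)) *m vec M)
    (1%:M *m vec M) (vec (df X *m M + M *m (dg X)^T)).
  move=> i j; have := c2 (mxtens_unindex i).1 (mxtens_unindex i).2.
  rewrite !trmx1 !mulmx1 !mul1mx [vec _ i j]mxE [vec _ i j]mxE.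
  by apply: dcurve_ext => z _; rewrite tens_vec [RHS]mxE.
exact: (mcurve_uniq (one_horner_neq0 (0 : C)) c1 c3).
Qed.

End TensorRepresentation.

Section SpinStar.

Variables (C : numClosedFieldType) (l : nat).

Lemma gamma_star k : (k <= l.*2)%N -> star (gamma C l k) = gamma C l k.
Proof.
elim: l k => [|l' IH] [|[|k]] //=; rewrite ?doubleS ?ltnS => kl.
- by rewrite star_scalar rmorph1.
- rewrite /star (@tr_block_mx _ (spindim l') (spindim l') (spindim l') (spindim l')) map_block_mx.
  by rewrite !trmx0 !tr_scalar_mx map_mx0 map_scalar_mx rmorph1.
- rewrite /star (@tr_block_mx _ (spindim l') (spindim l') (spindim l') (spindim l')) map_block_mx.
  by rewrite !trmx0 !tr_scalar_mx map_mx0 !map_scalar_mx rmorphN /= conjCi opprK.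
rewrite /star (@tr_block_mx _ (spindim l') (spindim l') (spindim l') (spindim l')) map_block_mx.
by rewrite !trmx0 map_mx0 linearN map_mxN -/(star _) IH.
Qed.

Lemma cliff_star (v : 'cV[C]_(l.*2.+1)) : star (cliff v) = cliff (map_mx Num.conj v).
Proof.
rewrite /cliff; elim/big_rec2: _ => [|i y1 y2 _ e]; first by rewrite star0.
by rewrite starD starZ e gamma_star -1?ltnS // mxE.
Qed.

(** The gammas are Hermitian, so the star reverses a product and conjugates the coordinates of its
    vectors. *)
Lemma spin_star (g : 'M[C]_(spindim l)) : spin g -> spin (star g).
Proof.
case=> s [os us ->]; exists (map (map_mx Num.conj) (rev s)); split.
- by rewrite size_map size_rev.
- move=> v /mapP[u]; rewrite mem_rev => /us uu ->.
  have := congr1 Num.conj uu; rewrite rmorph_sum rmorph1 => e.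
  by rewrite /unit_vector -[RHS]e; apply: eq_bigr => i _; rewrite mxE rmorphXn.
elim: s {os us} => [|v s IH]; first by rewrite !big_nil star_scalar rmorph1.
by rewrite big_cons rev_cons map_rcons -cats1 big_cat big_seq1 -!mulmxE starM IH cliff_star.
Qed.

End SpinStar.

Section Models.

Variable C : numClosedFieldType.

Lemma so_lie_form (B X : 'M[C]_(spindim 3)) :
  (forall k, (k <= 6)%N -> (gamma C 3 k)^T *m B = - (B *m gamma C 3 k)) ->
  so_lie X -> X^T *m B = - (B *m X).
Proof.
move=> hB; move: X; apply: (so_lie_gamma_ind (ltn0Sn 2)) => [a b ab|X Y IX IY|c X IX].
- have a6 : (a <= 6)%N by rewrite -ltnS.
  have b6 : (b <= 6)%N by rewrite -ltnS.
  rewrite trmx_mul -(mulmxA _ _ B) hB // mulmxN (mulmxA _ B) hB // mulNmx opprK -mulmxA.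
  rewrite -mulmxN; congr (_ *m _); apply/eqP; rewrite -addr_eq0 gamma_clifford //.
  by rewrite (val_eqE b a) (eq_sym b a) (negPf ab) mul0rn raddf0.
- by rewrite linearD /= mulmxDl mulmxDr IX IY opprD.
- by rewrite linearZ /= -scalemxAl -scalemxAr IX scalerN.
Qed.

(** X is skew for the form B, and B is a block of Q^T Q, so Q X Q^-1 is skew for the standard form.
    [Qstar] differs from the inverse of Q only by a block scalar matrix. *)
Lemma embed_lie_so (X : 'M[C]_(spindim 3)) : so_lie X -> so_lie (embed_lie X).
Proof.
move=> sX; apply/SoScale/so_of_lie => //.
have [B [Bu hB QB]] := spin_form C; have XB := so_lie_form hB sX.
have Qu := Qmx_unit C; have QTu : (Qmx C)^T \in unitmx by rewrite unitmx_tr.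
have extT c Y : (extend_mx c Y)^T = extend_mx c Y^T.
  by rewrite /extend_mx (@tr_block_mx _ (spindim 3) 1 (spindim 3) 1) !trmx0 tr_scalar_mx.
have Qs : Qstar C = extend_mx 1 2%:M *m invmx (Qmx C) by rewrite -Qstar_mul mulmxK.
rewrite Qs !mulmxA -[_ *m extend_mx 0 X *m _]mulmxA -extend_mxM mul0r.
rewrite !trmx_mul extT trmx_inv; apply: (can_inj (mulKmx QTu)); rewrite mulKVmx //.
apply: (can_inj (mulmxK Qu)); rewrite -(mulmxA _ _ (Qmx C)) QB.
rewrite mulmxN mulNmx !mulmxA mulmxKV // QB -!extend_mxM !mul0r mulr0.
rewrite trmx_mul tr_scalar_mx -mulmxA XB.
rewrite mul_mx_scalar mul_scalar_mx -scalemxAr scalerN.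
by rewrite -[RHS]scaleN1r -extend_mxZ mulr0 scaleN1r.
Qed.

(* a j is twice the j-th coordinate of the highest weight of v. *)
Definition model (a : nat -> nat) (k : nat) : Prop :=
  exists n (rho : 'M[C]_(spindim 4) -> 'M[C]_n) (drho : {linear 'M[C]_(spindim 4) -> 'M[C]_n})
    (v w : 'cV[C]_n),
  [/\ [/\ alg_morphism (@spin C 4) rho, is_diff (@spin C 4) rho drho,
          forall g, @spin C 4 g -> star (rho g) = rho (star g)
        & forall c, @spin C 4 c%:M -> exists d, rho c%:M = d%:M],
      (forall j, (j < 4)%N -> drho (torus_lie C 4 j) *m v = (a j)%:R *: v) /\
      (forall X, pos_root X -> drho X *m v = 0),
      (forall j, (j < 3)%N -> drho (embed_lie (torus_lie C 3 j)) *m w =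
        (if j == 0 then k%:R *+ 2 else 0) *: w) /\
      (forall X, pos_root X -> drho (embed_lie X) *m w = 0)
    & star w *m v != 0].

(** The pairing of two tensors of vectors is the product of the pairings, which keeps it nonzero. *)
Lemma model_add a b k l : model a k -> model b l -> model (fun j => a j + b j)%N (k + l).
Proof.
case=> n1 [f [df [v1 [w1 [[f1 f2 f3 f4] [tv1 pv1] [tw1 pw1] vw1]]]]].
case=> n2 [g [dg [v2 [w2 [[g1 g2 g3 g4] [tv2 pv2] [tw2 pw2] vw2]]]]].
have fg := tens_morphism f1 g1; have [D hD] := regular_diff (let: And3 _ _ h := fg in h).
have act X (x1 : 'cV_n1) (x2 : 'cV_n2) c1 c2 : so_lie X ->
    df X *m x1 = c1 *: x1 -> dg X *m x2 = c2 *: x2 ->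
    D X *m vec (x1 *m x2^T) = (c1 + c2) *: vec (x1 *m x2^T).
  move=> sX e1 e2; rewrite (diff_tens f1 g1 f2 g2 hD _ sX) -vecZ; congr (vec _).
  by rewrite mulmxA e1 -mulmxA -trmx_mul e2 linearZ /= -scalemxAl -scalemxAr scalerDl.
have kill X (x1 : 'cV_n1) (x2 : 'cV_n2) : so_lie X ->
    df X *m x1 = 0 -> dg X *m x2 = 0 -> D X *m vec (x1 *m x2^T) = 0.
  move=> sX e1 e2; rewrite (act X x1 x2 0 0) ?scale0r //.
  by rewrite addr0 scale0r.
exists _, (fun x => f x *t g x), D, (vec (v1 *m v2^T)), (vec (w1 *m w2^T)); split.
- split=> // [x sx|c sc]; first by rewrite star_tens f3 // g3.
  have [d ->] := f4 c sc; have [d' ->] := g4 c sc; exists (d * d').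
  by rewrite -[d%:M]scalemx1 -[d'%:M]scalemx1 -[(d * d')%:M]scalemx1 -tens1;
    apply/matrixP => i j; rewrite !mxE mulrACA.
- split=> [j jl|X pX]; first by rewrite natrD; apply: act; [exact: torus_lie_so|exact: tv1|exact: tv2].
  apply: kill; [|exact: pv1|exact: pv2].
  by have [] := pos_root_unipotent (ltn0Sn 3) pX.
- split=> [j jl|X pX].
    have sj := embed_lie_so (torus_lie_so C (ltn0Sn 2) jl).
    rewrite (act _ _ _ _ _ sj (tw1 j jl) (tw2 j jl)); congr (_ *: _).
    by case: (j == 0); rewrite ?addr0 // natrD mulrnDl.
  have [sX _ _] := pos_root_unipotent (ltn0Sn 2) pX.
  by apply: kill; [exact: embed_lie_so|exact: pw1|exact: pw2].
have x11 n (x y : 'cV[C]_n) : star x *m y != 0 -> exists2 c, c != 0 & star x *m y = c%:M.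
  move=> xy; exists ((star x *m y) 0 0); last exact: mx11_scalar.
  by apply: contraNneq xy => e; rewrite [star x *m y]mx11_scalar e raddf0.
have [c1 c10 e1] := x11 _ _ _ vw1; have [c2 c20 e2] := x11 _ _ _ vw2.
rewrite star_vec starM -mulmxA (mulmxA (star w1)) e1 mul_scalar_mx -scalemxAr linearZ /=.
rewrite mxtrace_mulC (_ : v2^T *m star w2^T = (star w2 *m v2)^T); last first.
  by rewrite trmx_mul /star map_trmx !trmxK.
rewrite e2 tr_scalar_mx mxtrace_scalar mulr1n; apply/negP => /eqP/matrixP/(_ 0 0).
by rewrite !mxE mulr1n => /eqP; rewrite mulf_eq0 (negPf c10) (negPf c20).
Qed.

Lemma model0 : model (fun _ => 0%N) 0.
Proof.
have mo : alg_morphism (@spin C 4) (fun _ => 1%:M : 'M[C]_1).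
  split=> // [g h _ _|i j]; first by rewrite mulmx1.
  exists (mpolyC _ ((1%:M : 'M[C]_1) i j)) => g _.
  by rewrite mevalC.
have [D hD] := regular_diff (let: And3 _ _ h := mo in h).
have D0 X : so_lie X -> D X = 0.
  elim=> {X} [X sX|X Y _ IX _ IY|c X _ IX]; last 2 first.
  - by rewrite (linearD D) IX IY addr0.
  - by rewrite (linearZZ D) IX scaler0.
  have c1 := rep_curve mo hD (siegel_unipotent sX).
  exact: (mcurve_uniq (one_horner_neq0 (0 : C)) c1 (mcurve_const _ _ _)).
exists 1%N, (fun _ => 1%:M), D, 1%:M, 1%:M; split.
- split=> // [g _|c _]; first by rewrite star_scalar rmorph1.
  by exists 1.
- split=> [j jl|X pX].
    by rewrite D0 ?mul0mx ?scale0r //; apply: torus_lie_so.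
  by rewrite D0 ?mul0mx //; have [] := pos_root_unipotent (ltn0Sn 3) pX.
- split=> [j jl|X pX].
    rewrite D0 ?mul0mx; first by case: (j == 0); rewrite ?mul0rn scale0r.
    exact/embed_lie_so/torus_lie_so.
  rewrite D0 ?mul0mx //; apply: embed_lie_so.
  by have [] := pos_root_unipotent (ltn0Sn 2) pX.
by rewrite star_scalar rmorph1 mulmx1 oner_neq0.
Qed.

Lemma model_muln a k m : model a k -> model (fun j => m * a j)%N (m * k).
Proof. by move=> h; elim: m => [|m IH]; [exact: model0|exact: model_add h IH]. Qed.

End Models.

Section HighestWeightGroup.

Variables (C : numClosedFieldType) (l' n : nat).
Notation l := l'.+1.
Variables (f : 'M[C]_(spindim l) -> 'M[C]_n) (df : {linear 'M[C]_(spindim l) -> 'M[C]_n}).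
Hypotheses (f_morph : alg_morphism (@spin C l) f) (f_diff : is_diff (@spin C l) f df).

Lemma highest_weight_compression m (A : 'M_(m, n)) (B : 'M_(n, m)) (lam : 'rV[rat]_l) (v : 'cV_n) :
  A *m B = 1%:M -> (forall g, spin g -> B *m A *m f g = f g *m (B *m A)) ->
  (forall j, (j < l)%N -> df (torus_lie C l j) *m v = (numq (2 * lam 0 (inord j)))%:~R *: v) ->
  (forall X, pos_root X -> df X *m v = 0) -> A *m v != 0 ->
  highest_weight (fun g => A *m f g *m B) lam.
Proof.
move=> AB BA tv pv Av.
have act g : spin g -> A *m f g *m B *m (A *m v) = A *m (f g *m v).
  move=> sg; rewrite -!mulmxA (mulmxA B A) (mulmxA (f g)) -BA // !mulmxA.
  by rewrite AB mul1mx.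
exists (A *m v); split=> // [j z z0|u].
  rewrite act; last exact: torus_spin.
  have := tv j (ltn_ord j); rewrite inord_val => /(torus_weightP (ltn_ord j) f_morph f_diff) -> //.
  by rewrite -scalemxAr.
move=> /pos_root_eltE[X pX [t ->]].
have uX := pos_root_unipotent (ltn0Sn l') pX; have [_ _ hX] := uX.
by rewrite act // (rep_fixP f_morph f_diff v uX).2 // pv.
Qed.

End HighestWeightGroup.

(** * The embedding and conjugate transposition *)

Section StarEmbedding.

Variables (C : numClosedFieldType) (phi : 'M[C]_(spindim 3) -> 'M[C]_(spindim 4)).
Hypotheses (phi_morph : alg_morphism (@spin C 3) phi)
  (phi_spin : forall h, @spin C 3 h -> @spin C 4 (phi h))
  (phi_image : forall h, @spin C 3 h ->
     so_image (phi h) (Qmx C *m extend_mx 1 h *m invmx (Qmx C))).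

Lemma so_image_star l (g : 'M[C]_(spindim l)) A : spin g -> so_image g A -> so_image (star g) (star A).
Proof.
move=> sg gA u.
have gu := spin_unitmx sg; have sgu := spin_unitmx (spin_star sg).
have cK : map_mx Num.conj (map_mx Num.conj u) = u by apply/matrixP => i j; rewrite !mxE conjCK.
have oA : A *m A^T = 1%:M by apply: mulmx1C; apply: so_image_orthogonal gu gA.
have cA : map_mx Num.conj (A *m (A^T *m map_mx Num.conj u)) = u.
  by rewrite mulmxA oA mul1mx.
have := congr1 (@star C _ _) (gA (A^T *m map_mx Num.conj u)).
rewrite !starM !cliff_star cA map_mxM cK star_inv => e.
rewrite -{1}e !mulmxA mulmxV // mul1mx mulmxK //.
Qed.

(** The kernel of the double cover consists of scalars: h^-1 g commutes with all vectors. *)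
Lemma same_image l (g h : 'M[C]_(spindim l)) A : spin g -> spin h -> so_image g A -> so_image h A ->
  exists c, @spin C l c%:M /\ g = h *m c%:M.
Proof.
move=> sg sh gA hA; have gu := spin_unitmx sg; have hu := spin_unitmx sh.
have [c e] : exists c, invmx h *m g = c%:M.
  apply: clifford_commutant => k kl.
  have -> : gamma C l k = cliff (basis_vec C (Ordinal (kl : (k < l.*2.+1)%N))) by rewrite cliff_basis.
  set v := basis_vec _ _; have := gA v; rewrite -hA => e.
  have := congr1 (fun Z => invmx h *m Z *m g) e.
  by rewrite !mulmxA mulmxKV // mulVmx // mul1mx => ->.
exists c; rewrite -e; split; first by apply: spinM => //; apply: spin_invmx.
by rewrite mulKVmx.
Qed.

(** Because star Q * Q is block scalar, conjugation by Q commutes with the star. So star (phi h) and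
    phi (star h) induce the same map on vectors. *)
Lemma embed_star h : @spin C 3 h -> exists c, @spin C 4 c%:M /\ star (phi h) = phi (star h) *m c%:M.
Proof.
move=> sh; have sh' := spin_star sh.
apply: (same_image (A := Qmx C *m extend_mx 1 (star h) *m invmx (Qmx C))).
- exact/spin_star/phi_spin.
- exact: phi_spin.
- have := so_image_star (phi_spin sh) (phi_image sh); congr so_image.
  have Qu := Qmx_unit C.
  have extS (X : 'M[C]_(spindim 3)) : star (extend_mx 1 X) = extend_mx 1 (star X).
    rewrite /star /extend_mx (@tr_block_mx _ (spindim 3) 1 (spindim 3) 1).
    rewrite (@map_block_mx _ _ _ (spindim 3) 1 (spindim 3) 1).
    by rewrite !trmx0 !map_mx0 tr_scalar_mx map_scalar_mx rmorph1.
  rewrite invmx_Qmx; have -> : Qstar C = star (Qmx C) by [].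
  rewrite (starM (_ *m _)) (starM (extend_mx _ _)) (starM (Qmx C)) starK !extS star_scalar.
  have half : (2^-1 : C)^* = 2^-1 by rewrite fmorphV rmorph_nat.
  rewrite half -!mulmxA; congr (_ *m _).
  by rewrite !mulmxA -!extend_mxM scalar_mxC.
exact: phi_image.
Qed.

End StarEmbedding.

(** * Irreducible constituents joined by an intertwiner *)

Section Branching.

Variables (C : numClosedFieldType) (phi : 'M[C]_(spindim 3) -> 'M[C]_(spindim 4)).
Hypotheses (phi_morph : alg_morphism (@spin C 3) phi)
  (phi_spin : forall h, @spin C 3 h -> @spin C 4 (phi h))
  (phi_image : forall h, @spin C 3 h ->
     so_image (phi h) (Qmx C *m extend_mx 1 h *m invmx (Qmx C))).

Section Restriction.

Variables (n : nat) (f : 'M[C]_(spindim 4) -> 'M[C]_n).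
Hypothesis f_morph : alg_morphism (@spin C 4) f.

Lemma restriction_morphism : alg_morphism (@spin C 3) (fun h => f (phi h)).
Proof.
have [f1 fM f_reg] := f_morph; have [phi1 phiM phi_reg] := phi_morph; split.
- by rewrite phi1 f1.
- by move=> g h sg sh; rewrite phiM // fM //; apply: phi_spin.
move=> i j; have [p hp] := f_reg i j.
have /choice[q hq] : forall k, exists q : {mpoly C[spindim 3 * spindim 3]},
    forall g, spin g -> mxvec (phi g) 0 k = q.@[fun k => mxvec g 0 k].
  move=> k; case/mxvec_indexP: k => a b; have [q hq] := phi_reg a b.
  by exists q => g sg; rewrite mxvecE hq.
exists (p \mPo [tuple q k | k < _]) => g sg; rewrite comp_mpoly_meval hp; last exact: phi_spin.
by apply: meval_eq => k; rewrite tnth_mktuple hq.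
Qed.

Lemma restriction_diff (df : {linear 'M[C]_(spindim 4) -> 'M[C]_n})
    (dh : {linear 'M[C]_(spindim 3) -> 'M[C]_n}) X :
  is_diff (@spin C 4) f df -> is_diff (@spin C 3) (fun h => f (phi h)) dh -> so_lie X ->
  dh X = df (embed_lie X).
Proof.
move=> f_diff h_diff; have [_ _ phi_reg] := phi_morph; have [dphi phi_diff] := regular_diff phi_reg.
elim=> {X} [X sX|X Y _ IX _ IY|c X _ IX]; last 2 first.
- by rewrite embed_lieD (linearD df) (linearD dh) IX IY.
- by rewrite embed_lieZ (linearZZ df) (linearZZ dh) IX.
have uX := siegel_unipotent sX; have [sX' _ hX] := uX.
rewrite -(diff_embed phi_morph phi_spin phi_image phi_diff sX').
have c1 := rep_curve restriction_morphism h_diff uX.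
have c2 : mcurve 1 0 (fun t => f (phi (1%:M + t *: X))) (f 1%:M) (df (dphi X)).
  apply: f_diff; first exact: one_horner_neq0.
    by move=> t _; apply/phi_spin/hX.
  exact: rep_curve.
exact: (mcurve_uniq (one_horner_neq0 (0 : C)) c1 c2).
Qed.

End Restriction.

(** [B *m A] projects onto an irreducible constituent for Spin_9 and [B' *m A'] onto one for Spin_7,
    chosen so that star v (B A) (B' A') w is nonzero. Hence T = A B' is nonzero, and it intertwines
    because both projections are equivariant. The images of [v] and [w] provide the highest
    weights. *)
Theorem model_branching (lam : 'rV[rat]_4) a k : model C a k ->
  (forall j, (j < 4)%N -> numq (2 * lam 0 (inord j)) = (a j)%:Z) ->
  exists n p (V : 'M[C]_(spindim 4) -> 'M[C]_n) (W : 'M[C]_(spindim 3) -> 'M[C]_p) T,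
  [/\ irrep_of_hw lam V, irrep_of_hw (eps 0 *+ k) W, intertwiner phi V W T & T != 0].
Proof.
case=> n [f [df [v [w [[f1 f2 f3 f4] [tv pv] [tw pw] vw]]]]] lamE.
have f_star g : spin g -> exists h c, [/\ @spin C 4 h, c != 0 & star (f g) = c *: f h].
  move=> sg; exists (star g), 1; split; [exact: spin_star|exact: oner_neq0|].
  by rewrite scale1r f3.
have [n' [A [B [[AB sBA] BA vw' V_irr]]]] :=
  irreducible_summand f1 f_star vw.
pose fH h := f (phi h); have fH1 : alg_morphism (@spin C 3) fH := restriction_morphism f1.
have [dh hdh] := regular_diff (let: And3 _ _ h := fH1 in h).
have fH_star g : spin g -> exists h c, [/\ @spin C 3 h, c != 0 & star (fH g) = c *: fH h].
  move=> sg; have [c [sc e]] := embed_star phi_spin phi_image sg.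
  have [d fd] := f4 c sc; exists (star g), d; split; first exact: spin_star.
    apply: contraNneq vw => d0; suff -> : v = 0 by rewrite mulmx0.
    have [c' [sc' _ cc']] := spinV sc.
    have [f11 fM _] := f1.
    by rewrite -[v]mul1mx -f11 -cc' fM // fd d0 raddf0 mulmx0 mul0mx.
  have [_ fM _] := f1; have ps := phi_spin (spin_star sg).
  by rewrite /fH f3 ?e ?fM ?fd ?mul_mx_scalar //; apply: phi_spin.
have xi_w : star v *m (B *m A) *m w != 0.
  apply: contraNneq vw' => /(congr1 (@star C _ _)).
  by rewrite (starM _ w) (starM (star v)) starK star0 sBA mulmxA => ->.
have [p [A' [B' [[AB' _] BA' xw W_irr]]]] :=
  irreducible_summand fH1 fH_star xi_w.
exists n', p, (fun g => A *m f g *m B), (fun h => A' *m fH h *m B'), (A *m B'); split.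
- split=> //; apply: (highest_weight_compression f1 f2 AB BA _ pv).
    by move=> j jl; rewrite lamE // tv.
  by apply: contraNneq vw' => e; rewrite -!mulmxA e !mulmx0.
- split=> //; apply: (highest_weight_compression (v := w) fH1 hdh AB' BA').
  + move=> j jl; rewrite weight_eps0 //.
    by rewrite (restriction_diff f1 f2 hdh (torus_lie_so C (ltn0Sn 2) jl)) tw.
  + move=> X pX; have [sX _ _] := pos_root_unipotent (ltn0Sn 2) pX.
    by rewrite (restriction_diff f1 f2 hdh sX) pw.
  by apply: contraNneq xw => e; rewrite -!mulmxA e !mulmx0.
- move=> h sh; have ps := phi_spin sh.
  have -> : A *m B' *m (A' *m fH h *m B') = A *m fH h *m B'.
    by rewrite !mulmxA -(mulmxA A B') -(mulmxA A) BA' // !mulmxA -(mulmxA _ A' B') AB' mulmx1.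
  by rewrite !mulmxA -(mulmxA _ B A) -(mulmxA A _ (B *m A)) -BA // !mulmxA AB mul1mx.
apply: contraNneq xw => e.
by rewrite -(mulmxA (star v)) -(mulmxA B) (mulmxA A) e mul0mx !mulmx0 mul0mx.
Qed.

End Branching.

(** * The generating pairs *)

Section ModelCheck.

Variables (c : nat) (gact : gmat -> gmat -> gmat).

Definition gtrace (A : gmat) : gauss := gsum (mkseq (fun i => gget A i i) c).

(** One test serves two representations: [c] is 1 for the spin representation S and 16 for S (x) S,
    whose elements are written as square matrices. The eigenvalue 2 k appears as 16 k because
    [gembed] carries a factor 8. *)
Definition model_check (roots tori sub_roots sub_tori : seq gmat) (v w : gmat) (a : seq nat)
    (k : nat) : bool :=
  let eq := geqmx (spindim 4) c in
  let scale m := gscalemx (spindim 4) c (Posz m, Posz 0) in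
  let pairing := gtrace (gmulmx c (spindim 4) c (gstarmx (spindim 4) c w) v) in
  [&& all (fun A => eq (gact A v) [::]) roots,
      all (fun j => eq (gact (nth [::] tori j) v) (scale (nth 0%N a j) v)) (iota 0 4),
      all (fun A => eq (gact A w) [::]) sub_roots,
      all (fun j => eq (gact (nth [::] sub_tori j) w)
                       (scale (if j is 0 then 16 * k else 0)%N w)) (iota 0 3)
    & pairing != g0].

End ModelCheck.

Definition gvector (s : seq gauss) : gmat := [seq [:: x] | x <- s].
Definition gspin_act (A v : gmat) : gmat := gmulmx (spindim 4) (spindim 4) 1 A v.
Definition gsquare_act (A M : gmat) : gmat :=
  let N := spindim 4 in
  gaddmx N N (gmulmx N N N A M) (gmulmx N N N M (gtrmx N N A)).

(* Highest weight vectors of the spin representation: for Spin_9, and for Spin_7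
   of weights 0 and epsilon_1. *)
Definition ghighest : gmat := gvector [:: g1].
Definition gspinor0 : gmat :=
  let m := gopp g1 in let n := gopp gi in
  gvector [:: m; gi; gi; g1; m; n; gi; m; g1; n; n; m; g1; gi; n; g1].
Definition gspinor1 : gmat :=
  let m := gopp g1 in let n := gopp gi in
  gvector [:: gi; g0; g1; g0; n; g0; m; g0; n; g0; m; g0; gi; g0; g1; g0].

(* The matrix J with X J + J X^T = 0 for X in so_9: M |-> M J turns the commutator
   action on matrices into the action on S (x) S, so that highest weight vectors
   in S (x) S are Clifford products times J. *)
Definition gcharge : gmat :=
  let m := gopp g1 in
  let s := [:: g1; m; g1; m; m; g1; m; g1; g1; m; g1; m; m; g1; m; g1] in
  gbuild 16 16 (fun i j => if eqn (i + j) 15 then nth g0 s i else g0).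

Definition gpair c (ab : nat * nat) : gmat :=
  gscaleN 4 c (gmulN 4 (ggamma 4 ab.1) (ggamma 4 ab.2)).
(** A highest weight vector of weight epsilon_1 for Spin_7 in the second exterior power of C^9,
    supported on the basis vectors 1 to 8. The basis vector 0 is the one fixed by H, so multiplying
    by gamma_0 gives a vector of the same weight in the third power. *)
Definition gbivector : gmat :=
  let m := gopp g1 in let n := gopp gi in
  gsummx 4 [:: gpair m (1, 3); gpair n (1, 5); gpair n (2, 3); gpair g1 (2, 5);
               gpair g1 (4, 6); gpair gi (4, 7); gpair n (6, 8); gpair g1 (7, 8)].

Definition gmul_charge (s : seq gmat) : gmat := foldr (gmulN 4) gcharge s.

Definition check_models (roots tori sub_roots sub_tori : seq gmat) : bool :=
  let spinor := model_check 1 gspin_act roots tori sub_roots sub_tori in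
  let square := model_check (spindim 4) gsquare_act roots tori sub_roots sub_tori in
  [&& spinor ghighest gspinor0 [:: 1; 1; 1; 1]%N 0, spinor ghighest gspinor1 [:: 1; 1; 1; 1]%N 1,
      square (gmul_charge [:: giso_plus 4 0]) (gmul_charge [:: ggamma 4 0]) [:: 2; 0; 0; 0]%N 0,
      square (gmul_charge [:: giso_plus 4 0; giso_plus 4 1]) (gmul_charge [:: gbivector])
        [:: 2; 2; 0; 0]%N 1
    & square (gmul_charge [:: giso_plus 4 0; giso_plus 4 1; giso_plus 4 2])
        (gmul_charge [:: gbivector; ggamma 4 0]) [:: 2; 2; 2; 0]%N 1].

Lemma basic_models : check_models (gpos_roots 4) (gtori 4)
  [seq gembed A | A <- gpos_roots 3] [seq gembed A | A <- gtori 3].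
Proof. by vm_compute. Qed.

Section ModelCheckCorrect.

Variables (C : numClosedFieldType) (c : nat) (gact : gmat -> gmat -> gmat).
Variable act : 'M[C]_(spindim 4) -> 'M[C]_(spindim 4, c) -> 'M[C]_(spindim 4, c).
Hypothesis act_mx : forall A v, mx_of C (spindim 4) c (gact A v) =
  act (mx_of C (spindim 4) (spindim 4) A) (mx_of C (spindim 4) c v).
Hypothesis actZ : forall d X v, act (d *: X) v = d *: act X v.

Lemma gval_eq0 x : (gval C x == 0) = (x == g0).
Proof.
apply/idP/eqP => [/eqP x0|->]; last by rewrite gval0.
case: x x0 => a b; rewrite /gval /= => e.
have e1 : 'Re ((a%:~R : C) + 'i * b%:~R) = a%:~R by rewrite Re_rect ?realz.
have e2 : 'Im ((a%:~R : C) + 'i * b%:~R) = b%:~R by rewrite Im_rect ?realz.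
move: e1 e2; rewrite e (Creal_ReP 0 _) ?real0 // (Creal_ImP 0 _) ?real0 //.
by move=> /esym/eqP; rewrite intr_eq0 => /eqP -> /esym/eqP; rewrite intr_eq0 => /eqP ->.
Qed.

Lemma model_checkP v w a k : model_check c gact (gpos_roots 4) (gtori 4)
    [seq gembed A | A <- gpos_roots 3] [seq gembed A | A <- gtori 3] v w a k ->
  let V := mx_of C (spindim 4) c v in let W := mx_of C (spindim 4) c w in
  [/\ (forall j, (j < 4)%N -> act (torus_lie C 4 j) V = (nth 0%N a j)%:R *: V) /\
      (forall X, pos_root X -> act X V = 0),
      (forall j, (j < 3)%N -> act (embed_lie (torus_lie C 3 j)) W =
         (if j == 0 then k%:R *+ 2 else 0) *: W) /\
      (forall X, pos_root X -> act (embed_lie X) W = 0)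
    & \tr (star W *m V) != 0].
Proof.
case/and5P=> /allP pv /allP tv /allP pw /allP tw nz V W.
have n8 : 8 != 0 :> C by rewrite pnatr_eq0.
have scaleE m (u : gmat) : mx_of C (spindim 4) c (gscalemx (spindim 4) c (Posz m, Posz 0) u)
    = m%:R *: mx_of C (spindim 4) c u.
  by rewrite mx_ofZ /gval /= mulr0 addr0.
split.
- split=> [j jl|X pX].
    have := tv j; rewrite mem_iota => /(_ jl)/(geqmxP C).
    by rewrite scaleE act_mx (nth_map 0%N) ?size_iota // nth_iota // add0n mx_of_torus.
  have [A hA ->] := pos_root_list pX.
  by have := geqmxP C (pv _ hA); rewrite [RHS]mx_of_nil act_mx.
- split=> [j jl|X pX].
    have := tw j; rewrite mem_iota => /(_ jl)/(geqmxP C).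
    rewrite scaleE act_mx (nth_map [::]) ?size_map ?size_iota // (nth_map 0%N) ?size_iota //.
    rewrite nth_iota // add0n mx_of_embed actZ mx_of_torus => e.
    apply: (scalerI n8); rewrite e scalerA; congr (_ *: _).
    by case: (j) => [|j'] /=; rewrite ?mulr0 // -[k%:R *+ 2]mulrnA -natrM; congr (_%:R); lia.
  have [A hA ->] := pos_root_list pX.
  have := geqmxP C (pw _ (map_f _ hA)); rewrite [RHS]mx_of_nil act_mx mx_of_embed actZ => e.
  by apply: (scalerI n8); rewrite e scaler0.
rewrite -gval_eq0 in nz; move: nz; congr (_ != 0).
rewrite /gtrace gval_sum /mxtrace; apply: eq_bigr => i _.
have := mx_ofM C c (spindim 4) c (gstarmx (spindim 4) c w) v.
by rewrite mx_of_star => /matrixP/(_ i i); rewrite [LHS]mxE.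
Qed.

End ModelCheckCorrect.

Section BasicModels.

Variable C : numClosedFieldType.

Lemma spin_rep_morphism l : alg_morphism (@spin C l) id.
Proof.
split=> // i j; exists 'X_(mxvec_index i j) => g _.
by rewrite mevalXU mxvecE.
Qed.

Lemma spin_rep_diff l : is_diff (@spin C l) id (idfun : {linear 'M[C]_(spindim l) -> 'M[C]_(spindim l)}).
Proof. by move=> q a G G1 _ _. Qed.

Lemma spinor_model v w a k :
  model_check 1 gspin_act (gpos_roots 4) (gtori 4)
    [seq gembed A | A <- gpos_roots 3] [seq gembed A | A <- gtori 3] v w a k -> model C (nth 0%N a) k.
Proof.
have act_mx A u : mx_of C (spindim 4) 1 (gspin_act A u) =
  mx_of C (spindim 4) (spindim 4) A *m mx_of C (spindim 4) 1 u by rewrite mx_ofM.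
have actZ d (X : 'M[C]_(spindim 4)) (u : 'cV_(spindim 4)) : (d *: X) *m u = d *: (X *m u).
  by rewrite scalemxAl.
case/(model_checkP act_mx actZ) => hv hw nz; exists (spindim 4), id, idfun, (mx_of C (spindim 4) 1 v), (mx_of C (spindim 4) 1 w).
split=> //; last by apply: contraNneq nz => ->; rewrite mxtrace0.
split=> [|||c _]; [exact: spin_rep_morphism|by move=> q x G G1 _ _|by []|by exists c].
Qed.

Lemma mx_of_square N A B :
  mx_of C N N (gaddmx N N (gmulmx N N N A B) (gmulmx N N N B (gtrmx N N A))) =
  mx_of C N N A *m mx_of C N N B + mx_of C N N B *m (mx_of C N N A)^T.
Proof. by rewrite mx_ofD !mx_ofM mx_ofT. Qed.

Lemma square_model v w a k :
  model_check (spindim 4) gsquare_act (gpos_roots 4) (gtori 4)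
    [seq gembed A | A <- gpos_roots 3] [seq gembed A | A <- gtori 3] v w a k -> model C (nth 0%N a) k.
Proof.
pose sq_act (X M : 'M[C]_(spindim 4)) := X *m M + M *m X^T.
have act_mx A u : mx_of C (spindim 4) (spindim 4) (gsquare_act A u) =
    sq_act (mx_of C (spindim 4) (spindim 4) A) (mx_of C (spindim 4) (spindim 4) u).
  exact: mx_of_square.
have actZ d X u : sq_act (d *: X) u = d *: sq_act X u.
  by rewrite /sq_act linearZ /= -scalemxAl -scalemxAr scalerDr.
have id_morph := @spin_rep_morphism 4; have id_diff := @spin_rep_diff 4.
have sq := tens_morphism id_morph id_morph.
have [D hD] := regular_diff (let: And3 _ _ h := sq in h).
have act X M : so_lie X -> D X *m vec M = vec (X *m M + M *m X^T).
  exact: (diff_tens id_morph id_morph id_diff id_diff hD).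
case/(model_checkP act_mx actZ); rewrite /sq_act.
set V := mx_of _ _ _ v; set W := mx_of _ _ _ w => -[tv pv] [tw pw] nz.
exists _, (fun x => x *t x), D, (vec V), (vec W); split.
- split=> // [g sg|c sc]; first by rewrite star_tens.
  exists (c * c); rewrite -[c%:M]scalemx1 -[(c * c)%:M]scalemx1 -tens1.
  by apply/matrixP => i j; rewrite !mxE mulrACA.
- split=> [j jl|X pX]; first by rewrite act ?tv ?vecZ //; apply: torus_lie_so.
  rewrite act ?pv ?vec0 //.
  by have [] := pos_root_unipotent (ltn0Sn 3) pX.
- split=> [j jl|X pX].
    rewrite act ?tw ?vecZ //; exact/embed_lie_so/torus_lie_so.
  rewrite act ?pw ?vec0 //; apply: embed_lie_so.
  by have [] := pos_root_unipotent (ltn0Sn 2) pX.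
rewrite star_vec; apply/negP => /eqP/matrixP/(_ 0 0).
by rewrite !mxE mulr1n => e; rewrite e eqxx in nz.
Qed.

Lemma model_eq a b k : (forall j, (j < 4)%N -> a j = b j) -> model C a k -> model C b k.
Proof.
move=> ab [n [rho [drho [v [w [h [tv pv] hw nz]]]]]].
exists n, rho, drho, v, w; split=> //; split=> // j jl.
by rewrite -ab // tv.
Qed.

(** The factors for varpi_2 and varpi_3 contribute n2 + n3 to k. Of the n4 factors for varpi_4, k -
    (n2 + n3) are taken from the pair (varpi_4, 1) and n2 + n3 + n4 - k from (varpi_4, 0); the
    bounds on k make both numbers meaningful. *)
Lemma dominant_model (n1 n2 n3 n4 k : nat) : (n2 + n3 <= k <= n2 + n3 + n4)%N ->
  model C (nth 0%N [:: 2 * (n1 + n2 + n3) + n4; 2 * (n2 + n3) + n4; 2 * n3 + n4; n4]%N) k.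
Proof.
move=> /andP[k1 k2].
have /and5P[/spinor_model m40 /spinor_model m41 /square_model m1 /square_model m2
  /square_model m3] := basic_models.
have := model_add (model_add (model_add (model_add (model_muln n1 m1) (model_muln n2 m2))
  (model_muln n3 m3)) (model_muln (k - (n2 + n3)) m41)) (model_muln (n2 + n3 + n4 - k) m40).
have -> : (n1 * 0 + n2 * 1 + n3 * 1 + (k - (n2 + n3)) * 1 + (n2 + n3 + n4 - k) * 0 = k)%N.
  by rewrite !muln0 !muln1 add0n addn0 subnKC.
apply: model_eq => -[|[|[|[|//]]]] _ /=; lia.
Qed.

End BasicModels.

(** * Dominant weights *)

Section Weights.

Lemma ord4_cases (P : 'I_4 -> Prop) : P 0 -> P 1 -> P 2 -> P 3 -> forall i, P i.
Proof.
move=> P0 P1 P2 P3 [[|[|[|[|//]]]] p].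
- by have -> : Ordinal p = 0 by apply/val_inj.
- by have -> : Ordinal p = 1 by apply/val_inj.
- by have -> : Ordinal p = 2 by apply/val_inj.
by have -> : Ordinal p = 3 by apply/val_inj.
Qed.

Definition weight4 (n1 n2 n3 n4 : nat) : 'rV[rat]_4 :=
  varpi1 *+ n1 + varpi2 *+ n2 + varpi3 *+ n3 + varpi4 *+ n4.

Lemma weight4E n1 n2 n3 n4 : let lam := weight4 n1 n2 n3 n4 in
  [/\ lam 0 0 = n1%:R + n2%:R + n3%:R + n4%:R / 2, lam 0 1 = n2%:R + n3%:R + n4%:R / 2,
      lam 0 2 = n3%:R + n4%:R / 2 & lam 0 3 = n4%:R / 2].
Proof.
have w (j : 'I_4) m : j = m :> nat -> weight4 n1 n2 n3 n4 0 j =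
    (m == 0)%:R *+ n1 + ((m == 0)%:R + (m == 1)%:R) *+ n2
    + ((m == 0)%:R + (m == 1)%:R + (m == 2)%:R) *+ n3
    + ((1 / 2) * ((m == 0)%:R + (m == 1)%:R + (m == 2)%:R + (m == 3)%:R)) *+ n4.
  move=> <-; rewrite /weight4 /varpi1 /varpi2 /varpi3 /varpi4.
  by rewrite !(mulmxnE, mxE) !eqxx.
rewrite /= (w 0 0%N erefl) (w 1 1%N erefl) (w 2 2%N erefl) (w 3 3%N erefl).
by split; rewrite /=; ring.
Qed.

Lemma int_nat (x : rat) : x \is a Num.int -> 0 <= x -> exists n : nat, x = n%:R.
Proof. by move=> xi x0; apply/natrP; rewrite natrEint xi. Qed.

(** The coefficients are the successive differences of the coordinates and twice the last
    coordinate. The parity of n4 decides between integers and half-integers. *)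
Lemma dominantP (lam : 'rV[rat]_4) : dominant lam <->
  exists n1 n2 n3 n4, lam = weight4 n1 n2 n3 n4.
Proof.
split=> [[mono pos integral]|[n1 [n2 [n3 [n4 ->]]]]].
  have dint i j : lam 0 i - lam 0 j \is a Num.int.
    case: integral => h; first by rewrite rpredB.
    by have := rpredB (h i) (h j); rewrite opprB addrA subrK.
  have int2 i : 2 * lam 0 i \is a Num.int.
    case: integral => h; first by rewrite rpredM // natr_int.
    have -> : 2 * lam 0 i = 2 * (lam 0 i - 1 / 2) + 1 by field.
    by rewrite rpredD ?rpredM ?natr_int ?rpred1.
  have [n1 e1] : exists n : nat, lam 0 0 - lam 0 1 = n%:R.
    by apply: int_nat; rewrite ?subr_ge0 ?mono.
  have [n2 e2] : exists n : nat, lam 0 1 - lam 0 2 = n%:R.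
    by apply: int_nat; rewrite ?subr_ge0 ?mono.
  have [n3 e3] : exists n : nat, lam 0 2 - lam 0 3 = n%:R.
    by apply: int_nat; rewrite ?subr_ge0 ?mono.
  have [n4 e4] : exists n : nat, 2 * lam 0 3 = n%:R.
    by apply: int_nat; rewrite ?mulr_ge0 ?pos.
  exists n1, n2, n3, n4; have [f0 f1 f2 f3] := weight4E n1 n2 n3 n4.
  apply/rowP; apply: ord4_cases; rewrite ?f0 ?f1 ?f2 ?f3; lra.
have [f0 f1 f2 f3] := weight4E n1 n2 n3 n4.
have p1 := ler0n rat n1; have p2 := ler0n rat n2; have p3 := ler0n rat n3; have p4 := ler0n rat n4.
split.
- apply: ord4_cases; apply: ord4_cases => //= _; rewrite ?f0 ?f1 ?f2 ?f3; lra.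
- by apply: ord4_cases; rewrite ?f0 ?f1 ?f2 ?f3; lra.
have half : n4%:R / 2 = (odd n4)%:R / 2 + (n4./2)%:R :> rat.
  by rewrite -{1}(odd_double_half n4) natrD -mul2n natrM; field.
case: (odd n4) half => /= half; [right|left]; apply: ord4_cases; rewrite ?f0 ?f1 ?f2 ?f3 half.
- rewrite (_ : _ - _ = (n1 + n2 + n3 + n4./2)%:R) ?natr_int // !natrD; ring.
- rewrite (_ : _ - _ = (n2 + n3 + n4./2)%:R) ?natr_int // !natrD; ring.
- rewrite (_ : _ - _ = (n3 + n4./2)%:R) ?natr_int // !natrD; ring.
- rewrite (_ : _ - _ = (n4./2)%:R) ?natr_int //; ring.
all: by rewrite mul0r add0r ?rpredD ?natr_int.
Qed.

Lemma weight4_numq n1 n2 n3 n4 j : (j < 4)%N ->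
  numq (2 * weight4 n1 n2 n3 n4 0 (inord j)) =
  (nth 0%N [:: 2 * (n1 + n2 + n3) + n4; 2 * (n2 + n3) + n4; 2 * n3 + n4; n4]%N j)%:Z.
Proof.
move=> j4; have [f0 f1 f2 f3] := weight4E n1 n2 n3 n4.
suff -> : 2 * weight4 n1 n2 n3 n4 0 (inord j) =
  (nth 0%N [:: 2 * (n1 + n2 + n3) + n4; 2 * (n2 + n3) + n4; 2 * n3 + n4; n4]%N j)%:Z%:~R.
  exact: numq_int.
have ordE (i : 'I_4) : (i = j :> nat) -> inord j = i by move=> <-; rewrite inord_val.
case: j j4 ordE => [|[|[|[|//]]]] _ ordE.
- by rewrite (ordE 0 erefl) f0 /= -pmulrn !(natrD, natrM); field.
- by rewrite (ordE 1 erefl) f1 /= -pmulrn !(natrD, natrM); field.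
- by rewrite (ordE 2 erefl) f2 /= -pmulrn !(natrD, natrM); field.
by rewrite (ordE 3 erefl) f3 /= -pmulrn; field.
Qed.

End Weights.

(** * The multiplicity and the bijection *)

Section Main.

Variables (C : numClosedFieldType) (phi : 'M[C]_(spindim 3) -> 'M[C]_(spindim 4)).
Hypothesis hphi : spin7_embedding phi.

(** In fundamental coordinates a_2 - a_4 = n2 + n3 and a_2 + a_4 = n2 + n3 + n4. Intertwiners for
    phi and for its normal form correspond under T |-> V (x^-1) T, so both directions are proved for
    the normal form. *)
Lemma multiplicity_one (k n1 n2 n3 n4 : nat) :
  has_mult phi (weight4 n1 n2 n3 n4) (eps 0 *+ k : 'rV[rat]_3) 1 <->
  (n2 + n3 <= k <= n2 + n3 + n4)%N.
Proof.
have [x sx [phi0_morph phi0_spin phi0_image]] := spin7_normal_form hphi.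
set phi0 := fun h => _ in phi0_morph phi0_spin phi0_image.
have [_ phi_spin _] := hphi.
have xu := spin_unitmx sx; have sx' := spin_invmx sx.
have invV n (V : 'M_(spindim 4) -> 'M[C]_n) : alg_morphism (@spin C 4) V ->
    V x *m V (invmx x) = 1%:M /\ V (invmx x) *m V x = 1%:M.
  by case=> V1 VM _; rewrite -!VM // mulmxV // mulVmx.
have twist n p (V : 'M_(spindim 4) -> 'M[C]_n) (W : 'M_(spindim 3) -> 'M[C]_p) T :
    alg_morphism (@spin C 4) V -> intertwiner phi V W T <-> intertwiner phi0 V W (V (invmx x) *m T).
  move=> V_morph; have [Vx Vx'] := invV n V V_morph; have [_ VM _] := V_morph.
  have Vphi h : spin h -> V (phi0 h) *m V (invmx x) = V (invmx x) *m V (phi h).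
    move=> sh; have sp := phi_spin h sh; have sp0 := phi0_spin h sh.
    by rewrite -!VM // /phi0 mulmxK.
  split=> int h sh; first by rewrite -mulmxA int // !mulmxA Vphi.
  have := int h sh; rewrite -mulmxA [RHS]mulmxA Vphi // -[RHS]mulmxA.
  by move/(congr1 (mulmx (V x))); rewrite !mulmxA Vx !mul1mx.
split=> [[n [V [p [W [Hom [V_irr W_irr HomP dim1]]]]]]|k_bounds].
  have V_morph : alg_morphism (@spin C 4) V by case: V_irr => -[].
  have W_morph : alg_morphism (@spin C 3) W by case: W_irr => -[].
  have [dV hV] := regular_diff (let: And3 _ _ h := V_morph in h).
  have [dW hW] := regular_diff (let: And3 _ _ h := W_morph in h).
  have T0 : vpick Hom != 0 by rewrite vpick0 -dimv_eq0 dim1.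
  have Tint : intertwiner phi V W (vpick Hom) by apply/HomP/memv_pick.
  have T0' : V (invmx x) *m vpick Hom != 0.
    have [Vx _] := invV n V V_morph.
    by apply: contraNneq T0 => e; rewrite -[vpick Hom]mul1mx -Vx -mulmxA e mulmx0.
  have [_ [m [M [mM e3 e1]]]] := multiplicity_bound phi0_morph phi0_spin phi0_image V_irr W_irr
    hV hW ((twist _ _ _ _ _ V_morph).1 Tint) T0'.
  (* Here M = n4 and k + m = n2 + n3 + n4 with 0 <= m <= n4. *)
  move: e3 e1; rewrite !weight4_numq //=; lia.
have [n [p [V [W [T [V_irr W_irr Tint T0]]]]]] := model_branching phi0_morph phi0_spin phi0_image
  (dominant_model C n1 k_bounds) (@weight4_numq n1 n2 n3 n4).
have V_morph : alg_morphism (@spin C 4) V by case: V_irr => -[].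
have W_morph : alg_morphism (@spin C 3) W by case: W_irr => -[].
have [dV hV] := regular_diff (let: And3 _ _ h := V_morph in h).
have [dW hW] := regular_diff (let: And3 _ _ h := W_morph in h).
have [uniq _] := multiplicity_bound phi0_morph phi0_spin phi0_image V_irr W_irr hV hW Tint T0.
have [Vx Vx'] := invV n V V_morph.
exists n, V, p, W, <[V x *m T]>%VS; split=> // [f|].
  split=> [/vlineP[c ->]|fint].
    suff : intertwiner phi V W (c *: (V x *m T)) by [].
    apply: (twist _ _ _ _ _ V_morph).2 => h sh.
    by rewrite -!scalemxAr (mulmxA (V (invmx x))) Vx' mul1mx -scalemxAl Tint.
  have /uniq[c e] := (twist _ _ _ _ _ V_morph).1 fint.
  apply/vlineP; exists c.
  by rewrite scalemxAr -e mulmxA Vx mul1mx.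
rewrite dim_vline; case: eqVneq => // e; case/eqP: T0.
by rewrite -[T]mul1mx -Vx' -mulmxA e mulmx0.
Qed.

End Main.

(** s + t of the k copies of varpi_4 are traded for varpi_2 and varpi_3. For fixed k, the
    fundamental coordinates of the sum return a, s, t and then b, which is the injectivity of the
    map. *)
Lemma cone_plus_B (a b s t k : nat) : (s + t <= k)%N ->
  (varpi1 *+ a + varpi4 *+ b) +
    ((varpi2 - varpi4) *+ s + (varpi3 - varpi4) *+ t + varpi4 *+ k)
  = weight4 a s t (b + (k - (s + t))).
Proof.
move=> st; have e : varpi4 *+ k = varpi4 *+ (k - (s + t)) + (varpi4 *+ s + varpi4 *+ t).
  by rewrite -!mulrnDr subnK.
rewrite e /weight4 !mulrnBl mulrnDr.
move: (varpi1 *+ a) (varpi2 *+ s) (varpi3 *+ t) (varpi4 *+ s) (varpi4 *+ t) (varpi4 *+ b)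
  (varpi4 *+ (k - (s + t))) => u1 u2 u3 u4 u5 u6 u7.
by apply/rowP => j; rewrite !mxE; ring.
Qed.

Lemma weight4_inj n1 n2 n3 n4 m1 m2 m3 m4 :
  weight4 n1 n2 n3 n4 = weight4 m1 m2 m3 m4 -> [/\ n1 = m1, n2 = m2, n3 = m3 & n4 = m4].
Proof.
move=> e; have [f0 f1 f2 f3] := weight4E n1 n2 n3 n4.
have := weight4E m1 m2 m3 m4; rewrite -e /= f0 f1 f2 f3 => -[e0 e1 e2 e3].
by split; apply/eqP; rewrite -(eqr_nat rat); apply/eqP; lra.
Qed.

Theorem theorem4p1 (R : realType)
    (phi : 'M[R[i]]_(spindim 3) -> 'M[R[i]]_(spindim 4))
    (hphi : spin7_embedding phi) (k : nat) :
  let mu : 'rV[rat]_3 := eps 0 *+ k in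
  Pplus phi mu
    = [set lam : 'rV[rat]_4 | dominant lam
        /\ lam 0 1 - lam 0 3 <= k%:R <= lam 0 1 + lam 0 3]
  /\ set_bij (cone14 `*` Bset k) (Pplus phi mu) (fun p => p.1 + p.2).
Proof.
move=> mu.
have PplusE lam : Pplus phi mu lam <-> exists n1 n2 n3 n4,
    (n2 + n3 <= k <= n2 + n3 + n4)%N /\ lam = weight4 n1 n2 n3 n4.
  split=> [[/dominantP[n1 [n2 [n3 [n4 ->]]]] hm]|[n1 [n2 [n3 [n4 [hk ->]]]]]].
    by exists n1, n2, n3, n4; split=> //; exact: (multiplicity_one hphi _ _ _ _ _).1 hm.
  split; first by apply/dominantP; exists n1, n2, n3, n4.
  exact: (multiplicity_one hphi _ _ _ _ _).2 hk.
have boundsE n1 n2 n3 n4 : let lam := weight4 n1 n2 n3 n4 in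
    (lam 0 1 - lam 0 3 <= k%:R <= lam 0 1 + lam 0 3) = (n2 + n3 <= k <= n2 + n3 + n4)%N.
  have [_ f1 _ f3] := weight4E n1 n2 n3 n4.
  rewrite /= f1 f3 addrK -addrA -splitr -!natrD !ler_nat; congr (_ && _).
split.
  apply/seteqP; split=> lam.
    move=> /PplusE[n1 [n2 [n3 [n4 [hk ->]]]]]; split; last by rewrite boundsE.
    by apply/dominantP; exists n1, n2, n3, n4.
  case=> /dominantP[n1 [n2 [n3 [n4 ->]]]]; rewrite boundsE => hk.
  by apply/PplusE; exists n1, n2, n3, n4.
split.
- move=> [_ _] [/= [a [b ->]] [s [t [st ->]]]]; rewrite cone_plus_B //.
  apply/PplusE; exists a, s, t, (b + (k - (s + t)))%N; split=> //; lia.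
- move=> [sigma x] [sigma' x']; rewrite !inE => -[/= [a [b ->]] [s [t [st ->]]]].
  move=> -[/= [a' [b' ->]] [s' [t' [st' ->]]]]; rewrite !cone_plus_B // => /weight4_inj.
  by case=> -> es et eb; subst s' t'; have -> : b = b' by lia.
move=> lam /PplusE[n1 [n2 [n3 [n4 [/andP[k1 k2] ->]]]]].
(* The coefficient of varpi_4 in the cone is the slack in the upper bound k <= n2 + n3 + n4; the
   lower bound n2 + n3 <= k is the condition that defines [Bset]. *)
exists (varpi1 *+ n1 + varpi4 *+ (n2 + n3 + n4 - k),
        (varpi2 - varpi4) *+ n2 + (varpi3 - varpi4) *+ n3 + varpi4 *+ k).
  split=> /=; first by exists n1, (n2 + n3 + n4 - k)%N.
  by exists n2, n3.
rewrite /= cone_plus_B //; congr weight4; lia.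
Qed.
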